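(* Let $L$ be an oriented dichromatic singular link in $\mathbb{R}^3$ and let $D$ be a diagram of $L$. Then for any finite oriented disingquandle $(X,*_1,*_2,R_1,R_2)$, the cardinality $\sharp\,\mathrm{Col}^{odsq}_X(D)$ of the set of oriented disingquandle $X$-colorings of $D$ is an invariant of $L$. That is, if $D'$ is any other oriented dichromatic singular link diagram of $L$ (so that $D'$ is obtained from $D$ by planar isotopy and a finite sequence of generalized oriented dichromatic singular Reidemeister moves), then $\sharp\,\mathrm{Col}^{odsq}_X(D')=\sharp\,\mathrm{Col}^{odsq}_X(D)$.
   Context: **Quandles.** A quandle $(X,* )$ is a set with a binary operation such that $x*x=x$; for each $y$ the map $x\mapsto x*y$ is a bijection of $X$, with inverse written $x\mapsto x\,\bar{*}\,y$; and $(x*y)*z=(x*z)*(y*z)$, for all $x,y,z\in X$. For operations $*_1,*_2$ the inverse operations are $\bar{*}_1,\bar{*}_2$. **Oriented singquandles.** $(X,*,R_1,R_2)$, with $(X,* )$ a quandle and $R_1,R_2:X\times X\to X$ maps, is an oriented singquandle if for all $x,y,z\in X$: - $R_1(x\,\bar{*}\,y,z)*y=R_1(x,z*y)$, - $R_2(x\,\bar{*}\,y,z)=R_2(x,z*y)\,\bar{*}\,y$, - $(y\,\bar{*}\,R_1(x,z))*x=(y*R_2(x,z))\,\bar{*}\,z$, - $R_2(x,y)=R_1(y,x*y)$, - $R_1(x,y)*R_2(x,y)=R_2(y,x*y)$. **Oriented disingquandles.** $(X,*_1,*_2,R_1,R_2)$ is an oriented disingquandle if $(X,*_1)$ and $(X,*_2)$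 are quandles, $(X,*_1,R_1,R_2)$ and $(X,*_2,R_1,R_2)$ are oriented singquandles, and for all $x,y,z\in X$: - $(y\,\bar{*}_1R_1(x,z))*_2x=(y*_2R_2(x,z))\,\bar{*}_1z$, - $(y\,\bar{*}_2R_1(x,z))*_1x=(y*_1R_2(x,z))\,\bar{*}_2z$, - $R_1(x,y)*_1R_2(x,y)=R_2(y,x*_2y)$, - $R_1(x,y)*_2R_2(x,y)=R_2(y,x*_1y)$. **Links and diagrams.** A singular link is a link in $\mathbb{R}^3$ allowed to have finitely many transverse double points (singular points). An oriented dichromatic singular link is an oriented singular link each of whose components is labelled by either $1$ or $2$. It is represented by a planar diagram with classical crossings and singular crossings, with orientations and labels on components (a component passes straight through each crossing, classical or singular). **Moves and equivalence.** The generalized oriented dichromatic singular Reidemeister moves are the following local moves, which preserve orientations, singular crossings and labels, with arbitrary labels $i,j,k\in\{1,2\}$ on the strands involved: the classical Reidemeister moves $RI$, $RII$, $RIII$; $RIVa$: a strand is moved over a singular crossing; $RIVb$: a strand is moved under a singular crossing; $RV$: a classical crossing between the two strands of a singular crossing, located just before the singular crossing, is moved to a classical crossing of the same sign just after it (the two outgoing strands crossing, in place of the two incoming ones). Two oriented dichromatic singular links are equivalent if and only if their diagrams are related by planar isotopy and a finite sequence of these moves; an invariant is a quantity depending only on the equivalence class. **Colorings.** The arcs of a diagram $D$ are its connected pieces ending at undercrossings and at singular crossings; $\mathcal{A}(D)$ is the set of arcs. An oriented disingquandle $X$-coloring of $D$ is a map $\mathcal{C}:\mathcal{A}(D)\to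 X$ such that: - at a classical crossing whose over-arc belongs to a component labelled $j\in\{1,2\}$ and has color $y$, if the incoming under-arc has color $x$, then the outgoing under-arc has color $x*_jy$ if the crossing is positive and $x\,\bar{*}_jy$ if it is negative; - at a singular crossing, drawn with both strands oriented downward, if the top-left incoming arc has color $x$ and the top-right incoming arc has color $y$, then the bottom-left outgoing arc has color $R_1(x,y)$ and the bottom-right outgoing arc has color $R_2(x,y)$. $\mathrm{Col}^{odsq}_X(D)$ denotes the set of all such colorings.
   Formalization: The disingquandle is also assumed to satisfy (x*_a y)*_b z = (x*_b z)*_a(y*_b z) for {a,b}={1,2}; without this law the count can change under RIII with different labels, so the statement as given is false. *)

(* Defs.v *)
From Stdlib Require Export Relation_Operators.
From mathcomp Require Export all_boot all_order all_fingroup all_algebra.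
From mathcomp Require Export boolp classical_sets reals topology normedtype.

Set Implicit Arguments.
Unset Strict Implicit.
Unset Printing Implicit Defensive.

Import Order.TTheory GRing.Theory Num.Theory numFieldNormedType.Exports.

Local Open Scope ring_scope.
Local Open Scope classical_set_scope.

(** * Quandles, singquandles, disingquandles *)

(* [qop x y] is x * y and [qbar x y] is the inverse operation applied to x. *)
Record quandle (X : Type) := Quandle {
  qop : X -> X -> X;
  qbar : X -> X -> X;
  qop_idem : forall x, qop x x = x;
  qopK : forall y, cancel (qop^~ y) (qbar^~ y);
  qbarK : forall y, cancel (qbar^~ y) (qop^~ y);
  qop_dist : forall x y z, qop (qop x y) z = qop (qop x z) (qop y z)
}.

Record singquandle_axioms (X : Type) (Q : quandle X) (R1 R2 : X -> X -> X) :
    Prop := SingquandleAxioms {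
  sq_R1 : forall x y z, qop Q (R1 (qbar Q x y) z) y = R1 x (qop Q z y);
  sq_R2 : forall x y z, R2 (qbar Q x y) z = qbar Q (R2 x (qop Q z y)) y;
  sq_under : forall x y z,
    qop Q (qbar Q y (R1 x z)) x = qbar Q (qop Q y (R2 x z)) z;
  sq_R12 : forall x y, R2 x y = R1 y (qop Q x y);
  sq_twist : forall x y, qop Q (R1 x y) (R2 x y) = R2 y (qop Q x y)
}.

Record disingquandle (X : Type) := Disingquandle {
  Q1 : quandle X;
  Q2 : quandle X;
  R1 : X -> X -> X;
  R2 : X -> X -> X;
  dsq_sing1 : singquandle_axioms Q1 R1 R2;
  dsq_sing2 : singquandle_axioms Q2 R1 R2;
  dsq_under12 : forall x y z,
    qop Q2 (qbar Q1 y (R1 x z)) x = qbar Q1 (qop Q2 y (R2 x z)) z;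
  dsq_under21 : forall x y z,
    qop Q1 (qbar Q2 y (R1 x z)) x = qbar Q2 (qop Q1 y (R2 x z)) z;
  dsq_twist12 : forall x y, qop Q1 (R1 x y) (R2 x y) = R2 y (qop Q2 x y);
  dsq_twist21 : forall x y, qop Q2 (R1 x y) (R2 x y) = R2 y (qop Q1 x y)
}.

Inductive label := One | Two.

Definition dsq_quandle (X : Type) (Q : disingquandle X) (l : label) :
    quandle X :=
  if l is One then Q1 Q else Q2 Q.

(* The axioms of disingquandles do not imply this property, and the colorings
   by a finite disingquandle are counted by an invariant only if it holds: it is
   the third Reidemeister move for strands of different labels. *)
Definition mixed_distributive (X : Type) (Q : disingquandle X) : Prop :=
  (forall x y z, qop (Q2 Q) (qop (Q1 Q) x y) z =
                 qop (Q1 Q) (qop (Q2 Q) x z) (qop (Q2 Q) y z)) /\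
  (forall x y z, qop (Q1 Q) (qop (Q2 Q) x y) z =
                 qop (Q2 Q) (qop (Q1 Q) x z) (qop (Q1 Q) y z)).

(** * Polygonal diagrams *)

(* The abstract link: a finite set of oriented edges, each followed by the edge
   [next].  The components are the cycles of [next]; since [next (next e) != e],
   each of them is a polygon with at least three edges. *)
Record skeleton := Skeleton {
  edge : finType;
  next : {perm edge};
  lab : edge -> label;
  lab_next : forall e, lab (next e) = lab e;
  next_next : forall e, next (next e) != e
}.

(* [layer e f] is the position of [e] with respect to [f] at their crossing. *)
Inductive layer := Over | Under | Sing.

Definition opposite (l : layer) : layer :=
  match l with Over => Under | Under => Over | Sing => Sing end.

Section Geometry.
Variables (R : realType) (S : skeleton).

(* [p e] is the initial vertex of the edge [e]. *)
Definition position := edge S -> 'rV[R]_2.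
Definition layering := edge S -> edge S -> layer.

Variables (p : position) (i : layering).

Definition dir (e : edge S) : 'rV[R]_2 := p (next S e) - p e.

Definition point (e : edge S) (t : R) : 'rV[R]_2 := p e + t *: dir e.

Definition segment (e : edge S) : set 'rV[R]_2 :=
  [set x | exists2 t : R, 0 <= t <= 1 & x = point e t].

Definition crosses (e f : edge S) : Prop :=
  [/\ e != f, next S e != f, next S f != e &
      exists x, segment e x /\ segment f x].

(* A diagram in general position: a vertex lies on no edge other than the two
   edges which it ends, and three edges have no common point.  As a consequence
   two edges that cross do so transversally, at a single point interior to both.
   The value of [i e f] is meaningful only when [e] and [f] cross. *)
Definition regular : Prop :=
  [/\ forall e f : edge S, f != e -> next S f != e -> ~ segment f (p e),
      forall e f g : edge S, e != f -> f != g -> e != g ->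
        segment e `&` segment f `&` segment g = set0 &
      forall e f : edge S, crosses e f -> i f e = opposite (i e f)].

Definition hits (e f : edge S) (t : R) : Prop :=
  0 <= t <= 1 /\ segment f (point e t).

(* Along [e], the crossing with [f] comes before the crossing with [g]. *)
Definition before (e f g : edge S) : Prop :=
  exists s t : R, [/\ hits e f s, hits e g t & s < t].

Definition det2 (u v : 'rV[R]_2) : R :=
  u ord0 ord0 * v ord0 ord_max - u ord0 ord_max * v ord0 ord0.

(* The classical crossing of [e] and [f] is positive when the direction of the
   over-strand followed by that of the under-strand is a positive frame. *)
Definition positive_crossing (e f : edge S) : bool :=
  if i e f is Over then 0 < det2 (dir e) (dir f)
  else 0 < det2 (dir f) (dir e).

End Geometry.

Record diagram (R : realType) := Diagram {
  skel :> skeleton;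
  pos : position R skel;
  lay : layering skel;
  diagram_regular : regular pos lay
}.

Arguments pos {R} d.
Arguments lay {R} d.

(** * Arcs *)

Section Arcs.
Variables (R : realType) (D : diagram R).

(* [e] is interrupted at its crossing with [f]. *)
Definition cut (e f : edge D) : Prop :=
  crosses (pos D) e f /\ lay D e f <> Over.

(* The cuts divide each edge into pieces: [(e, None)] is the piece of [e] that
   starts at the initial vertex of [e], and [(e, Some f)] is the piece of [e]
   that starts at the cut of [e] by [f]. *)
Definition is_piece (x : edge D * option (edge D)) : bool :=
  if x.2 is Some f then `[< cut x.1 f >] else true.

Definition piece : finType := {x : edge D * option (edge D) | is_piece x}.

Definition starts_before (x : piece) (f : edge D) : Prop :=
  if (val x).2 is Some g then before (pos D) (val x).1 g f else True.

(* [x] is the piece of [e] that ends at the crossing of [e] with [f], or that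
   goes through this crossing if [e] is not cut there. *)
Definition reaches (x : piece) (e f : edge D) : Prop :=
  [/\ (val x).1 = e, starts_before x f &
      forall g, cut e g -> before (pos D) e g f -> ~ starts_before x g].

(* [x] runs to the terminal vertex of its edge, where [y] continues it. *)
Definition continued (x y : piece) : Prop :=
  val y = (next D (val x).1, None) /\
  forall g, cut (val x).1 g -> ~ starts_before x g.

Definition same_arc (x y : piece) : bool :=
  connect (fun a b => `[< continued a b \/ continued b a >]) x y.

Definition arcs : {set {set piece}} :=
  [set [set y | same_arc x y]%SET | x : piece]%SET.

Definition arc : finType := {A : {set piece} | A \in arcs}.

Definition arc_of (x : piece) : arc :=
  exist _ [set y | same_arc x y]%SET (imset_f _ (isT : x \in predT)).

End Arcs.

(** * Colorings *)

Section Colorings.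
Variables (R : realType) (D : diagram R) (X : finType) (Q : disingquandle X).

Record is_coloring (C : {ffun arc D -> X}) : Prop := IsColoring {
  (* [e] passes under [f]; [u] arrives at the crossing and [u'] leaves it. *)
  coloring_classical : forall (e f : edge D) (u u' v : piece D),
    crosses (pos D) e f -> lay D e f = Under ->
    reaches u e f -> val u' = (e, Some f) -> reaches v f e ->
    C (arc_of u') =
      (if positive_crossing (pos D) (lay D) e f
       then qop (dsq_quandle Q (lab f))
       else qbar (dsq_quandle Q (lab f))) (C (arc_of u)) (C (arc_of v));
  (* When both strands are drawn downward, the one that goes from the top left
     to the bottom right is the [e] such that [det2 (dir e) (dir f) < 0]. *)
  coloring_singular : forall (e f : edge D) (u u' v v' : piece D),
    crosses (pos D) e f -> lay D e f = Sing ->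
    det2 (dir (pos D) e) (dir (pos D) f) < 0 ->
    reaches u e f -> val u' = (e, Some f) ->
    reaches v f e -> val v' = (f, Some e) ->
    C (arc_of v') = R1 Q (C (arc_of u)) (C (arc_of v)) /\
    C (arc_of u') = R2 Q (C (arc_of u)) (C (arc_of v))
}.

Definition colorings : {set {ffun arc D -> X}} :=
  [set C | `[< is_coloring C >]]%SET.

End Colorings.

(** * Planar isotopy *)

Definition relabeling (R : realType) (D D' : diagram R) : Prop :=
  exists phi : edge D -> edge D',
    [/\ bijective phi,
        forall e, next D' (phi e) = phi (next D e),
        forall e, lab (phi e) = lab e,
        forall e, pos D' (phi e) = pos D e &
        forall e f, crosses (pos D) e f ->
          lay D' (phi e) (phi f) = lay D e f].

(* [D'] is [D] with an additional vertex on the edge [e]: [phi (Some e)] and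
   [phi None] are the first and second parts of [e]. *)
Definition subdivision (R : realType) (D D' : diagram R) : Prop :=
  exists (e : edge D) (phi : option (edge D) -> edge D'),
    [/\ bijective phi,
        next D' (phi None) = phi (Some (next D e)) /\
        (forall x, next D' (phi (Some x)) =
                   phi (if x == e then None else Some (next D x))),
        forall a, lab (phi a) = lab (odflt e a),
        (forall x, pos D' (phi (Some x)) = pos D x) /\
        (exists2 t : R, 0 < t < 1 & pos D' (phi None) = point (pos D) e t) &
        forall a b, crosses (pos D') (phi a) (phi b) ->
          lay D' (phi a) (phi b) = lay D (odflt e a) (odflt e b)].

(* An isotopy is a continuous motion of the vertices during which the diagram
   remains in general position. *)
Definition deformation (R : realType) (S : skeleton) (i : layering S)
    (p q : position R S) : Prop :=
  exists h : R -> position R S,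
    [/\ h 0 = p, h 1 = q,
        forall e, continuous (fun t : R => h t e : 'rV[R]_2) &
        forall t, 0 <= t <= 1 -> regular (h t) i].

(** * Reidemeister moves *)

Section Moves.
Variables (R : realType) (S : skeleton).
Implicit Types (p q : position R S) (i j : layering S) (B : set 'rV[R]_2).
Implicit Types (e f g x : edge S).

Definition convex B : Prop :=
  forall a b (t : R), B a -> B b -> 0 <= t <= 1 -> B (a + t *: (b - a)).

(* The diagrams drawn by [p] and [q] differ only in the disc [B], by the
   position of the interior vertices of the polygonal strand formed by the
   consecutive edges [e :: s].  Inside [B] one sees only this strand, whose
   endpoints are fixed, and the edges of [through], which traverse [B]. *)
Definition strand_moved p q B e (s through : seq (edge S)) : Prop :=
  [/\ convex B /\ fpath (next S) e s,
      forall x, x \in e :: s -> segment p x `<=` B /\ segment q x `<=` B,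
      forall x, x \notin s -> p x = q x,
      forall x, x \in through -> ~ B (p x) /\ ~ B (p (next S x)) &
      forall x z, x \notin e :: s -> x \notin through ->
        segment p x z -> B z -> z = p e \/ z = p (next S (last e s))].

(* The strand [e1 e2], in position [l] with respect to [f] and [g], crosses each
   of them once in [B].  With the endpoints of the strand fixed there are only
   two pictures, one for each side of the strand on which [f] and [g] cross. *)
Definition slides p q i B e1 e2 f g (l : layer) : Prop :=
  [/\ strand_moved p q B e1 [:: e2] [:: f; g],
      (exists z, [/\ segment p f z, segment p g z & B z]) /\ crosses p f g,
      forall x, x \in [:: f; g] ->
        (crosses p e1 x <-> ~ crosses p e2 x) /\
        (crosses q e1 x <-> ~ crosses q e2 x) &
      [/\ i e1 f = l, i e2 f = l, i e1 g = l & i e2 g = l]].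

Inductive reidemeister : position R S -> layering S ->
    position R S -> layering S -> Prop :=
(* A strand without crossings acquires a kink. *)
| RI p q i B e1 e2 e3 of
    strand_moved p q B e1 [:: e2; e3] [::] &
    ~ crosses p e1 e3 & crosses q e1 e3 & i e1 e3 <> Sing :
    reidemeister p i q i
(* A strand is pushed over or under an edge [f] in two points. *)
| RII p q i B e1 e2 f of
    strand_moved p q B e1 [:: e2] [:: f] &
    ~ crosses p e1 f & ~ crosses p e2 f &
    crosses q e1 f & crosses q e2 f &
    i e1 f = i e2 f & i e1 f <> Sing :
    reidemeister p i q i
(* A strand slides over a classical crossing. *)
| RIII p q i B e1 e2 f g of
    slides p q i B e1 e2 f g Over & i f g <> Sing :
    reidemeister p i q i
| RIVa p q i B e1 e2 f g of
    slides p q i B e1 e2 f g Over & i f g = Sing :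
    reidemeister p i q i
| RIVb p q i B e1 e2 f g of
    slides p q i B e1 e2 f g Under & i f g = Sing :
    reidemeister p i q i
(* The strands [e1 e2] and [f1 f2] bound a bigon, with corners the crossings of
   [e1] with [f1] and of [e2] with [f2].  The first is classical and the second
   singular in [i]; it is the reverse in [j], with a classical crossing of the
   same sign. *)
| RV p i j B e1 e2 f1 f2 of
    next S e1 = e2 & next S f1 = f2 & convex B &
    [/\ crosses p e1 f1, crosses p e2 f2, ~ crosses p e1 f2 &
        ~ crosses p e2 f1] &
    (forall z, segment p e1 z -> segment p f1 z -> B z) &
    (forall z, segment p e2 z -> segment p f2 z -> B z) &
    B (p e2) /\ B (p f2) &
    [/\ ~ B (p e1), ~ B (p f1), ~ B (p (next S e2)) & ~ B (p (next S f2))] &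
    (forall x z, x \notin [:: e1; e2; f1; f2] -> segment p x z -> ~ B z) &
    i e1 f1 <> Sing & i e2 f2 = Sing & j e1 f1 = Sing & j e2 f2 <> Sing &
    positive_crossing p i e1 f1 = positive_crossing p j e2 f2 &
    (forall x y, (x, y) \notin [:: (e1, f1); (f1, e1); (e2, f2); (f2, e2)] ->
      j x y = i x y) :
    reidemeister p i p j.

End Moves.

Inductive move (R : realType) : diagram R -> diagram R -> Prop :=
| Relabel D D' of relabeling D D' : move D D'
| Subdivide D D' of subdivision D D' : move D D'
| Deform (S : skeleton) (p q : position R S) (i : layering S)
    (hp : regular p i) (hq : regular q i) of
    deformation i p q : move (Diagram hp) (Diagram hq)
| Reidemeister (S : skeleton) (p q : position R S) (i j : layering S)
    (hp : regular p i) (hq : regular q j) of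
    reidemeister p i q j : move (Diagram hp) (Diagram hq).

Definition equivalent (R : realType) : diagram R -> diagram R -> Prop :=
  clos_refl_sym_trans (diagram R) (@move R).

(* Main.v *)
Require Import Defs.
From mathcomp Require Import ring lra.

Set Implicit Arguments.
Unset Strict Implicit.
Unset Printing Implicit Defensive.

Import Order.TTheory GRing.Theory Num.Theory numFieldNormedType.Exports.

Local Open Scope ring_scope.
Local Open Scope classical_set_scope.

(** The number of colorings does not change because, for each elementary change of a
diagram, the colorings of one diagram determine colorings of the other one, in a
reversible way.

A coloring gives colors to the arcs, which are classes of pieces of edges; such a
description does not survive a change of the diagram.  It is replaced by a function
[c], where [c e t] is the color that arrives at the parameter [t] of the edge [e].
A function comes from a coloring of the arcs if and only if its values are
transported along the edges according to the crossings met on the way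
([coloring_at], with [color_at_coloring], [color_at_inj] and [realize]).  After
[colorings_transfer] there are no arcs any more.

This transport depends only on the crossings, their order along the edges, their
levels and their signs.  A relabeling preserves these data, and so does a
deformation, since general position makes them locally constant
([colorings_iso]).  A subdivision reparametrizes an edge.

A Reidemeister move takes place in a convex disc.  A coloring of the outside extends
to the new diagram if the new inside can show the same colors on the boundary of the
disc as the old one; it extends in one way if the colors that enter the disc
determine the colors in it ([tangle_replacement]).  Hence, for each move, it has to
be found which pictures are possible in the disc, and that the axioms give the same
outgoing colors for all of them:
- a kink has a constant color, because the operations are idempotent
  ([passing_fixed]);
- the two crossings of a finger have opposite signs, and cancel out
  ([passing_undo]);
- a strand that passes over a crossing acts on it by an automorphism of all the
  operations; for two classical strands with a different label this is the mixed
  distributivity ([passing_qop]);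
- a strand that passes under a singular crossing can do so on both sides, by the
  third axiom of singquandles ([under_sing4]);
- a classical crossing can be taken from one corner of a bigon to the other one by
  the last two axioms ([twist_exits]).
The pictures are found from signs of determinants.  In a convex disc, a strand meets
the line through an edge only where it meets the edge ([on_line_in_disc]); therefore
the sides on which its vertices lie determine the signs and the order of its
crossings ([strand_turn], [through_order]).  The two corners of a bigon have opposite
orientations because the strands could not leave the disc otherwise
([bigon_turns]). *)


(** * Crossings of a polygonal diagram *)

Section PlaneVectors.
Variable R : realType.
Implicit Types (u v w : 'rV[R]_2) (k : R).

Lemma row2P u v :
  u ord0 ord0 = v ord0 ord0 -> u ord0 ord_max = v ord0 ord_max -> u = v.
Proof.
move=> h0 h1; apply/rowP => -[[|[|//]] h].
  by have -> : Ordinal h = ord0 by exact: val_inj.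
by have -> : Ordinal h = ord_max by exact: val_inj.
Qed.

Lemma det2C u v : det2 v u = - det2 u v.
Proof. by rewrite /det2; ring. Qed.

Lemma det2Zr k u v : det2 u (k *: v) = k * det2 u v.
Proof. by rewrite /det2 !mxE; ring. Qed.

Lemma det2Zl k u v : det2 (k *: u) v = k * det2 u v.
Proof. by rewrite /det2 !mxE; ring. Qed.

Lemma det2_eq0 u v : det2 u v = 0 -> u != 0 -> exists k, v = k *: u.
Proof.
rewrite /det2 => d0 un0.
have [u0|u0] := eqVneq (u ord0 ord0) 0; last first.
  exists (v ord0 ord0 / u ord0 ord0); apply: row2P; rewrite !mxE; first by field.
  by apply: (mulfI u0); rewrite mulrA mulrCA divff // mulr1; lra.
have u1 : u ord0 ord_max != 0.
  by apply: contraNneq un0 => u1; apply/eqP/row2P; rewrite mxE.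
exists (v ord0 ord_max / u ord0 ord_max); apply: row2P; rewrite !mxE.
  rewrite u0 mulr0; apply: (mulfI u1); rewrite mulr0.
  by move: d0; rewrite u0 mul0r; lra.
by field.
Qed.

End PlaneVectors.

Section Segments.
Variables (R : realType) (S : skeleton) (p : position R S).
Implicit Types (e f g : edge S).

(** Cramer's rule for the parameter, along [e], of the crossing of [e] and [f]. *)
Definition par e f : R :=
  det2 (p f - p e) (dir p f) / det2 (dir p e) (dir p f).

Lemma point0 e : point p e 0 = p e.
Proof. by rewrite /point scale0r addr0. Qed.

Lemma point1 e : point p e 1 = p (next S e).
Proof. by rewrite /point scale1r /dir addrC subrK. Qed.

Lemma segment_start e : segment p e (p e).
Proof. by exists 0; rewrite ?point0 // lexx ler01. Qed.

Lemma segment_end e : segment p e (p (next S e)).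
Proof. by exists 1; rewrite ?point1 // lexx ler01. Qed.

Lemma par_eq e f s t : point p e s = point p f t ->
  det2 (dir p e) (dir p f) != 0 -> s = par e f.
Proof.
move=> h dn0; have : det2 (point p e s - p e) (dir p f) =
                   det2 (point p f t - p e) (dir p f) by rewrite h.
rewrite /par => h'; apply: (mulIf dn0); rewrite divfK //.
by move: h'; rewrite /det2 /point /dir !mxE; lra.
Qed.

Lemma point_par e f : det2 (dir p e) (dir p f) != 0 ->
  point p e (par e f) = point p f (par f e).
Proof.
move=> dn0; have dn0' : det2 (dir p f) (dir p e) != 0 by rewrite det2C oppr_eq0.
move: dn0 dn0'; rewrite /par /point /det2; move: (dir p e) (dir p f) => u v.
by move=> h1 h2; apply: row2P; rewrite !mxE; field; rewrite h1 h2.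
Qed.

(** The side of the line through [f] on which a point lies is the sign of an
affine function, which vanishes on the line. *)
Definition side f (z : 'rV[R]_2) : R := det2 (dir p f) (z - p f).

Lemma side_point f e t :
  side f (point p e t) = side f (p e) + t * det2 (dir p f) (dir p e).
Proof. by rewrite /side /point /det2 !mxE; ring. Qed.

Lemma side0 f z : dir p f != 0 -> side f z = 0 -> exists t, z = point p f t.
Proof.
by move=> fn0 /det2_eq0 => /(_ fn0) [k hk]; exists k; rewrite /point -hk addrC subrK.
Qed.

End Segments.

Section Regular.
Variables (R : realType) (S : skeleton) (p : position R S) (i : layering S).
Hypothesis reg : regular p i.
Implicit Types (e f g : edge S).

Lemma nextI e f : next S e = next S f -> e = f.
Proof. exact: perm_inj. Qed.

Lemma next_neq e : next S e != e.
Proof. by apply: contraNneq (next_next e) => h; rewrite !h. Qed.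

Lemma vertex_ends e f : segment p f (p e) -> e = f \/ e = next S f.
Proof.
case: reg => h _ _ se; have [->|fe] := eqVneq f e; first by left.
have [<-|nfe] := eqVneq (next S f) e; first by right.
by case: (h e f).
Qed.

Lemma crossesC e f : crosses p e f -> crosses p f e.
Proof.
by case=> h1 h2 h3 [x [? ?]]; split; rewrite ?(eq_sym f) //; exists x.
Qed.

(** The only edges through a vertex are the two that it ends, and they are adjacent. *)
Lemma crossing_not_vertex e f v : crosses p e f ->
  segment p e (p v) -> segment p f (p v) -> False.
Proof.
case=> /eqP h1 /eqP h2 /eqP h3 _ /vertex_ends he /vertex_ends hf.
by case: he hf => -> [] // => [/esym//|/nextI].
Qed.

Lemma dir_neq0 e f : crosses p e f -> dir p e != 0.
Proof.
move=> cr; case: (cr) => _ _ _ [x [[t _ xt] xf]].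
apply/eqP => d0; apply: (@crossing_not_vertex e f e cr); first exact: segment_start.
by move: xf; rewrite xt /point d0 scaler0 addr0.
Qed.

Lemma crossing_interior e f t : crosses p e f -> 0 <= t <= 1 ->
  segment p f (point p e t) -> 0 < t < 1.
Proof.
move=> cr /andP[t0 t1] sf; rewrite !lt_neqAle t0 t1 !andbT; apply/andP; split.
  apply/eqP => t00; move: sf; rewrite -t00 point0.
  by move/(crossing_not_vertex cr); apply; exact: segment_start.
apply/eqP => t00; move: sf; rewrite t00 point1.
by move/(crossing_not_vertex cr); apply; exact: segment_end.
Qed.

(** If two edges that cross were parallel, then they would overlap, and an end of
one of them would lie on the other. *)
Lemma crosses_det e f : crosses p e f -> det2 (dir p e) (dir p f) != 0.
Proof.
move=> cr; apply/eqP => d0.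
have [k dk] := det2_eq0 d0 (dir_neq0 cr).
have crC := crossesC cr.
have k0 : k != 0.
  by apply/eqP => k0; move: (dir_neq0 crC); rewrite dk k0 scale0r eqxx.
case: (cr) => /eqP h1 /eqP h2 /eqP h3 [x [[s s01 xs] [u u01 xu]]].
have s01' : 0 < s < 1.
  by apply: (crossing_interior cr s01); rewrite -xs xu; exists u.
have u01' : 0 < u < 1.
  by apply: (crossing_interior crC u01); rewrite -xu xs; exists s.
(* The two edges are on the same line, where [e] is the unit interval. *)
have pf w : point p f w = point p e (s + (w - u) * k).
  rewrite /point; have -> : p f = p e + s *: dir p e - u *: dir p f.
    by apply: (addIr (u *: dir p f)); rewrite subrK -/(point p f u) -xu xs.
  by rewrite dk; apply: row2P; rewrite !mxE; ring.
have noe v : segment p e (p v) -> segment p f (p v) -> False.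
  exact: crossing_not_vertex.
have [c1|c1] := boolP (0 <= s - u * k <= 1).
  apply: (noe f); last exact: segment_start.
  by exists (s - u * k) => //; rewrite -(point0 p f) pf; congr point; ring.
have [c2|c2] := boolP (0 <= s + (1 - u) * k <= 1).
  apply: (noe (next S f)); last exact: segment_end.
  by exists (s + (1 - u) * k) => //; rewrite -(point1 p f) pf.
apply: (noe e); first exact: segment_start.
exists (u - s / k); last first.
  by rewrite pf -(point0 p e); congr point; field.
have [kp|kn|k00] := ltgtP k 0; last by rewrite k00 eqxx in k0.
  have E : s / k * k = s by rewrite divfK.
  move: E; set w := s / k => E.
  have w0 : w < 0 by nra.
  have : 1 < s - u * k.
    move: c1; rewrite negb_and -!ltNge => /orP[|//]; nra.
  have : s + (1 - u) * k < 0.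
    move: c2; rewrite negb_and -!ltNge => /orP[//|]; nra.
  by nra.
have E : s / k * k = s by rewrite divfK.
move: E; set w := s / k => E.
have w0 : 0 < w by nra.
have : s - u * k < 0.
  move: c1; rewrite negb_and -!ltNge => /orP[//|]; nra.
have : 1 < s + (1 - u) * k.
  move: c2; rewrite negb_and -!ltNge => /orP[|//]; nra.
by nra.
Qed.

Lemma par_hits e f t u : crosses p e f -> point p e t = point p f u ->
  t = par p e f.
Proof. by move=> cr h; apply: par_eq h (crosses_det cr). Qed.

Lemma crosses_point e f : crosses p e f ->
  point p e (par p e f) = point p f (par p f e).
Proof. by move=> cr; exact/point_par/crosses_det. Qed.

Lemma par_in01 e f : crosses p e f -> 0 < par p e f < 1.
Proof.
move=> cr; case: (cr) => _ _ _ [x [[s s01 xs] [u u01 xu]]].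
have st : point p e s = point p f u by rewrite -xs.
rewrite -(par_hits cr st); apply: (crossing_interior cr s01).
by rewrite st; exists u.
Qed.

Lemma par_in01W e f : crosses p e f -> 0 <= par p e f <= 1.
Proof. by move/par_in01 => /andP[/ltW -> /ltW ->]. Qed.

Lemma segment_crossing e f : crosses p e f ->
  segment p e (point p e (par p e f)) /\ segment p f (point p e (par p e f)).
Proof.
move=> cr; split; first by exists (par p e f) => //; exact: par_in01W.
exists (par p f e); last exact: crosses_point.
exact/par_in01W/crossesC.
Qed.

Lemma hitsP e f t : crosses p e f -> (hits p e f t <-> t = par p e f).
Proof.
move=> cr; split; first by case=> _ [u _ h]; exact: par_hits cr h.
by move=> ->; split; [exact: par_in01W|case: (segment_crossing cr)].
Qed.

Lemma beforeP e f g : crosses p e f -> crosses p e g ->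
  (before p e f g <-> par p e f < par p e g).
Proof.
move=> cf cg; split; last by exists (par p e f), (par p e g); split=> //; exact/hitsP.
by case=> s [t [/(hitsP _ cf) -> /(hitsP _ cg) ->]].
Qed.

Lemma par_inj e f g : crosses p e f -> crosses p e g ->
  par p e f = par p e g -> f = g.
Proof.
move=> cf cg h; apply/eqP/negP => /negP fg.
have [_ /(_ e f g) h3 _] := reg.
case: (cf) (cg) => ef _ _ _ [eg _ _ _].
suff : (segment p e `&` segment p f `&` segment p g) (point p e (par p e f)).
  by rewrite h3.
split; first exact: segment_crossing.
by rewrite h; case: (segment_crossing cg).
Qed.

(** If two consecutive edges met elsewhere, they would be on the same line, and one
of them would go back over the whole of the other, hence over one of its ends. *)
Lemma adjacent_meet e z : segment p e z -> segment p (next S e) z ->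
  z = p (next S e).
Proof.
move=> [s /andP[s0 s1] ->] [u /andP[u0 u1]].
set e' := next S e; set d := dir p e; set d' := dir p e' => h.
have E : point p e s = p e' - (1 - s) *: d.
  by rewrite /point /d /e' /dir; apply: row2P; rewrite !mxE; ring.
have [u00|un0] := eqVneq u 0; first by rewrite h u00 point0.
have [s11|sn1] := eqVneq s 1; first by rewrite s11 point1.
have dd : - (1 - s) *: d = u *: d'.
  by apply: (addrI (p e')); rewrite scaleNr -E h.
pose k := (1 - s) / u.
have up : 0 < u by rewrite lt_neqAle eq_sym un0.
have sp : 0 < 1 - s by rewrite subr_gt0 lt_neqAle sn1.
have kp : 0 < k by rewrite divr_gt0.
have dk : d' = - k *: d.
  by rewrite /k -mulNr mulrC -scalerA dd scalerA mulVf // scale1r.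
exfalso; have [k1|k1] := leP k 1.
  have : segment p e (p (next S e')).
    exists (1 - k); first lra.
    rewrite -(point1 p e') /point -/d' dk scale1r /d /e' /dir.
    by apply: row2P; rewrite !mxE; ring.
  case/vertex_ends; rewrite /e'; last by move/eqP; rewrite (negbTE (next_neq _)).
  by move/eqP; rewrite (negbTE (next_next _)).
have : segment p e' (p e).
  have k0 : k != 0 by lra.
  exists k^-1; first by rewrite invr_ge0 ltW //= invf_le1 // ltW.
  rewrite /point -/d' dk scalerA mulrN mulVf // scaleN1r /d /dir.
  by apply: row2P; rewrite !mxE; ring.
case/vertex_ends; rewrite /e' => /esym/eqP; first by rewrite (negbTE (next_neq _)).
by rewrite (negbTE (next_next _)).
Qed.

End Regular.

(** * The crossing data of a diagram and the transport of colors *)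

(** All that colorings see of a diagram: which edges cross ([chi]), in which order
along each edge ([place], of which only the order matters in the end), which one
passes over ([level]), and on which side ([turn e f] says that the directions of
[e] and [f] form a positive frame).  It is a Gauss code, in which the order on an
edge is given by real parameters rather than by a list, so that a local change of
the diagram does not renumber the other crossings. *)
Record gauss (R : realType) (S : skeleton) := Gauss {
  chi : rel (edge S);
  place : edge S -> edge S -> R;
  level : layering S;
  turn : rel (edge S);
  chiC : forall e f, chi e f -> chi f e;
  place01 : forall e f, chi e f -> 0 < place e f < 1;
  place_inj : forall e f g, chi e f -> chi e g -> place e f = place e g -> f = g;
  level_opp : forall e f, chi e f -> level f e = opposite (level e f);
  turnC : forall e f, chi e f -> turn f e = ~~ turn e f
}.

Section Transport.
Variables (R : realType) (S : skeleton) (G : gauss R S).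
Variables (X : Type) (Q : disingquandle X).
Implicit Types (e f g h : edge S) (c : edge S -> R -> X) (a b s t : R) (x y : X).

(** The color with which [e] leaves its crossing with [f], when [e] and [f] arrive
there with colors [x] and [y].  At a singular crossing [turn e f] means that [e] is
the strand drawn at the top right. *)
Definition out e f x y : X :=
  match level G e f with
  | Over => x
  | Under => (if turn G f e then qop (dsq_quandle Q (lab f))
              else qbar (dsq_quandle Q (lab f))) x y
  | Sing => if turn G e f then R1 Q y x else R2 Q x y
  end.

Definition clear e s t := forall f, chi G e f -> ~~ (s <= place G e f < t).

Definition clear_after e f t :=
  forall g, chi G e g -> ~~ (place G e f < place G e g < t).

(** [c e t] is the color that arrives at the parameter [t] of [e]: it is continuous
from the left, and at a crossing it is the incoming color.  Hence both arguments of
[out] are values of [c], and only the color just after a crossing needs a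
neighborhood to be expressed. *)
Record carries c e a b : Prop := Carries {
  carries_clear : forall s t, a <= s -> s < t -> t <= b -> clear e s t ->
    c e t = c e s;
  carries_cross : forall f t, chi G e f -> a <= place G e f ->
    place G e f < t -> t <= b -> clear_after e f t ->
    c e t = out e f (c e (place G e f)) (c f (place G f e))
}.

Record coloring_at c : Prop := ColoringAt {
  coloring_at_vertex : forall e, c (next S e) 0 = c e 1;
  coloring_at_edge : forall e, carries c e 0 1
}.

(** Induction along an edge, from one crossing to the next; it terminates because
there are finitely many crossings. *)
Lemma position_ind e a b (P : R -> Prop) :
  P a ->
  (forall s t, a <= s -> s < t -> t <= b -> clear e s t -> P s -> P t) ->
  (forall f t, chi G e f -> a <= place G e f -> place G e f < t -> t <= b ->
     clear_after e f t -> P (place G e f) -> P t) ->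
  forall t, a <= t <= b -> P t.
Proof.
move=> Pa Pclear Pcross t.
have [n] := ubnP #|[pred f | chi G e f && (a <= place G e f < t)]|.
elim: n t => // n IH t; rewrite ltnS => le_n /andP[at_ tb].
have [f0 /andP[ef0 f0t]|none] :=
    pickP [pred f | chi G e f && (a <= place G e f < t)]; last first.
  have [<- //|na] := eqVneq a t.
  apply: (Pclear a) => //; first by rewrite lt_neqAle na.
  by move=> f ef; move: (none f); rewrite /= ef /= => ->.
case: (@Order.TotalTheory.arg_maxP _ _ _ f0
  [pred f | chi G e f && (a <= place G e f < t)] (place G e)).
  by rewrite /= ef0.
move=> f /= /andP[ef /andP[af ft]] fmax; apply: (Pcross f) => //.
  move=> g eg; apply/negP => /andP[fg gt].
  have /fmax : chi G e g && (a <= place G e g < t).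
    by rewrite eg gt (le_trans af (ltW fg)).
  by rewrite leNgt fg.
apply: IH; last by rewrite af (le_trans (ltW ft)).
apply: leq_trans le_n; apply: proper_card; apply/properP; split.
  apply/fintype.subsetP => g; rewrite !inE => /andP[-> /andP[-> gf]].
  by rewrite (lt_trans gf).
by exists f; rewrite !inE ef af ?ft // ltxx.
Qed.

Lemma carriesS c e a b a' b' : a <= a' -> b' <= b ->
  carries c e a b -> carries c e a' b'.
Proof.
move=> aa bb [h1 h2]; split.
  by move=> s t as_ st tb; apply: h1 => //; [apply: le_trans as_|apply: le_trans bb].
by move=> f t ef af ft tb; apply: h2 => //; [apply: le_trans af|apply: le_trans bb].
Qed.

(** Colors being continuous from the left, two adjacent intervals may have a
crossing at their common end. *)
Lemma carries_cat c e a m b : a <= m -> m <= b ->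
  carries c e a m -> carries c e m b -> carries c e a b.
Proof.
move=> am mb [h1 h2] [k1 k2]; split.
  move=> s t as_ st tb cl.
  have [tm|mt] := leP t m; first exact: h1.
  have [ms|sm] := leP m s; first exact: k1.
  rewrite (k1 m t) // ?(h1 s m) // => f ef; apply: contra (cl f ef).
    by move=> /andP[-> fm]; rewrite (lt_trans fm).
  by move=> /andP[mf ->]; rewrite (le_trans (ltW sm)).
move=> f t ef af ft tb cl.
have [tm|mt] := leP t m; first exact: h2.
have [ms|sm] := leP m (place G e f); first exact: k2.
rewrite (k1 m t) // ?(h2 f m) // => g eg; apply: contra (cl g eg).
  by move=> /andP[-> fm]; rewrite (lt_trans fm).
by move=> /andP[mf ->]; rewrite (lt_le_trans sm).
Qed.

(** The transport is a recursion over the crossings, which consults the other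
strands only where they cut the edge. *)
Lemma carries_unique c c' e a b :
  carries c e a b -> carries c' e a b -> c e a = c' e a ->
  (forall f x, chi G e f -> a <= place G e f < b ->
     out e f x (c f (place G f e)) = out e f x (c' f (place G f e))) ->
  forall t, a <= t <= b -> c e t = c' e t.
Proof.
move=> [h1 h2] [k1 k2] eqa eqf; apply: (@position_ind e a b (fun t => c e t = c' e t)) => //.
  by move=> s t as_ st tb cl est; rewrite (h1 s t) // (k1 s t).
move=> f t ef af ft tb cl est; rewrite (h2 f t) // (k2 f t) // est eqf //.
by rewrite af (lt_le_trans ft).
Qed.

(** Passing over changes nothing, so only the cuts matter. *)
Lemma carries_uncut c e a b t : carries c e a b -> a <= t <= b ->
  (forall f, chi G e f -> a <= place G e f < t -> level G e f = Over) ->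
  c e t = c e a.
Proof.
move=> [h1 h2] /andP[at_ tb] ov; apply: (@position_ind e a t (fun t => c e t = c e a)) => //.
- by move=> s u as_ su ut cl <-; apply: h1 => //; apply: le_trans tb.
- move=> f u ef af fu ut cl <-; rewrite (h2 f u) //; last exact: le_trans tb.
  by rewrite /out ov // af (lt_le_trans fu).
- by rewrite at_ lexx.
Qed.

End Transport.

Section GaussOf.
Variables (R : realType) (S : skeleton) (p : position R S) (i : layering S).
Hypothesis reg : regular p i.

Definition gauss_of : gauss R S.
Proof.
refine (@Gauss R S (fun e f => `[< crosses p e f >]) (par p) i
  (fun e f => 0 < det2 (dir p e) (dir p f)) _ _ _ _ _).
- by move=> e f /asboolP/crossesC/asboolP.
- by move=> e f /asboolP; exact: par_in01 reg _ _.
- by move=> e f g /asboolP h /asboolP; exact: par_inj reg _ _ _ h.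
- by case: reg => _ _ h e f /asboolP; exact: h.
- move=> e f /asboolP /(crosses_det reg) dn0.
  by rewrite det2C oppr_gt0 -leNgt le_eqVlt (negbTE dn0).
Defined.

End GaussOf.

(** * Colorings of arcs as colorings of positions *)

Section Arcs.
Variables (R : realType) (D : diagram R).
Implicit Types (e f g : edge D) (x y : piece D) (t : R).

Let reg := diagram_regular D.

(** [started] and [covers] extend [starts_before] and [reaches] from crossings to
arbitrary positions: [covers x e t] says that one arrives at the parameter [t] of
[e] on the piece [x]. *)
Definition started x t : Prop :=
  if (val x).2 is Some g then par (pos D) (val x).1 g < t else True.

Definition covers x e t : Prop :=
  [/\ (val x).1 = e, started x t &
      forall g, cut e g -> par (pos D) e g < t -> ~ started x (par (pos D) e g)].

Lemma cut_of_piece x g : (val x).2 = Some g -> cut (val x).1 g.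
Proof. by move=> h; move: (valP x); rewrite /is_piece h => /asboolP. Qed.

Lemma covers_ex e t : exists x, covers x e t.
Proof.
have [f0 f0P|none] := pickP [pred f | `[< cut e f >] && (par (pos D) e f < t)].
  case: (@Order.TotalTheory.arg_maxP _ _ _ f0
    [pred f | `[< cut e f >] && (par (pos D) e f < t)] (par (pos D) e) f0P).
  move=> f /= /andP[cf ft] fmax.
  have pf : is_piece (e, Some f) by [].
  exists (Sub (e, Some f) pf); split; rewrite /started ?SubK //=.
  move=> g /asboolP cg gt.
  have /fmax : `[< cut e g >] && (par (pos D) e g < t) by rewrite cg gt.
  by rewrite /= leNgt => /negP.
have pf : is_piece (e, @None (edge D)) by [].
exists (Sub (e, None) pf); split; rewrite /started ?SubK //=.
by move=> g /asboolP cg gt; move: (none g); rewrite /= cg gt.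
Qed.

Lemma covers_unique x y e t : covers x e t -> covers y e t -> x = y.
Proof.
move=> [x1 x2 x3] [y1 y2 y3]; apply: val_inj.
rewrite [LHS]surjective_pairing [RHS]surjective_pairing x1 y1; congr pair.
have cx := @cut_of_piece x; have cy := @cut_of_piece y.
rewrite /started ?x1 ?y1 in x2 x3 y2 y3 cx cy.
case: (val x).2 (val y).2 cx cy x2 x3 y2 y3 => [f|] [g|] cx cy x2 x3 y2 y3 //.
- have [cf _] := cx f erefl; have [cg _] := cy g erefl; congr Some.
  apply: (par_inj reg cf cg); apply/eqP; rewrite eq_le !leNgt.
  by apply/andP; split; apply/negP; [apply: y3|apply: x3] => //; [apply: cx|apply: cy].
- by case: (y3 f) => //; apply: cx.
- by case: (x3 g) => //; apply: cy.
Qed.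

Lemma starts_beforeP x f : crosses (pos D) (val x).1 f ->
  (starts_before x f <-> started x (par (pos D) (val x).1 f)).
Proof.
rewrite /starts_before /started => cf.
case E : (val x).2 => [g|] //; case: (cut_of_piece E) => cg _.
exact: beforeP reg _ _ _ cg cf.
Qed.

Lemma reachesP x e f : crosses (pos D) e f ->
  (reaches x e f <-> covers x e (par (pos D) e f)).
Proof.
move=> cf; split=> -[h1 h2 h3]; rewrite -h1 in cf; split=> //.
- by rewrite -h1; apply/(starts_beforeP cf).
- rewrite -h1 => g cg gf; have [cg' _] := cg.
  move/(starts_beforeP cg'); apply: h3; rewrite -h1 //.
  exact/(beforeP reg cg' cf).
- by apply/(starts_beforeP cf); rewrite h1.
- rewrite -h1 => g cg gf; have [cg' _] := cg.
  move/(starts_beforeP cg'); rewrite h1; apply: h3; rewrite -h1 //.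
  exact/(beforeP reg cg' cf).
Qed.

Lemma continuedP x y :
  continued x y <-> val y = (next D (val x).1, None) /\ covers x (val x).1 1.
Proof.
split=> -[h1 h2]; split=> //.
  split=> //.
    rewrite /started; case E : (val x).2 => [g|] //; case: (cut_of_piece E) => cg _.
    by case/andP: (par_in01 reg cg).
  by move=> g cg _; have [cg' _] := cg; move/(starts_beforeP cg'); apply: h2.
move=> g cg; have [cg' _] := cg; move/(starts_beforeP cg').
by case: h2 => _ _; apply=> //; case/andP: (par_in01 reg cg').
Qed.

Lemma same_arc_sym : connect_sym
  (fun a b : piece D => `[< continued a b \/ continued b a >]).
Proof.
by apply: sym_connect_sym => a b; apply/asboolP/asboolP; rewrite or_comm.
Qed.

Lemma arc_of_eq x y : same_arc x y -> arc_of x = arc_of y.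
Proof.
move=> xy; apply: val_inj => /=; apply/setP => z; rewrite !inE.
exact: (same_connect same_arc_sym).
Qed.

Lemma arc_of_same x y : arc_of x = arc_of y -> same_arc x y.
Proof.
move/(congr1 val) => /= /setP /(_ y); rewrite !inE => ->; exact: connect0.
Qed.

Lemma arc_of_surj (A : arc D) : exists x, A = arc_of x.
Proof. by have /imsetP[x _ hx] := valP A; exists x; exact: val_inj. Qed.

(** A function of the pieces descends to the arcs as soon as it does not change at
the vertices. *)
Lemma same_arc_invariant (T : Type) (k : piece D -> T) x y :
  (forall a b, continued a b -> k a = k b) -> same_arc x y -> k x = k y.
Proof.
move=> hk /connectP[s]; elim: s x => [x _ -> //|z s IH x /= /andP[/asboolP xz zs] l].
by rewrite -(IH z) //; case: xz => /hk.
Qed.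

End Arcs.

Section Positions.
Variables (R : realType) (D : diagram R) (X : finType) (Q : disingquandle X).
Implicit Types (e f g : edge D) (x y : piece D) (t : R) (C : {ffun arc D -> X}).

Let reg := diagram_regular D.

Definition diagram_gauss : gauss R D := gauss_of reg.
Local Notation G := diagram_gauss.

Definition color_at C e t : X := C (arc_of (projT1 (cid (covers_ex e t)))).

Lemma color_atE C x e t : covers x e t -> color_at C e t = C (arc_of x).
Proof.
move=> cx; rewrite /color_at; case: cid => y /= cy.
by rewrite (covers_unique cx cy).
Qed.

(** The two clauses of [is_coloring] are the two nontrivial cases of [out]; at a
singular crossing, which of the strands is the left one depends on [turn]. *)
Lemma coloring_out C e f u u' v : is_coloring Q C -> cut e f ->
    covers u e (par (pos D) e f) -> val u' = (e, Some f) ->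
    covers v f (par (pos D) f e) ->
  C (arc_of u') = out G Q e f (C (arc_of u)) (C (arc_of v)).
Proof.
move=> [cl si] [cr lef] cu hu' cv.
have ru : reaches u e f by apply/(reachesP _ cr).
have crC := crossesC cr.
have rv : reaches v f e by apply/(reachesP _ crC).
rewrite /out /=; case E : (lay D e f) lef => // _.
  by rewrite (cl e f u u' v) // /positive_crossing E; case: ifP.
have [d0|d0] := ltP 0 (det2 (dir (pos D) e) (dir (pos D) f)).
  have Efe : lay D f e = Sing by case: reg => _ _ h; rewrite (h e f) // E.
  have d1 : det2 (dir (pos D) f) (dir (pos D) e) < 0 by rewrite det2C oppr_lt0.
  have pv : is_piece (f, Some e).
    by apply/asboolP; split=> //=; rewrite Efe.
  by have [-> _] := si f e v (Sub (f, Some e) pv) u u' crC Efe d1 rv (SubK _ _) ru hu'.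
have d1 : det2 (dir (pos D) e) (dir (pos D) f) < 0.
  by rewrite lt_neqAle d0 (crosses_det reg cr).
have Efe : lay D f e = Sing by case: reg => _ _ h; rewrite (h e f) // E.
have pv : is_piece (f, Some e).
  by apply/asboolP; split=> //=; rewrite Efe.
by have [_ ->] := si e f u u' v (Sub (f, Some e) pv) cr E d1 ru hu' rv (SubK _ _).
Qed.

Lemma color_at_coloring C : is_coloring Q C -> coloring_at G Q (color_at C).
Proof.
move=> hC; split.
  move=> e; have [x cx] := covers_ex e 1.
  have pf : is_piece (next D e, @None (edge D)) by [].
  have cy : covers (Sub (next D e, None) pf : piece D) (next D e) 0.
    split; rewrite /started ?SubK // => g [cg _] g0.
    by case/andP: (par_in01 reg cg) => /lt_trans/(_ g0); rewrite ltxx.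
  rewrite (color_atE _ cx) (color_atE _ cy); congr (C _); apply/esym/arc_of_eq.
  apply: connect1; apply/asboolP; left; apply/continuedP.
  by case: (cx) => -> _ _; rewrite SubK.
move=> e; split.
  move=> s t s0 st t1 cl; have [x cx] := covers_ex e s.
  rewrite (color_atE _ cx) (@color_atE _ x) //.
  have [h1 h2 h3] := cx; split => //.
    rewrite /started in h2 *; case: (val x).2 h2 => // g /lt_trans; exact.
  move=> g cg gt; apply: h3 => //; rewrite ltNge; apply/negP => sg.
  have /cl : chi G e g by apply/asboolP; case: cg.
  by rewrite /= sg gt.
move=> f t ef f0 ft t1 cl /=.
have [u cu] := covers_ex e (par (pos D) e f).
have [v cv] := covers_ex f (par (pos D) f e).
rewrite (color_atE _ cu) (color_atE _ cv).
have cr : crosses (pos D) e f by apply/asboolP.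
have [ov|/asboolP nov] := boolP `[< lay D e f = Over >].
  move/asboolP: ov => ov.
  rewrite /out /= ov; apply: color_atE; have [h1 h2 h3] := cu; split=> //.
    rewrite /started in h2 *; case: (val u).2 h2 => // g /lt_trans; exact.
  move=> g cg gt; apply: h3 => //; rewrite ltNge le_eqVlt; apply/negP => /orP[/eqP fg|fg].
    have [cg' nov] := cg.
    by apply: nov; rewrite -(par_inj reg cr cg' fg).
  have /cl : chi G e g by apply/asboolP; case: cg.
  by rewrite /= fg gt.
have ct : cut e f by [].
have pf : is_piece (e, Some f) by apply/asboolP.
rewrite (@color_atE _ (Sub (e, Some f) pf)).
  by apply: coloring_out => //; rewrite SubK.
split; rewrite /started ?SubK //= => g cg gt fg.
have /cl : chi G e g by apply/asboolP; case: cg.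
by rewrite /= fg gt.
Qed.

Lemma color_at_inj C C' : is_coloring Q C -> is_coloring Q C' ->
  (forall e t, 0 <= t <= 1 -> color_at C e t = color_at C' e t) -> C = C'.
Proof.
move=> hC hC' E; apply/ffunP => A; have [x ->] := arc_of_surj A.
case Ex : (val x) => [e [f|]].
  have ct : cut e f by have := @cut_of_piece _ _ x f; rewrite Ex; apply.
  have [u cu] := covers_ex e (par (pos D) e f).
  have [v cv] := covers_ex f (par (pos D) f e).
  rewrite (coloring_out hC ct cu Ex cv) (coloring_out hC' ct cu Ex cv).
  have [cr _] := ct; have crC := crossesC cr.
  by rewrite -!(color_atE _ cu) -!(color_atE _ cv) !E ?(par_in01W reg).
have cx : covers x e 0.
  split; rewrite /started ?Ex // => g [cg _] g0.
  by case/andP: (par_in01 reg cg) => /lt_trans/(_ g0); rewrite ltxx.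
by rewrite -!(color_atE _ cx) E // lexx ler01.
Qed.

Definition piece_color (c : edge D -> R -> X) x : X :=
  let e := (val x).1 in
  if (val x).2 is Some f
  then out G Q e f (c e (par (pos D) e f)) (c f (par (pos D) f e)) else c e 0.

Lemma piece_color_covers c x e t : coloring_at G Q c -> covers x e t ->
  0 <= t <= 1 -> piece_color c x = c e t.
Proof.
move=> [_ hc] [x1 x2 x3] /andP[t0 t1].
have ov f : chi G e f -> started x (place G e f) -> place G e f < t ->
    level G e f = Over.
  move=> ef sf ft; apply: contrapT => nov; apply: (x3 f) => //.
  by split=> //; apply/asboolP.
have cx := @cut_of_piece _ _ x.
rewrite /piece_color /= x1; rewrite /started x1 in x2 ov cx.
case: (val x).2 x2 ov cx => [g|] x2 ov cx; last first.
  apply/esym; apply: (carries_uncut (hc e)); first by rewrite t0.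
  by move=> f ef /andP[_]; exact: ov.
have [cg _] := cx _ erefl; have g01 := par_in01W reg cg.
have eg : chi G e g by apply/asboolP.
have [h1 h2] := hc e; apply/esym.
pose r := place G e g; have rt : r < t := x2.
have [r0 r1] := andP (g01 : 0 <= r <= 1).
change (c e t = out G Q e g (c e r) (c g (place G g e))).
suff : forall u, r <= u <= t -> r < u -> c e u =
    out G Q e g (c e r) (c g (place G g e)) by apply; rewrite ?lexx // ltW.
apply: (@position_ind _ _ G e r t (fun u => r < u -> _)).
- by rewrite ltxx.
- move=> v u rv vu ut cl IH ru.
  have [vr|nvr] := eqVneq r v; first by case/negP: (cl g eg); rewrite -vr lexx.
  rewrite -IH ?lt_neqAle ?nvr //; apply: h1 => //; first exact: le_trans rv.
  exact: le_trans t1.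
- move=> f u ef rf fu ut cl IH ru.
  rewrite (h2 f u) //; [|exact: le_trans rf|exact: le_trans t1].
  have [vr|nvr] := eqVneq r (place G e f).
    by rewrite (place_inj ef eg).
  have rf' : r < place G e f by rewrite lt_neqAle nvr.
  by rewrite -IH // {1}/out ov // (lt_le_trans fu).
Qed.

(** Every coloring of positions comes from a coloring of arcs; as the latter is
determined by the positions ([color_at_inj]), both can be used interchangeably. *)
Lemma realize c : coloring_at G Q c -> exists2 C, is_coloring Q C &
  forall e t, 0 <= t <= 1 -> color_at C e t = c e t.
Proof.
move=> hc; have kc := piece_color_covers hc.
have kinv x y : same_arc x y -> piece_color c x = piece_color c y.
  apply: same_arc_invariant => a b /continuedP[vb ca].
  rewrite (kc _ _ _ ca) ?ler01 ?lexx // {1}/piece_color vb /=.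
  by case: hc => -> _.
pose C := [ffun A : arc D => piece_color c (projT1 (cid (arc_of_surj A)))].
have CE x : C (arc_of x) = piece_color c x.
  by rewrite ffunE; case: cid => y /= /arc_of_same/kinv.
exists C; last first.
  move=> e t t01; have [x cx] := covers_ex e t.
  by rewrite (color_atE _ cx) CE (kc _ _ _ cx).
split.
  move=> e f u u' v cr E /(reachesP _ cr) cu hu' /(reachesP _ (crossesC cr)) cv.
  rewrite !CE (kc _ _ _ cu) ?(par_in01W reg) // (kc _ _ _ cv) ?(par_in01W reg)//; last exact: crossesC.
  by rewrite /piece_color hu' /out /= E /positive_crossing E; case: ifP.
move=> e f u u' v v' cr E d0 /(reachesP _ cr) cu hu' /(reachesP _ (crossesC cr)) cv hv'.
have Efe : lay D f e = Sing by case: reg => _ _ h; rewrite (h e f) // E.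
have d1 : 0 < det2 (dir (pos D) f) (dir (pos D) e) by rewrite det2C oppr_gt0.
rewrite !CE (kc _ _ _ cu) ?(par_in01W reg) // (kc _ _ _ cv) ?(par_in01W reg)//; last exact: crossesC.
by rewrite /piece_color hu' hv' /out /= E Efe d1 ltNge (ltW d0).
Qed.

End Positions.

Section Transfer.
Variables (R : realType) (X : finType) (Q : disingquandle X).

Lemma coloringsP (D : diagram R) (C : {ffun arc D -> X}) :
  reflect (is_coloring Q C) (C \in colorings D Q).
Proof. by rewrite finset.in_set; exact: asboolP. Qed.

(** Comparing two finite sets of colorings only takes a relation between colorings
of positions that is total and injective, up to the values outside of the edges. *)
Lemma colorings_transfer (D D' : diagram R)
    (rho : (edge D -> R -> X) -> (edge D' -> R -> X) -> Prop) :
  (forall c, coloring_at (diagram_gauss D) Q c ->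
     exists2 c', coloring_at (diagram_gauss D') Q c' & rho c c') ->
  (forall c1 c2 c1' c2',
     coloring_at (diagram_gauss D) Q c1 -> coloring_at (diagram_gauss D) Q c2 ->
     rho c1 c1' -> rho c2 c2' ->
     (forall e t, 0 <= t <= 1 -> c1' e t = c2' e t) ->
     forall e t, 0 <= t <= 1 -> c1 e t = c2 e t) ->
  (#|colorings D Q| <= #|colorings D' Q|)%N.
Proof.
move=> ex inj.
have ex' C : is_coloring Q C -> exists C', is_coloring Q C' /\
    exists2 c', rho (color_at C) c' &
      forall e t, 0 <= t <= 1 -> color_at C' e t = c' e t.
  move=> /color_at_coloring/ex[c' /realize[C' hC' EC'] rc].
  by exists C'; split=> //; exists c'.
pose F C := if pselect (is_coloring Q C) is left hC
            then Some (projT1 (cid (ex' C hC))) else None.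
have FP C : is_coloring Q C -> exists2 C', F C = Some C' & is_coloring Q C' /\
    exists2 c', rho (color_at C) c' &
      forall e t, 0 <= t <= 1 -> color_at C' e t = c' e t.
  by move=> hC; rewrite /F; case: pselect => // h; case: cid => C' /= ?; exists C'.
have Finj : {in colorings D Q &, injective F}.
  move=> C1 C2 /coloringsP h1 /coloringsP h2.
  have [C1' -> [_ [c1' r1 E1]]] := FP _ h1; have [C2' -> [_ [c2' r2 E2]]] := FP _ h2.
  move=> [E]; apply: (color_at_inj h1 h2).
  apply: (inj _ _ _ _ _ _ r1 r2); [exact: color_at_coloring..|].
  by move=> e t t01; rewrite -E1 // -E2 // E.
rewrite -(card_in_imset Finj) -(card_imset (mem (colorings D' Q)) Some_inj).
apply/subset_leq_card/fintype.subsetP => o /imsetP[C /coloringsP hC ->].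
have [C' -> [hC' _]] := FP _ hC.
by apply/imsetP; exists C' => //; apply/coloringsP.
Qed.

End Transfer.

(** * Diagrams with the same combinatorial structure *)

(** The places themselves need not correspond: only their order matters. *)
Record gauss_iso (R : realType) (S S' : skeleton) (G : gauss R S)
    (G' : gauss R S') (phi : edge S -> edge S') : Prop := GaussIso {
  iso_next : forall e, next S' (phi e) = phi (next S e);
  iso_lab : forall e, lab (phi e) = lab e;
  iso_chi : forall e f, chi G' (phi e) (phi f) = chi G e f;
  iso_level : forall e f, chi G e f -> level G' (phi e) (phi f) = level G e f;
  iso_turn : forall e f, chi G e f -> turn G' (phi e) (phi f) = turn G e f;
  iso_place : forall e f g, chi G e f -> chi G e g ->
    (place G' (phi e) (phi f) < place G' (phi e) (phi g)) =
    (place G e f < place G e g)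
}.

Section Iso.
Variables (R : realType) (S S' : skeleton) (G : gauss R S) (G' : gauss R S').
Variables (phi : edge S -> edge S') (psi : edge S' -> edge S).
Hypotheses (phiK : cancel phi psi) (psiK : cancel psi phi).
Hypothesis iso : gauss_iso G G' phi.
Variables (X : Type) (Q : disingquandle X).
Implicit Types (e f g : edge S) (t u : R).

Lemma gauss_iso_sym : gauss_iso G' G psi.
Proof.
case: iso => h1 h2 h3 h4 h5 h6.
have c (e' f' : edge S') : chi G' e' f' -> chi G (psi e') (psi f') by rewrite -h3 !psiK.
split.
- by move=> e'; rewrite -{2}(psiK e') h1 phiK.
- by move=> e'; rewrite -h2 psiK.
- by move=> e' f'; rewrite -h3 !psiK.
- by move=> e' f' /c/h4 <-; rewrite !psiK.
- by move=> e' f' /c/h5 <-; rewrite !psiK.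
- by move=> e' f' g' /c cf /c cg; rewrite -h6 // !psiK.
Qed.

(** The position [u] is at the same rank among the crossings of [e] as the position
[t] among those of [phi e]. *)
Definition same_place e u t := forall f, chi G e f ->
  (place G e f < u) = (place G' (phi e) (phi f) < t).

Lemma same_place_ex e t : exists2 u, 0 <= u <= 1 & same_place e u t.
Proof.
have [f0 f0P|none] := pickP
    [pred f | chi G e f && (t <= place G' (phi e) (phi f))]; last first.
  exists 1; rewrite ?lexx ?ler01 // => f ef.
  move: (none f); rewrite /= ef /= leNgt => /negbFE ->.
  by case/andP: (place01 ef).
case: (@Order.TotalTheory.arg_minP _ _ _ f0
  [pred f | chi G e f && (t <= place G' (phi e) (phi f))] (place G e) f0P).
move=> f /= /andP[ef tf] fmin; exists (place G e f).
  by case/andP: (place01 ef) => /ltW -> /ltW ->.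
move=> g eg; apply/idP/idP => [gf|gt].
  rewrite ltNge; apply/negP => tg.
  by have := fmin g; rewrite eg tg leNgt gf; apply/implyP.
by rewrite -(iso_place iso) //; exact: lt_le_trans tf.
Qed.

Lemma carries_same_place (c : edge S -> R -> X) e u v : carries G Q c e 0 1 ->
  0 <= u <= 1 -> 0 <= v <= 1 ->
  (forall f, chi G e f -> (place G e f < u) = (place G e f < v)) ->
  c e u = c e v.
Proof.
move=> [h _]; wlog uv : u v / u <= v.
  move=> hw hu hv E; have [|/ltW] := leP u v => uv; first exact: hw.
  by apply/esym/hw => // f /E.
move=> /andP[u0 _] /andP[_ v1] E; have [-> //|nuv] := eqVneq u v.
apply/esym/h => //; first by rewrite lt_neqAle nuv.
by move=> f ef; rewrite -(E f ef) leNgt andNb.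
Qed.

(** The colors at the start of the edges and at their crossings determine all the
others, and correspond even if the places do not. *)
Definition same_arrivals (c : edge S -> R -> X) (c' : edge S' -> R -> X) :=
  (forall e, c' (phi e) 0 = c e 0) /\
  forall e f, chi G e f ->
    c' (phi e) (place G' (phi e) (phi f)) = c e (place G e f).

Lemma out_iso e f (x y : X) : chi G e f ->
  out G' Q (phi e) (phi f) x y = out G Q e f x y.
Proof.
move=> ef; have fe := chiC ef.
by rewrite /out (iso_level iso) // !(iso_turn iso) // (iso_lab iso).
Qed.

Lemma coloring_at_iso c : coloring_at G Q c ->
  exists2 c', coloring_at G' Q c' & same_arrivals c c'.
Proof.
move=> [hv hc].
pose corr (e' : edge S') t := s2val (cid2 (same_place_ex (psi e') t)).
have corr01 (e' : edge S') t : 0 <= corr e' t <= 1 by rewrite /corr; case: cid2.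
have corrP (e' : edge S') t : same_place (psi e') (corr e' t) t.
  by rewrite /corr; case: cid2.
pose c' (e' : edge S') t := c (psi e') (corr e' t).
have c'E e t u : 0 <= u <= 1 -> same_place e u t -> c' (phi e) t = c e u.
  move=> u01 eu; rewrite /c'.
  move: (corr01 (phi e) t) (corrP (phi e) t); rewrite phiK => h1 h2.
  by apply: (carries_same_place (hc e)) => // f ef; rewrite h2 // eu.
have pl01 e f : chi G e f -> 0 <= place G e f <= 1.
  by move=> ef; case/andP: (place01 ef) => /ltW -> /ltW ->.
have pE e f : chi G e f -> same_place e (place G e f) (place G' (phi e) (phi f)).
  by move=> ef g eg; rewrite (iso_place iso).
have pl' e f : chi G e f -> 0 < place G' (phi e) (phi f) < 1.
  by move=> ef; apply: place01; rewrite (iso_chi iso).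
have sp0 e : same_place e 0 0.
  move=> f ef; rewrite !ltNge; congr (~~ _).
  case/andP: (place01 ef) => /ltW -> _; apply/esym/ltW.
  by case/andP: (pl' _ _ ef).
have sp1 e : same_place e 1 1.
  move=> f ef; case/andP: (place01 ef) => _ ->; apply/esym.
  by case/andP: (pl' _ _ ef).
exists c'; last first.
  split=> [e|e f ef]; first by rewrite (c'E e 0 0) // lexx ler01.
  by apply: c'E; [exact: pl01|exact: pE].
split.
  move=> e'; rewrite -(psiK e') (iso_next iso) (c'E _ 0 0) ?lexx ?ler01 //.
  by rewrite (c'E _ 1 1) ?lexx ?ler01.
move=> e'; rewrite -(psiK e'); move: (psi e') => {e'} e; split.
  move=> s t s0 st t1 cl; rewrite /c'.
  have := corr01 (phi e) s; have := corr01 (phi e) t.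
  have := corrP (phi e) s; have := corrP (phi e) t; rewrite phiK => ht hs h1 h2.
  apply: (carries_same_place (hc e)) => // f ef; rewrite ht // hs //.
  apply/idP/idP => [ft|]; last by move/lt_trans; apply.
  have := cl (phi f); rewrite (iso_chi iso) ef ft andbT => /(_ isT).
  by rewrite -ltNge.
move=> f'; rewrite -(psiK f'); move: (psi f') => {f'} f t.
rewrite (iso_chi iso) => ef f0 ft t1 cl.
rewrite (c'E _ _ _ (pl01 _ _ ef) (pE _ _ ef)).
rewrite (c'E _ _ _ (pl01 _ _ (chiC ef)) (pE _ _ (chiC ef))) out_iso //.
have := corr01 (phi e) t; have := corrP (phi e) t; rewrite /c' phiK => ht /andP[_ h1].
apply: (carries_cross (hc e)) => //; rewrite ?ht //.
  by case/andP: (pl01 _ _ ef).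
move=> g eg; rewrite ht // -(iso_place iso) //.
by apply: cl; rewrite (iso_chi iso).
Qed.

Lemma same_arrivals_inj c1 c2 c1' c2' :
  coloring_at G Q c1 -> coloring_at G Q c2 ->
  same_arrivals c1 c1' -> same_arrivals c2 c2' ->
  (forall (e' : edge S') t, 0 <= t <= 1 -> c1' e' t = c2' e' t) ->
  forall e t, 0 <= t <= 1 -> c1 e t = c2 e t.
Proof.
move=> [_ h1] [_ h2] [s1 a1] [s2 a2] E e.
apply: (carries_unique (h1 e) (h2 e)).
  by rewrite -s1 -s2 E // lexx ler01.
move=> f x /chiC fe _; rewrite -a1 // -a2 // E //.
have : chi G' (phi f) (phi e) by rewrite (iso_chi iso).
by move/place01/andP => [/ltW -> /ltW ->].
Qed.

End Iso.

Lemma colorings_iso (R : realType) (D D' : diagram R) (X : finType)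
    (Q : disingquandle X) (phi : edge D -> edge D') : bijective phi ->
  gauss_iso (diagram_gauss D) (diagram_gauss D') phi ->
  #|colorings D' Q| = #|colorings D Q|.
Proof.
move=> [psi phiK psiK] iso; have iso' := gauss_iso_sym phiK psiK iso.
apply/eqP; rewrite eqn_leq; apply/andP; split.
  exact: (colorings_transfer (coloring_at_iso (Q := Q) psiK phiK iso')
                             (same_arrivals_inj (Q := Q) iso')).
exact: (colorings_transfer (coloring_at_iso (Q := Q) phiK psiK iso)
                           (same_arrivals_inj (Q := Q) iso)).
Qed.

Lemma colorings_relabeling (R : realType) (D D' : diagram R) (X : finType)
    (Q : disingquandle X) : relabeling D D' -> #|colorings D' Q| = #|colorings D Q|.
Proof.
move=> [phi [bphi hn hl hp hy]]; apply: (colorings_iso _ bphi).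
have dE e : dir (pos D') (phi e) = dir (pos D) e by rewrite /dir hn !hp.
have sE e : segment (pos D') (phi e) = segment (pos D) e.
  by rewrite /segment /point dE hp.
have [psi phiK _] := bphi; have iphi := can_inj phiK.
have cE e f : crosses (pos D') (phi e) (phi f) <-> crosses (pos D) e f.
  by rewrite /crosses !hn !(inj_eq iphi) !sE.
have pE e f : par (pos D') (phi e) (phi f) = par (pos D) e f.
  by rewrite /par !dE !hp.
split=> //=.
- by move=> e f; apply/asboolP/asboolP => /cE.
- by move=> e f /asboolP; exact: hy.
- by move=> e f _; rewrite !dE.
- by move=> e f g _ _; rewrite !pE.
Qed.

(** * Subdivisions *)

(** The two parts of the subdivided edge are reparametrized affinely: the part [a]
is the piece of the edge [whole a] that starts at [offset a] and has length
[scale a].  Colors restrict to the parts, and glue along the new vertex. *)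
Section Subdivision.
Variables (R : realType) (S S' : skeleton) (G : gauss R S) (G' : gauss R S').
Variables (e0 : edge S) (t0 : R) (phi : option (edge S) -> edge S').
Hypotheses (t01 : 0 < t0 < 1) (bphi : bijective phi).
Hypothesis nextN : next S' (phi None) = phi (Some (next S e0)).
Hypothesis nextS : forall x, next S' (phi (Some x)) =
  phi (if x == e0 then None else Some (next S x)).
Variables (X : Type) (Q : disingquandle X).
Implicit Types (a b : option (edge S)) (s t : R).

Definition whole a := odflt e0 a.
Definition offset a : R := if a is Some _ then 0 else t0.
Definition scale a : R :=
  if a is Some x then (if x == e0 then t0 else 1) else 1 - t0.
Definition onto_whole a s := offset a + scale a * s.

Lemma scale_gt0 a : 0 < scale a.
Proof. by case/andP: t01 => ? ?; case: a => [x|] /=; [case: eqP|]; lra. Qed.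

Lemma offset_scale a : 0 <= offset a /\ offset a + scale a <= 1.
Proof. by case/andP: t01 => ? ?; case: a => [x|] /=; [case: eqP|]; lra. Qed.

Lemma whole_inj a b : whole a = whole b -> a <> b ->
  (a = Some e0 /\ b = None) \/ (a = None /\ b = Some e0).
Proof.
case: a b => [x|] [y|] //= h ab.
- by case: ab; rewrite h.
- by left; rewrite h.
- by right; rewrite h.
Qed.

Lemma next_whole a b : next S' (phi a) = phi b ->
  (a = Some e0 /\ b = None) \/ next S (whole a) = whole b.
Proof.
have [psi phiK _] := bphi; case: a => [x|].
  rewrite nextS => /(can_inj phiK); case: eqP => [-> <-|_ <-]; first by left.
  by right.
by rewrite nextN => /(can_inj phiK) <-; right.
Qed.

Hypothesis lab_phi : forall a, lab (phi a) = lab (whole a).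
Hypothesis sub_chi : forall a b, chi G' (phi a) (phi b) ->
  [/\ chi G (whole a) (whole b),
      place G (whole a) (whole b) = onto_whole a (place G' (phi a) (phi b)),
      level G (whole a) (whole b) = level G' (phi a) (phi b) &
      turn G (whole a) (whole b) = turn G' (phi a) (phi b)].
Hypothesis sub_ex : forall a f, chi G (whole a) f ->
  offset a <= place G (whole a) f < offset a + scale a ->
  exists2 b, whole b = f & chi G' (phi a) (phi b).

Definition restricts (c : edge S -> R -> X) (c' : edge S' -> R -> X) :=
  forall a s, 0 <= s <= 1 -> c' (phi a) s = c (whole a) (onto_whole a s).

Lemma onto_whole_lt a s t : (onto_whole a s < onto_whole a t) = (s < t).
Proof. by rewrite ltrD2l ltr_pM2l // scale_gt0. Qed.

Lemma onto_whole_le a s t : (onto_whole a s <= onto_whole a t) = (s <= t).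
Proof. by rewrite lerD2l ler_pM2l // scale_gt0. Qed.

Lemma onto_whole0 a : onto_whole a 0 = offset a.
Proof. by rewrite /onto_whole mulr0 addr0. Qed.

Lemma onto_whole1 a : onto_whole a 1 = offset a + scale a.
Proof. by rewrite /onto_whole mulr1. Qed.

Lemma onto_whole_surj a t : offset a <= t <= offset a + scale a ->
  exists2 s, 0 <= s <= 1 & t = onto_whole a s.
Proof.
rewrite -onto_whole1 -onto_whole0 => h.
have E : t = onto_whole a ((t - offset a) / scale a).
  by rewrite /onto_whole mulrCA divff ?mulr1 ?lt0r_neq0 ?scale_gt0 //; ring.
exists ((t - offset a) / scale a); last exact: E.
by rewrite -(onto_whole_le a 0) -(onto_whole_le a _ 1) -E.
Qed.

Lemma out_sub a b (x y : X) : chi G' (phi a) (phi b) ->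
  out G' Q (phi a) (phi b) x y = out G Q (whole a) (whole b) x y.
Proof.
move=> ab; have [_ _ E1 E2] := sub_chi ab; have [_ _ _ E3] := sub_chi (chiC ab).
by rewrite /out E1 E2 E3 lab_phi.
Qed.

Lemma arrival_sub c c' a b : restricts c c' -> chi G' (phi a) (phi b) ->
  c (whole a) (place G (whole a) (whole b)) =
  c' (phi a) (place G' (phi a) (phi b)).
Proof.
move=> rc ab; have [_ -> _ _] := sub_chi ab; rewrite rc //.
by case/andP: (place01 ab) => /ltW -> /ltW ->.
Qed.

Lemma clear_sub a s t : 0 <= s -> t <= 1 ->
  clear G' (phi a) s t -> clear G (whole a) (onto_whole a s) (onto_whole a t).
Proof.
move=> s0 t1 cl f ef; apply/negP => /andP[sf ft].
have [|b bf ab] := sub_ex ef.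
  rewrite -onto_whole1 (lt_le_trans ft) ?onto_whole_le // andbT.
  by rewrite (le_trans _ sf) // -onto_whole0 onto_whole_le.
have [_ E _ _] := sub_chi ab; rewrite bf in E.
by have := cl _ ab; rewrite -(onto_whole_le a) -(onto_whole_lt a) -E sf ft.
Qed.

Lemma sub_clear a s t :
  clear G (whole a) (onto_whole a s) (onto_whole a t) -> clear G' (phi a) s t.
Proof.
have [psi phiK psiK] := bphi.
move=> cl f'; rewrite -(psiK f') => ab; have [ef E _ _] := sub_chi ab.
by have := cl _ ef; rewrite E onto_whole_le onto_whole_lt.
Qed.

Lemma clear_after_sub a b t : t <= 1 -> chi G' (phi a) (phi b) ->
  clear_after G' (phi a) (phi b) t <->
  clear_after G (whole a) (whole b) (onto_whole a t).
Proof.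
have [psi phiK psiK] := bphi.
move=> t1 ab; have [eb Eb _ _] := sub_chi ab.
have b0 : 0 <= place G' (phi a) (phi b) by case/andP: (place01 ab) => /ltW.
split=> cl.
  move=> f ef; apply/negP => /andP[sf ft].
  have [|d df ad] := sub_ex ef.
    rewrite -onto_whole1 (lt_le_trans ft) ?onto_whole_le // andbT.
    by rewrite (le_trans _ (ltW sf)) // Eb -onto_whole0 onto_whole_le.
  have [_ E _ _] := sub_chi ad; rewrite df in E.
  by have := cl _ ad; rewrite -(onto_whole_lt a _ t) -(onto_whole_lt a _ (place _ _ _)) -E -Eb sf ft.
move=> f'; rewrite -(psiK f') => ad; have [ef E _ _] := sub_chi ad.
by have := cl _ ef; rewrite E Eb !onto_whole_lt.
Qed.

Lemma carries_sub c c' a : restricts c c' ->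
  carries G Q c (whole a) (offset a) (offset a + scale a) <->
  carries G' Q c' (phi a) 0 1.
Proof.
have [psi phiK psiK] := bphi.
move=> rc; split=> -[h1 h2]; split.
- move=> s t s0 st t1 cl; rewrite !rc ?s0 ?t1 ?(le_trans s0 (ltW st)) //; last first.
    exact: le_trans (ltW st) t1.
  apply: h1; rewrite -?onto_whole1 -?onto_whole0 ?onto_whole_le ?onto_whole_lt //.
  exact: clear_sub.
- move=> f' t; rewrite -(psiK f'); move: (psi f') => b ab f0 ft t1 cl.
  rewrite out_sub // -!(arrival_sub rc) //; last exact: chiC.
  have [eb E _ _] := sub_chi ab.
  rewrite rc ?t1 ?(le_trans f0 (ltW ft)) //; apply: h2 => //.
  + by rewrite E -onto_whole0 onto_whole_le.
  + by rewrite E onto_whole_lt.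
  + by rewrite -onto_whole1 onto_whole_le.
  + exact/clear_after_sub.
- move=> s t s0 st t1 cl.
  have [|s' /andP[s'0 s'1] Es] := @onto_whole_surj a s.
  + by rewrite s0 (le_trans (ltW st)).
  have [|t' /andP[t'0 t'1] Et] := @onto_whole_surj a t.
  + by rewrite t1 (le_trans s0) // ltW.
  rewrite Es Et -!rc ?s'0 ?t'0 //; apply: h1 => //.
    by rewrite -(onto_whole_lt a) -Es -Et.
  by apply: sub_clear; rewrite -Es -Et.
- move=> f t ef f0 ft t1 cl.
  have [|b bf ab] := sub_ex ef; first by rewrite f0 (lt_le_trans ft).
  have [|t' /andP[t'0 t'1] Et] := @onto_whole_surj a t.
  + by rewrite t1 (le_trans f0) // ltW.
  rewrite -bf in ef f0 ft cl *; have [_ E _ _] := sub_chi ab.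
  rewrite -out_sub // !(arrival_sub rc) //; last exact: chiC.
  rewrite Et -rc ?t'0 //; apply: h2 => //.
  + by rewrite -(onto_whole_le a) onto_whole0 -E.
  + by rewrite -(onto_whole_lt a) -E -Et.
  + by apply/clear_after_sub; rewrite -?Et.
Qed.

Lemma carries_whole c c' : restricts c c' ->
  (forall e, carries G Q c e 0 1) <-> (forall e', carries G' Q c' e' 0 1).
Proof.
have [psi phiK psiK] := bphi.
move=> rc; split=> h.
  move=> e'; rewrite -(psiK e'); apply/(carries_sub _ rc).
  have [o1 o2] := offset_scale (psi e').
  by apply: carriesS (h _).
move=> e; have [->|ee0] := eqVneq e e0; last first.
  have /(carries_sub _ rc) := h (phi (Some e)).
  by rewrite /= (negbTE ee0) add0r.
have /(carries_sub _ rc) := h (phi (Some e0)); have /(carries_sub _ rc) := h (phi None).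
rewrite /= eqxx add0r addrC subrK; case/andP: t01 => ? ?.
by move=> h1 h2; apply: carries_cat h2 h1; apply: ltW.
Qed.

Lemma restricts_vertex c c' : restricts c c' ->
  (forall e, c (next S e) 0 = c e 1) <->
  (forall e', c' (next S' e') 0 = c' e' 1).
Proof.
have [psi phiK psiK] := bphi; move=> rc.
have l1 : 0 <= (1 : R) <= 1 by rewrite ler01 lexx.
have l0 : 0 <= (0 : R) <= 1 by rewrite ler01 lexx.
split=> h.
  move=> e'; rewrite -(psiK e'); case: (psi e') => [x|].
    rewrite nextS !rc // onto_whole0 onto_whole1 /=.
    by have [->|_] /= := eqVneq x e0; rewrite add0r.
  by rewrite nextN !rc // onto_whole0 onto_whole1 /= addrC subrK.
move=> e; have [->|ee0] := eqVneq e e0.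
  have := h (phi None); rewrite nextN !rc // onto_whole0 onto_whole1 /=.
  by rewrite addrC subrK.
have := h (phi (Some e)); rewrite nextS (negbTE ee0) !rc // onto_whole0 onto_whole1 /=.
by rewrite (negbTE ee0) add0r.
Qed.

Lemma restricts_ex c' : (forall e', c' (next S' e') 0 = c' e' 1) ->
  exists c, restricts c c'.
Proof.
move=> h; case/andP: t01 => t00 t011.
exists (fun e t => if e == e0 then
    if t <= t0 then c' (phi (Some e0)) (t / t0)
    else c' (phi None) ((t - t0) / (1 - t0)) else c' (phi (Some e)) t).
move=> [x|] s /andP[s0 s1]; rewrite /onto_whole /= ?eqxx.
  have [->|_] := eqVneq x e0; last by rewrite add0r mul1r.
  by rewrite add0r ger_pMr // s1 mulrAC divff ?mul1r // gt_eqF.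
have n0 : 1 - t0 != 0 by rewrite gt_eqF // subr_gt0.
have [->|sn0] := eqVneq s 0.
  rewrite mulr0 addr0 lexx divff ?gt_eqF //.
  by rewrite -h nextS eqxx.
have sp : 0 < s by rewrite lt_neqAle eq_sym sn0.
rewrite gerDl leNgt mulr_gt0 ?subr_gt0 //=.
by congr (c' _ _); rewrite addrC addrA [- t0 + _]addrC subrr add0r mulrAC divff ?mul1r.
Qed.

Lemma restricts_inj c1 c2 c1' c2' : restricts c1 c1' -> restricts c2 c2' ->
  (forall e' t, 0 <= t <= 1 -> c1' e' t = c2' e' t) ->
  forall e t, 0 <= t <= 1 -> c1 e t = c2 e t.
Proof.
move=> r1 r2 E e t t01'.
suff [a <- [s s01 ->]] : exists2 a, whole a = e &
    exists2 s, 0 <= s <= 1 & t = onto_whole a s by rewrite -r1 // -r2 // E.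
case/andP: t01 => t00 t011; case/andP: t01' => t0' t1'.
have [->|ee0] := eqVneq e e0; last first.
  exists (Some e) => //; apply: onto_whole_surj.
  by rewrite /= (negbTE ee0); lra.
have [tt|tt] := leP t t0.
  by exists (Some e0) => //; apply: onto_whole_surj; rewrite /= eqxx; lra.
by exists None => //; apply: onto_whole_surj; rewrite /=; lra.
Qed.

End Subdivision.

(** No edge passes through the new vertex, so each crossing of the subdivided edge
is on exactly one of its parts; conversely two parts that cross do not come from
consecutive edges, since these meet at a vertex only. *)
Lemma colorings_subdivision (R : realType) (D D' : diagram R) (X : finType)
    (Q : disingquandle X) : subdivision D D' -> #|colorings D' Q| = #|colorings D Q|.
Proof.
move=> [e0 [phi [bphi [nN nS] hl [hpS [t0 t01 hpN]] hy]]].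
have reg := diagram_regular D; have reg' := diagram_regular D'.
have [psi phiK psiK] := bphi; have iphi := can_inj phiK.
have t0' : t0 != 0 by case/andP: t01 => /lt0r_neq0.
have dE a : dir (pos D') (phi a) = scale e0 t0 a *: dir (pos D) (whole e0 a).
  rewrite /dir; case: a => [x|] /=.
    rewrite nS !hpS; have [->|_] := eqVneq x e0; last by rewrite hpS scale1r.
    by rewrite hpN /point /dir addrC addKr.
  by rewrite nN hpS hpN /point /dir; apply: row2P; rewrite !mxE; ring.
have pE a s : point (pos D') (phi a) s =
              point (pos D) (whole e0 a) (onto_whole e0 t0 a s).
  rewrite /point dE; case: a => [x|] /=; rewrite ?hpS ?hpN /onto_whole /point /=.
    by rewrite add0r scalerA mulrC.
  by apply: row2P; rewrite !mxE; ring.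
have on01 a s : 0 <= s <= 1 -> 0 <= onto_whole e0 t0 a s <= 1.
  move=> /andP[s0 s1]; have [o1 o2] := offset_scale e0 t01 a.
  have := onto_whole_le e0 t01 a 0 s; have := onto_whole_le e0 t01 a s 1.
  by rewrite onto_whole0 onto_whole1 s0 s1; lra.
have sE a z : segment (pos D') (phi a) z -> segment (pos D) (whole e0 a) z.
  by move=> [s /on01 s01 ->]; rewrite pE; exists (onto_whole e0 t0 a s).
have nadj a b z : crosses (pos D') (phi a) (phi b) ->
    segment (pos D') (phi a) z -> segment (pos D') (phi b) z ->
    next D (whole e0 a) <> whole e0 b.
  move=> cr za zb E.
  have zE : z = pos D' (phi (Some (whole e0 b))).
    rewrite hpS -E; apply: (adjacent_meet reg); first exact: sE.
    by rewrite E; exact: sE.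
  by apply: (crossing_not_vertex reg' (v := phi (Some (whole e0 b))) cr); rewrite -zE.
have crE a b : crosses (pos D') (phi a) (phi b) ->
    crosses (pos D) (whole e0 a) (whole e0 b).
  move=> cr; have [/eqP n1 /eqP n2 /eqP n3 [z [za zb]]] := cr; split.
  - apply/eqP => /whole_inj h; have : a <> b by move=> E; apply: n1; rewrite E.
    by case/h => -[E1 E2]; [apply: n2|apply: n3]; rewrite E1 E2 nS eqxx.
  - by apply/eqP/(nadj _ _ z).
  - by apply/eqP/(nadj _ _ z) => //; exact: crossesC.
  - by exists z; split; exact: sE.
pose G := diagram_gauss D; pose G' := diagram_gauss D'.
have sub_chi a b : chi G' (phi a) (phi b) ->
  [/\ chi G (whole e0 a) (whole e0 b),
      place G (whole e0 a) (whole e0 b) = onto_whole e0 t0 a (place G' (phi a) (phi b)),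
      level G (whole e0 a) (whole e0 b) = level G' (phi a) (phi b) &
      turn G (whole e0 a) (whole e0 b) = turn G' (phi a) (phi b)].
  move=> /asboolP cr; split=> /=.
  - exact/asboolP/crE.
  - apply/esym/(par_hits reg (crE _ _ cr)).
      by rewrite -pE (crosses_point reg' cr) pE.
  - by rewrite hy.
  - by rewrite !dE det2Zl det2Zr !pmulr_rgt0 ?scale_gt0.
have sub_ex a f : chi G (whole e0 a) f ->
  offset t0 a <= place G (whole e0 a) f < offset t0 a + scale e0 t0 a ->
  exists2 b, whole e0 b = f & chi G' (phi a) (phi b).
  move=> /asboolP cr /andP[l1 l2].
  have [s s01 Es] : exists2 s, 0 <= s <= 1 & place G (whole e0 a) f = onto_whole e0 t0 a s.
    by apply: onto_whole_surj => //; rewrite l1 ltW.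
  have [b bf [u u01 Eu]] : exists2 b, whole e0 b = f &
      exists2 u, 0 <= u <= 1 & place G f (whole e0 a) = onto_whole e0 t0 b u.
    have q01 := par_in01W reg (crossesC cr); have [q0 q1] := andP q01.
    have [fe0|ee0] := eqVneq f e0; last first.
      exists (Some f) => //; apply: onto_whole_surj => //.
      by rewrite /= (negbTE ee0) q0 add0r.
    subst f; have [t00 t011] := andP t01.
    have [tt|tt] := leP (place G e0 (whole e0 a)) t0.
      exists (Some e0) => //; apply: onto_whole_surj => //.
      by rewrite /offset /scale eqxx add0r tt andbT.
    exists None => //; apply: onto_whole_surj => //.
    by rewrite /offset /scale (ltW tt) addrC subrK.
  exists b => //; apply/asboolP; rewrite -bf in cr Eu Es.
  have [/eqP n1 /eqP n2 /eqP n3 _] := cr; split.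
  - by apply/eqP => /iphi E; apply: n1; rewrite E.
  - by apply/eqP => /(next_whole bphi nN nS) [[E1 E2]|//]; apply: n1; rewrite E1 E2.
  - by apply/eqP => /(next_whole bphi nN nS) [[E1 E2]|//]; apply: n1; rewrite E1 E2.
  exists (point (pos D') (phi a) s); split; first by exists s.
  exists u => //; rewrite !pE -Es -Eu; exact: (crosses_point reg cr).
have cw (c : edge D -> R -> X) c' (rc : restricts e0 t0 phi c c') :=
  carries_whole t01 bphi Q hl sub_chi sub_ex rc.
have rv (c : edge D -> R -> X) c' (rc : restricts e0 t0 phi c c') := restricts_vertex bphi nN nS rc.
apply/eqP; rewrite eqn_leq; apply/andP; split.
  apply: (colorings_transfer (rho := fun c' c => restricts e0 t0 phi c c')).
    move=> c' [hv hc]; have [c rc] := restricts_ex t01 nS hv.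
    by exists c => //; split; [exact: (proj2 (rv _ _ rc) hv)|exact: (proj2 (cw _ _ rc) hc)].
  move=> c1' c2' c1 c2 _ _ r1 r2 E e'; rewrite -(psiK e') => t t01'.
  by rewrite r1 // r2 // E // on01.
apply: (colorings_transfer (rho := fun c c' => restricts e0 t0 phi c c')); last first.
  by move=> c1 c2 c1' c2' _ _; exact: restricts_inj.
move=> c [hv hc].
pose c' e' s := c (whole e0 (psi e')) (onto_whole e0 t0 (psi e') s).
have rc : restricts e0 t0 phi c c' by move=> a s _; rewrite /c' phiK.
by exists c' => //; split; [exact: (proj1 (rv _ _ rc) hv)|exact: (proj1 (cw _ _ rc) hc)].
Qed.

(** * Deformations *)

(** By connectedness of the interval. *)
Lemma locally_constant (R : realType) (P : R -> Prop) :
  (forall t : R, 0 <= t <= 1 ->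
     \forall s \near t, 0 <= s <= 1 -> (P s <-> P t)) ->
  forall t : R, 0 <= t <= 1 -> (P t <-> P 0).
Proof.
move=> loc t t01; pose B := `[0, 1] `&` [set t | P t <-> P 0].
suff : B = `[0, 1] by move/seteqP => [_ /(_ t)]; rewrite /= in_itv /= => /(_ t01) [].
apply: (@segment_connected R 0 1).
- by exists 0; split=> //=; rewrite in_itv /= lexx ler01.
- exists ([set t | 0 <= t <= 1 -> (P t <-> P 0)]^°); first exact: open_interior.
  apply/seteqP; split=> s [] /=; rewrite in_itv /= => s01 h; split=> //=.
    by apply: filterS (loc s s01) => u hu /hu; rewrite h.
  by apply: (interior_subset h).
- exists (~` [set t | 0 <= t <= 1 -> ~ (P t <-> P 0)]^°).
    by apply: open_closedC; exact: open_interior.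
  apply/seteqP; split=> s [] /=; rewrite in_itv /= => s01 h; split=> //=.
    by move=> /interior_subset /= /(_ s01).
  apply: contrapT => nP; apply: h.
  by apply: filterS (loc s s01) => u hu /hu; rewrite /= => ->.
Qed.

Section Deformation.
Variables (R : realType) (S : skeleton) (i : layering S) (h : R -> position R S).
Hypothesis hcont : forall e, continuous (fun t : R => h t e : 'rV[R]_2).
Hypothesis hreg : forall t, 0 <= t <= 1 -> regular (h t) i.
Implicit Types (e f g : edge S) (t s u v : R).

Lemma coord_cvg e k t : (fun s => h s e ord0 k) @ t --> h t e ord0 k.
Proof. exact: (continuous_comp (@hcont e t) (@coord_continuous _ _ _ _ _ _)). Qed.

Lemma dir_cvg e k t : (fun s => dir (h s) e ord0 k) @ t --> dir (h t) e ord0 k.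
Proof.
have -> : (fun s => dir (h s) e ord0 k) =
          (fun s => h s (next S e) ord0 k - h s e ord0 k).
  by apply/funext => s; rewrite !mxE.
by rewrite !mxE; apply: cvgB; exact: coord_cvg.
Qed.

Lemma det2_cvg (x y : R -> 'rV[R]_2) t :
  (forall k, (fun s => x s ord0 k) @ t --> x t ord0 k) ->
  (forall k, (fun s => y s ord0 k) @ t --> y t ord0 k) ->
  (fun s => det2 (x s) (y s)) @ t --> det2 (x t) (y t).
Proof. by move=> hx hy; apply: cvgB; apply: cvgM. Qed.

Lemma det_dir_cvg e f t :
  (fun s => det2 (dir (h s) e) (dir (h s) f)) @ t -->
  det2 (dir (h t) e) (dir (h t) f).
Proof.
apply: (det2_cvg (x := fun s => dir (h s) e) (y := fun s => dir (h s) f)).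
  by move=> k; exact: dir_cvg.
by move=> k; exact: dir_cvg.
Qed.

Lemma par_cvg e f t : crosses (h t) e f -> 0 <= t <= 1 ->
  (fun s => par (h s) e f) @ t --> par (h t) e f.
Proof.
move=> cr t01; apply: cvgM; last first.
  by apply: cvgV; [exact: (crosses_det (hreg t01))|exact: det_dir_cvg].
apply: (det2_cvg (x := fun s => h s f - h s e) (y := fun s => dir (h s) f)).
  move=> k; have -> : (fun s => (h s f - h s e) ord0 k) =
                      (fun s => h s f ord0 k - h s e ord0 k).
    by apply/funext => s; rewrite !mxE.
  by rewrite !mxE; apply: cvgB; exact: coord_cvg.
by move=> k; exact: dir_cvg.
Qed.

(** Two disjoint edges stay disjoint for a while because they are compact. *)
Lemma disjoint_near e f t :
  (forall u v, 0 <= u <= 1 -> 0 <= v <= 1 ->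
     point (h t) e u <> point (h t) f v) ->
  \forall s \near t, forall u v, 0 <= u <= 1 -> 0 <= v <= 1 ->
     point (h s) e u <> point (h s) f v.
Proof.
move=> dis; pose K : set (R * R) := `[0, 1] `*` `[0, 1].
have Kc : compact K by apply: compact_setX; exact: segment_compact.
have nc := proj1 (compact_near_coveringP K) Kc.
suff : \forall s \near t, K `<=` [set x | point (h s) e x.1 <> point (h s) f x.2].
  apply: filterS => s hs u v u01 v01; apply: (hs (u, v)); split;
    by rewrite /= in_itv.
apply: (nc R (nbhs t) (fun s x => point (h s) e x.1 <> point (h s) f x.2) _).
move=> [u v] [/= u01 v01].
rewrite !in_itv /= in u01 v01.
pose Phi k (z : (R * R) * R) := point (h z.2) e z.1.1 ord0 k - point (h z.2) f z.1.2 ord0 k.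
have PhiE k : Phi k = fun z => h z.2 e ord0 k + z.1.1 * dir (h z.2) e ord0 k -
    (h z.2 f ord0 k + z.1.2 * dir (h z.2) f ord0 k).
  by apply/funext => z; rewrite /Phi /point !mxE.
have snd_cvg (q : R -> R) : q @ t --> q t ->
    (fun z : (R * R) * R => q z.2) @ nbhs ((u, v), t) --> q t.
  by move=> hq; apply: cvg_comp hq; exact: cvg_snd.
have c1 : (fun z : (R * R) * R => z.1.1) @ nbhs ((u, v), t) --> u.
  by apply: (@cvg_comp _ _ _ fst fst _ (nbhs (u, v)) _); exact: cvg_fst.
have c2 : (fun z : (R * R) * R => z.1.2) @ nbhs ((u, v), t) --> v.
  by apply: (@cvg_comp _ _ _ fst snd _ (nbhs (u, v)) _); [exact: cvg_fst|exact: cvg_snd].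
have Phic k : Phi k @ nbhs ((u, v), t) --> Phi k ((u, v), t).
  rewrite PhiE /=; apply: cvgB; apply: cvgD.
  - exact: (snd_cvg (fun s => h s e ord0 k) (@coord_cvg e k t)).
  - apply: cvgM; first exact: c1.
    exact: (snd_cvg (fun s => dir (h s) e ord0 k) (@dir_cvg e k t)).
  - exact: (snd_cvg (fun s => h s f ord0 k) (@coord_cvg f k t)).
  - apply: cvgM; first exact: c2.
    exact: (snd_cvg (fun s => dir (h s) f ord0 k) (@dir_cvg f k t)).
have [k kn0] : exists k, Phi k ((u, v), t) != 0.
  apply: contrapT => /forallNP no; apply: (dis u v u01 v01).
  by apply: row2P; apply/eqP; rewrite -subr_eq0; apply/negP => /negP;
    [move/(no ord0)|move/(no ord_max)].
have H := cvgr_neq0 (FF := nbhs_filter ((u, v), t)) _ (Phic k) kn0.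
suff : nbhs ((u, v), t)
    [set z : (R * R) * R | point (h z.2) e z.1.1 <> point (h z.2) f z.1.2] by [].
apply: (@filterS _ _ (nbhs_filter ((u, v), t)) _ _ _ H) => -[[u' v'] s'] /=; apply: contra_neq_not => E.
by rewrite /Phi /= E subrr.
Qed.

Lemma crosses_near e f t : 0 <= t <= 1 ->
  \forall s \near t, 0 <= s <= 1 -> (crosses (h s) e f <-> crosses (h t) e f).
Proof.
move=> t01; have [/asboolP cr|/asboolP ncr] := boolP `[< crosses (h t) e f >].
  have crC := crossesC cr.
  have /andP[p0 p1] := par_in01 (hreg t01) cr.
  have /andP[q0 q1] := par_in01 (hreg t01) crC.
  have dn := crosses_det (hreg t01) cr.
  near=> s => s01; split=> // _; have [n1 n2 n3 _] := cr; split=> //.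
  exists (point (h s) e (par (h s) e f)); split.
    exists (par (h s) e f) => //; apply/andP; split; apply: ltW.
      by near: s; apply: (cvgr_gt _ (par_cvg cr t01)).
    by near: s; apply: (cvgr_lt _ (par_cvg cr t01)).
  exists (par (h s) f e); last first.
    by apply: point_par; near: s; apply: (cvgr_neq0 _ (@det_dir_cvg e f t)).
  apply/andP; split; apply: ltW.
    by near: s; apply: (cvgr_gt _ (par_cvg crC t01)).
  by near: s; apply: (cvgr_lt _ (par_cvg crC t01)).
have [n1|n1] := boolP [&& e != f, next S e != f & next S f != e]; last first.
  near=> s => s01; split=> [[m1 m2 m3 _]|//].
  by case/negP: n1; rewrite m1 m2.
have [m1 m2 m3] := and3P n1.
have /disjoint_near D : forall u v, 0 <= u <= 1 -> 0 <= v <= 1 ->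
    point (h t) e u <> point (h t) f v.
  move=> u v u01 v01 E; apply: ncr; split=> //.
  by exists (point (h t) e u); split; [exists u|exists v].
near=> s => _; split=> // -[_ _ _ [x [[u u01 ->] [v v01 E]]]].
suff /(_ u v u01 v01) : forall u v, 0 <= u <= 1 -> 0 <= v <= 1 ->
    point (h s) e u <> point (h s) f v by [].
by near: s; exact: D.
Unshelve. all: by end_near. Qed.

Lemma crosses_constant e f t : 0 <= t <= 1 ->
  (crosses (h t) e f <-> crosses (h 0) e f).
Proof.
exact: (locally_constant (P := fun t => crosses (h t) e f) (@crosses_near e f)).
Qed.

Lemma sign_near (q : R -> R) t : q @ t --> q t -> q t != 0 ->
  \forall s \near t, 0 <= s <= 1 -> (0 < q s <-> 0 < q t).
Proof.
move=> qc; rewrite neq_lt => /orP[n|p]; near=> s => _.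
  have qs : q s < 0 by near: s; exact: (cvgr_lt _ qc).
  by split; rewrite ltNge ltW.
by split=> // _; near: s; exact: (cvgr_gt _ qc).
Unshelve. all: by end_near. Qed.

Lemma turn_constant e f : crosses (h 0) e f -> forall t, 0 <= t <= 1 ->
  (0 < det2 (dir (h t) e) (dir (h t) f) <-> 0 < det2 (dir (h 0) e) (dir (h 0) f)).
Proof.
move=> cr; apply: (locally_constant (P := fun t => 0 < det2 (dir (h t) e) (dir (h t) f))) => t t01.
apply: (sign_near (q := fun t => det2 (dir (h t) e) (dir (h t) f))).
  exact: det_dir_cvg.
by apply: (crosses_det (hreg t01)); apply/(crosses_constant e f t01).
Qed.

Lemma order_constant e f g : crosses (h 0) e f -> crosses (h 0) e g -> f != g ->
  forall t, 0 <= t <= 1 ->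
  (0 < par (h t) e g - par (h t) e f <-> 0 < par (h 0) e g - par (h 0) e f).
Proof.
move=> cf cg fg.
apply: (locally_constant (P := fun t => 0 < par (h t) e g - par (h t) e f)) => t t01.
have cf' : crosses (h t) e f by apply/(crosses_constant e f t01).
have cg' : crosses (h t) e g by apply/(crosses_constant e g t01).
apply: (sign_near (q := fun t => par (h t) e g - par (h t) e f)).
  by apply: cvgB; exact: par_cvg.
rewrite subr_eq0; apply: contra_neq fg => E.
exact: (par_inj (hreg t01) cf' cg' (esym E)).
Qed.

End Deformation.

(** General position throughout the motion prevents the crossings, their signs and
their order along the edges from changing: each of them is locally constant. *)
Lemma colorings_deformation (R : realType) (S : skeleton) (p q : position R S)
    (i : layering S) (hp : regular p i) (hq : regular q i) (X : finType)
    (Q : disingquandle X) : deformation i p q ->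
  #|colorings (Diagram hq) Q| = #|colorings (Diagram hp) Q|.
Proof.
move=> [h [h0 h1 hc hr]]; apply: (@colorings_iso _ (Diagram hp) (Diagram hq) _ _ id).
  by exists id.
have l1 : 0 <= (1 : R) <= 1 by rewrite ler01 lexx.
have cE := crosses_constant hc hr _ _ l1; rewrite h0 h1 in cE.
have tE := turn_constant hc hr _ l1; rewrite h0 h1 in tE.
have oE := order_constant hc hr _ _ _ l1; rewrite h0 h1 in oE.
split=> //=.
- by move=> e f; apply/asboolP/asboolP => /cE.
- by move=> e f /asboolP cr; apply/idP/idP => /(tE _ _ cr).
- move=> e f g /asboolP cf /asboolP cg.
  have [->|fg] := eqVneq f g; first by rewrite !ltxx.
  by rewrite -[LHS]subr_gt0 -[RHS]subr_gt0; apply/idP/idP => /(oE _ _ _ cf cg fg).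
Qed.

(** * Replacing the inside of a disc *)

(** A local move changes the diagram inside of a disc, which is visible from an edge
through the window of parameters between [enter e] and [leave e].  A window that
starts below 0 or ends above 1 extends over the corresponding vertex, whose color is
then free to change; a window reduced to [0, 0] belongs to an edge that avoids the
disc. *)
Section Windows.
Variables (R : realType) (S : skeleton) (X : Type) (Q : disingquandle X).
Variables (enter leave : edge S -> R).
Implicit Types (G : gauss R S) (c m : edge S -> R -> X) (e f g : edge S) (s t : R).

Definition locally_colored G m : Prop :=
  (forall e s t, enter e <= s -> 0 <= s -> t <= leave e -> t <= 1 ->
     carries G Q m e s t) /\
  (forall e, 1 < leave e -> m (next S e) 0 = m e 1).

Definition same_entries c m : Prop := forall e, enter e < leave e ->
  0 <= enter e -> m e (enter e) = c e (enter e).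

Definition same_exits c m : Prop := forall e, enter e < leave e ->
  leave e <= 1 -> m e (leave e) = c e (leave e).

Definition deterministic G : Prop := forall c m,
  locally_colored G c -> locally_colored G m -> same_entries c m ->
  forall e t, enter e <= t <= leave e -> 0 <= t <= 1 -> enter e < leave e ->
    c e t = m e t.

Definition simulates G G' : Prop := forall c, locally_colored G c ->
  exists m, [/\ locally_colored G' m, same_entries c m & same_exits c m].

(** [N] is the set of the pairs of edges whose crossings are inside of the disc. *)
Record same_outside (N : rel (edge S)) G G' : Prop := SameOutside {
  out_chi : forall e f, ~~ N e f -> chi G e f = chi G' e f;
  out_place : forall e f, chi G e f -> ~~ N e f -> place G e f = place G' e f;
  out_level : forall e f, chi G e f -> ~~ N e f -> level G e f = level G' e f;
  out_turn : forall e f, chi G e f -> ~~ N e f -> turn G e f = turn G' e f;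
  out_far : forall e f, chi G e f -> ~~ N e f ->
    place G e f < enter e \/ leave e < place G e f;
  out_in : forall e f, chi G e f -> N e f -> enter e <= place G e f < leave e;
  out_in' : forall e f, chi G' e f -> N e f -> enter e <= place G' e f < leave e;
  out_sym : forall e f, N e f = N f e
}.

Lemma same_outsideC N G G' : same_outside N G G' -> same_outside N G' G.
Proof.
case=> h1 h2 h3 h4 h5 h6 h7 h8.
have h e f : chi G' e f -> ~~ N e f -> chi G e f by move=> + n; rewrite h1.
split=> // e f.
- by move=> n; rewrite h1.
- by move=> ef n; rewrite h2 // h.
- by move=> ef n; rewrite h3 // h.
- by move=> ef n; rewrite h4 // h.
- by move=> ef n; rewrite -h2 ?h // ; apply: h5 => //; apply: h.
Qed.

Lemma coloring_at_locally G c : coloring_at G Q c -> locally_colored G c.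
Proof.
by move=> [hv hc]; split=> [e s t _ s0 _ t1|e _]; [apply: carriesS (hc e)|exact: hv].
Qed.

Lemma carries_trivial G c e s t : t <= s -> carries G Q c e s t.
Proof.
move=> ts; split=> [u v su uv vt|f v _ su uv vt].
  by have := le_lt_trans su (lt_le_trans uv (le_trans vt ts)); rewrite ltxx.
by have := le_lt_trans su (lt_le_trans uv (le_trans vt ts)); rewrite ltxx.
Qed.

Lemma carries_ext G c m e s t : (forall u, s <= u <= t -> c e u = m e u) ->
  (forall f, chi G e f -> s <= place G e f < t ->
     c f (place G f e) = m f (place G f e)) ->
  carries G Q m e s t -> carries G Q c e s t.
Proof.
move=> h1 h2 [k1 k2]; split.
  move=> u v su uv vt cl; rewrite !h1 ?su ?vt ?(ltW (le_lt_trans su uv)) //.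
    exact: k1.
  exact: ltW (lt_le_trans uv vt).
move=> f v ef su uv vt cl.
rewrite !h1 ?su ?vt ?(ltW (le_lt_trans su uv)) ?(ltW (lt_le_trans uv vt)) //.
by rewrite h2 ?su ?(lt_le_trans uv) //; exact: k2.
Qed.

Section Replacement.
Variables (N : rel (edge S)) (G G' : gauss R S).
Hypothesis so : same_outside N G G'.
Hypothesis window_ok : forall e, [/\ enter e <= 1, 0 <= leave e & enter e <= leave e].
Hypothesis junction : forall e, (1 < leave e) = (enter (next S e) < 0).

Definition patch c m e t : X :=
  if enter e < t < leave e then m e t else c e t.

Lemma patch_out c m e t : t <= enter e \/ leave e <= t -> patch c m e t = c e t.
Proof.
rewrite /patch; case=> h; first by rewrite ltNge h.
by rewrite [t < _]ltNge h andbF.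
Qed.

Lemma patch_in c m e t : same_entries c m -> same_exits c m ->
  enter e < leave e -> 0 <= t <= 1 -> enter e <= t <= leave e ->
  patch c m e t = m e t.
Proof.
rewrite /patch => hin hout el /andP[t0 t1] /andP[].
rewrite le_eqVlt => /orP[/eqP E _|->]; first by rewrite -E ltxx /= hin // E.
rewrite le_eqVlt => /orP[/eqP E|-> //].
by rewrite E ltxx /= hout // -E.
Qed.

Lemma carries_patch_out c m e s t : carries G Q c e 0 1 ->
  0 <= s -> t <= 1 -> t <= enter e \/ leave e <= s ->
  carries G' Q (patch c m) e s t.
Proof.
move=> [h1 h2] s0 t1 off.
have offu u : s <= u <= t -> u <= enter e \/ leave e <= u.
  case/andP=> su ut; case: off => h; [left|right].
    exact: le_trans h.
  exact: le_trans su.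
have nN H f : (H = G \/ H = G') -> chi H e f -> s <= place H e f < t -> ~~ N e f.
  move=> hH ef /andP[sf ft]; apply/negP => n.
  have /andP[k1 k2] : enter e <= place H e f < leave e.
    by case: hH ef => ->  ef; [apply: (out_in so)|apply: (out_in' so)].
  case: off => h.
    by have := le_lt_trans k1 (lt_le_trans ft h); rewrite ltxx.
  by have := lt_le_trans k2 (le_trans h sf); rewrite ltxx.
split.
  move=> u v su uv vt cl.
  rewrite !patch_out; last 2 first.
  - by apply: offu; rewrite su (le_trans (ltW uv)).
  - by apply: offu; rewrite (le_trans su (ltW uv)) vt.
  apply: h1 => //; [exact: le_trans su|exact: le_trans t1|].
  move=> f ef; apply/negP => /andP[uf fv].
  have n : ~~ N e f.
    by apply: (nN G) => //; [left|rewrite (le_trans su uf) (lt_le_trans fv)].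
  have := cl f; rewrite -(out_chi so) // -(out_place so) // ef uf fv.
  by move/(_ isT).
move=> f v ef' su uv vt cl.
have n : ~~ N e f.
  by apply: (nN G') => //; [right|rewrite su (lt_le_trans uv)].
have ef : chi G e f by rewrite (out_chi so).
have fe := chiC ef; have n' : ~~ N f e by rewrite -(out_sym so).
move: su uv cl; rewrite -(out_place so) // => su uv cl.
rewrite patch_out; last by apply: offu; rewrite vt ltW // (le_lt_trans su).
rewrite patch_out; last by apply: offu; rewrite su (le_trans (ltW uv)).
rewrite patch_out; last first.
  rewrite -(out_place so) //.
  by case: (out_far so fe n') => /ltW; [left|right].
rewrite (h2 f v) //; last 3 first.
- exact: le_trans su.
- exact: le_trans t1.
- move=> g eg; apply/negP => /andP[fg gv].
  have ng : ~~ N e g.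
    apply: (nN G) => //; first by left.
    by rewrite (le_trans su (ltW fg)) (lt_le_trans gv).
  have := cl g; rewrite -!(out_place so) // fg gv -(out_chi so) // eg.
  by move/(_ isT).
rewrite /out -(out_level so) // -(out_turn so) // -(out_turn so) //.
by rewrite -(out_place so).
Qed.

(** The transport can be cut at the ends of a window: outside, the two diagrams have
the same crossings, and at the ends themselves [c] and [m] agree. *)
Lemma coloring_at_patch c m : coloring_at G Q c -> locally_colored G' m ->
  same_entries c m -> same_exits c m -> coloring_at G' Q (patch c m).
Proof.
move=> [hv hc] [mc mv] hin hout.
split=> e.
  have [l1|l1] := ltP 1 (leave e).
    have n0 : enter (next S e) < 0 by rewrite -junction.
    have [e1 _ _] := window_ok e; have [_ l0 _] := window_ok (next S e).
    rewrite !patch_in // ?mv ?lexx ?ler01 //.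
    - exact: le_lt_trans l1.
    - by rewrite e1 ltW.
    - exact: lt_le_trans l0.
    - by rewrite ltW.
  rewrite !patch_out //; first by right.
  by left; rewrite leNgt -junction -leNgt.
have [e1 l0 el] := window_ok e.
pose u := Num.max 0 (enter e); pose v := Num.min 1 (leave e).
have u0 : 0 <= u by rewrite le_max lexx.
have u1 : u <= 1 by rewrite ge_max ler01.
have v1 : v <= 1 by rewrite ge_min lexx.
have uv : u <= v by rewrite ge_max !le_min ler01 l0 e1.
have eu : enter e <= u by rewrite le_max lexx orbT.
have vl : v <= leave e by rewrite ge_min lexx orbT.
apply: (@carries_cat _ _ _ _ _ _ _ _ u) => //.
  have [e0|e0] := leP (enter e) 0.
    by apply: carries_trivial; rewrite /u max_l.
  by apply: carries_patch_out => //; left; rewrite /u max_r // ltW.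
apply: (@carries_cat _ _ _ _ _ _ _ _ v) => //; last first.
  have [l1|l1] := leP 1 (leave e).
    by apply: carries_trivial; rewrite /v min_l.
  apply: carries_patch_out => //; first by rewrite (le_trans u0).
  by right; rewrite /v min_r // ltW.
have [le|elt] := leP (leave e) (enter e).
  apply: carries_trivial; rewrite /u /v.
  by rewrite ge_min !le_max le !orbT.
apply: (@carries_ext _ _ m); last first.
- exact: mc.
- move=> f ef /andP[uf fv]; have /andP[f0 f1] := place01 ef.
  have fe := chiC ef; have /andP[g0 g1] := place01 fe.
  have n : N e f.
    apply/negP => /negP n.
    have [|] := out_far (same_outsideC so) ef n => h.
      by have := lt_le_trans h (le_trans eu uf); rewrite ltxx.
    by have := lt_trans h (lt_le_trans fv vl); rewrite ltxx.
  have /andP[k1 k2] : enter f <= place G' f e < leave f.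
    by apply: (out_in' so) => //; rewrite -(out_sym so).
  apply: patch_in => //; rewrite ?k1 ?ltW //; exact: le_lt_trans k2.
- move=> w /andP[uw wv]; apply: patch_in => //.
    by rewrite (le_trans u0 uw) (le_trans wv v1).
  by rewrite (le_trans eu uw) (le_trans wv vl).
Qed.

End Replacement.
End Windows.

(** If the inside of [G'] can follow the inside of [G], then colorings of [G] extend
to [G']; this is injective because the boundary of the disc determines the coloring
of [G] inside. *)
Lemma tangle_replacement (R : realType) (S : skeleton) (p q : position R S)
    (i j : layering S) (hp : regular p i) (hq : regular q j) (X : finType)
    (Q : disingquandle X) (N : rel (edge S)) (enter leave : edge S -> R) :
  let G := gauss_of hp in let G' := gauss_of hq in
  same_outside enter leave N G G' ->
  (forall e, [/\ enter e <= 1, 0 <= leave e & enter e <= leave e]) ->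
  (forall e, (1 < leave e) = (enter (next S e) < 0)) ->
  deterministic Q enter leave G -> simulates Q enter leave G G' ->
  (#|colorings (Diagram hp) Q| <= #|colorings (Diagram hq) Q|)%N.
Proof.
move=> G G' so wo ju det sim.
apply: (@colorings_transfer R X Q (Diagram hp) (Diagram hq)
  (fun c c' : edge S -> R -> X => forall e t,
     t <= enter e \/ leave e <= t -> c' e t = c e t)).
  move=> c hc; have [m [mc hin hout]] := sim c (coloring_at_locally _ _ hc).
  exists (patch enter leave c m); last by move=> e t; exact: patch_out.
  exact: (coloring_at_patch so wo ju hc mc hin hout).
move=> c1 c2 c1' c2' h1 h2 r1 r2 E.
have E' e t : 0 <= t <= 1 -> t <= enter e \/ leave e <= t -> c1 e t = c2 e t.
  by move=> t01 o; rewrite -r1 // -r2 // E.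
move=> e t t01; have [te|te] := leP t (enter e); first by apply: E' => //; left.
have [lt|lt] := leP (leave e) t; first by apply: E' => //; right.
apply: (det c1 c2 _ _ _ e t) => //; try exact: coloring_at_locally.
- move=> f el e0; apply/esym/E'; last by left.
  by rewrite e0; case: (wo f).
- by rewrite !ltW.
- exact: lt_trans lt.
Qed.

(** * What the axioms say about passages *)

Section Passing.
Variables (X : Type) (Q : disingquandle X).
Implicit Types (l : label) (v : layer) (x y z a u s : X) (d : bool).

(** [out], as a function of the level [v] and the turn [d] of the first strand with
respect to the second one, which has the label [l]. *)
Definition passing v d l x y : X :=
  match v with
  | Over => x
  | Under => (if d then qbar (dsq_quandle Q l) else qop (dsq_quandle Q l)) x y
  | Sing => if d then R1 Q y x else R2 Q x y
  end.

Lemma out_passing (R : realType) (S : skeleton) (G : gauss R S) e f x y :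
  chi G e f -> out G Q e f x y = passing (level G e f) (turn G e f) (lab f) x y.
Proof.
by move=> /turnC E; rewrite /out /passing E; case: (level G e f) => //; case: turn.
Qed.

Lemma qop_morph l m x y a : mixed_distributive Q ->
  qop (dsq_quandle Q l) (qop (dsq_quandle Q m) x y) a =
  qop (dsq_quandle Q m) (qop (dsq_quandle Q l) x a) (qop (dsq_quandle Q l) y a).
Proof. case=> h1 h2; case: l m => -[] /=.
- exact: qop_dist.
- exact: h2.
- exact: h1.
- exact: qop_dist. Qed.

Lemma dsq_sing l : singquandle_axioms (dsq_quandle Q l) (R1 Q) (R2 Q).
Proof. by case: l; [exact: dsq_sing1|exact: dsq_sing2]. Qed.

Lemma R1_morph l x y a : qop (dsq_quandle Q l) (R1 Q x y) a =
  R1 Q (qop (dsq_quandle Q l) x a) (qop (dsq_quandle Q l) y a).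
Proof. by rewrite -(sq_R1 (dsq_sing l)) qopK. Qed.

Lemma R2_morph l x y a : qop (dsq_quandle Q l) (R2 Q x y) a =
  R2 Q (qop (dsq_quandle Q l) x a) (qop (dsq_quandle Q l) y a).
Proof.
have := sq_R2 (dsq_sing l) (qop (dsq_quandle Q l) x a) a y.
by rewrite qopK => ->; rewrite qbarK.
Qed.

(** Acting by a color is an automorphism of all the operations: this is how a
strand passes over any crossing.  For two different labels it is the mixed
distributivity. *)
Lemma passing_qop v d l m x y a : mixed_distributive Q ->
  qop (dsq_quandle Q m) (passing v d l x y) a =
  passing v d l (qop (dsq_quandle Q m) x a) (qop (dsq_quandle Q m) y a).
Proof.
move=> mix; case: v => //=; last by case: d; rewrite ?R1_morph ?R2_morph.
case: d; last exact: qop_morph.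
rewrite -{2}(qbarK (dsq_quandle Q l) y x) (qop_morph _ _ _ _ _ mix).
by rewrite qopK.
Qed.

Lemma passing_qbar v d l m x y a : mixed_distributive Q ->
  qbar (dsq_quandle Q m) (passing v d l x y) a =
  passing v d l (qbar (dsq_quandle Q m) x a) (qbar (dsq_quandle Q m) y a).
Proof.
move=> mix; apply: (can_inj (qopK (dsq_quandle Q m) a)).
by rewrite passing_qop // !qbarK.
Qed.

(** The axiom of the singular crossing says that a strand can pass under either
pair of opposite sides; inverting the operations gives its four forms. *)
Lemma under_sing4 l m x z u :
  qop (dsq_quandle Q m) (qbar (dsq_quandle Q l) u (R1 Q x z)) x =
  qbar (dsq_quandle Q l) (qop (dsq_quandle Q m) u (R2 Q x z)) z.
Proof.
case: l m => -[] /=; [exact: (sq_under (dsq_sing One))|exact: dsq_under12|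
  exact: dsq_under21|exact: (sq_under (dsq_sing Two))].
Qed.

Lemma under_sing1 l m x z u :
  qop (dsq_quandle Q l) (qop (dsq_quandle Q m) u x) z =
  qop (dsq_quandle Q m) (qop (dsq_quandle Q l) u (R1 Q x z)) (R2 Q x z).
Proof.
have := under_sing4 l m x z (qop (dsq_quandle Q l) u (R1 Q x z)).
by rewrite qopK => ->; rewrite qbarK.
Qed.

Lemma under_sing2 l m x z u :
  qbar (dsq_quandle Q m) (qbar (dsq_quandle Q l) u z) x =
  qbar (dsq_quandle Q l) (qbar (dsq_quandle Q m) u (R2 Q x z)) (R1 Q x z).
Proof.
set t := RHS; have E : u = qop (dsq_quandle Q m) (qop (dsq_quandle Q l) t (R1 Q x z)) (R2 Q x z).
  by rewrite /t !qbarK.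
by rewrite E -under_sing1 !qopK.
Qed.

Lemma under_sing3 l m x z u :
  qop (dsq_quandle Q l) (qbar (dsq_quandle Q m) u x) (R1 Q x z) =
  qbar (dsq_quandle Q m) (qop (dsq_quandle Q l) u z) (R2 Q x z).
Proof.
set t := LHS; have E : u = qop (dsq_quandle Q m) (qbar (dsq_quandle Q l) t (R1 Q x z)) x.
  by rewrite /t qopK qbarK.
by rewrite [in RHS]E under_sing4 qbarK qopK.
Qed.

(** A classical crossing slides through a singular one. *)
Lemma twist_sing l m x y : qop (dsq_quandle Q m) (R1 Q x y) (R2 Q x y) =
  R2 Q y (qop (dsq_quandle Q l) x y).
Proof.
case: l m => -[] /=; [exact: (sq_twist (dsq_sing One))|exact: dsq_twist21|
  exact: dsq_twist12|exact: (sq_twist (dsq_sing Two))].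
Qed.

Lemma R2_R1 l x y : R2 Q x y = R1 Q y (qop (dsq_quandle Q l) x y).
Proof. exact: sq_R12 (dsq_sing l) _ _. Qed.

(** A strand meets the edges [f] and [g], which cross.  The functions are the
passages of the strand through [f] and [g] ([sf], [sg]), of [f] and [g] through the
strand ([cf], [cg]), and of [f] and [g] through each other ([xf], [xg]).  The
booleans say whether the strand meets [f] before [g] ([w]), and whether [f] and [g]
meet the strand before they meet each other ([bf], [bg]).  The colors 0, 1, 2 are
those of the strand ([s]), [f] ([x]) and [g] ([y]) before, between and after their
two passages. *)
Definition slide_system (sf sg cf cg xf xg : X -> X -> X) (w bf bg : bool)
    s0 s1 s2 x0 x1 x2 y0 y1 y2 : Prop :=
  let s_f := if w then s0 else s1 in let s_g := if w then s1 else s0 in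
  let x_s := if bf then x0 else x1 in let x_g := if bf then x1 else x0 in
  let y_s := if bg then y0 else y1 in let y_f := if bg then y1 else y0 in
  let s_1 := if w then s1 else s2 in let s_2 := if w then s2 else s1 in
  let x_1 := if bf then x1 else x2 in let x_2 := if bf then x2 else x1 in
  let y_1 := if bg then y1 else y2 in let y_2 := if bg then y2 else y1 in
  [/\ s_1 = sf s_f x_s /\ s_2 = sg s_g y_s,
      x_1 = cf x_s s_f /\ x_2 = xf x_g y_f &
      y_1 = cg y_s s_g /\ y_2 = xg y_f x_g].

(** In the plane, [w] determines [bf] and [bg]: the strand passes on the side of the
crossing of [f] and [g] that is on its way. *)
Definition slide_sides v (ls lf lg : label) v' df dg d w :=
  slide_system (passing v df lf) (passing v dg lg)
    (passing (opposite v) (~~ df) ls) (passing (opposite v) (~~ dg) ls)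
    (passing v' d lg) (passing (opposite v') (~~ d) lf)
    w ((w == dg) == d) ((w == df) == d).

Lemma slide_solvable v ls lf lg v' df dg d w s0 x0 y0 : v <> Sing ->
  exists s1 s2 x1 x2 y1 y2,
    slide_sides v ls lf lg v' df dg d w s0 s1 s2 x0 x1 x2 y0 y1 y2.
Proof.
rewrite /slide_sides /slide_system.
by case: v => // _ /=; case: w df dg d => -[] [] [] /=;
  do 6! eexists; repeat split; reflexivity.
Qed.

(** What leaves the disc does not depend on the side of the strand on which [f] and
[g] cross: if the strand is above, because it acts by automorphisms; if it is below a
singular crossing, by [under_sing4] and its variants. *)
Lemma slide_exits v ls lf lg v' df dg d w w' s0 s1 s2 x0 x1 x2 y0 y1 y2
    s1' s2' x1' x2' y1' y2' : mixed_distributive Q ->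
  v = Over \/ v = Under /\ v' = Sing ->
  slide_sides v ls lf lg v' df dg d w s0 s1 s2 x0 x1 x2 y0 y1 y2 ->
  slide_sides v ls lf lg v' df dg d w' s0 s1' s2' x0 x1' x2' y0 y1' y2' ->
  [/\ s2' = s2, x2' = x2 & y2' = y2].
Proof.
move=> mix; rewrite /slide_sides /slide_system => -[->|[-> ->]] /=.
  by case: w w' df dg d => -[] [] [] [] /= [[-> ->] [-> ->] [-> ->]]
    [[-> ->] [-> ->] [-> ->]] //;
    rewrite ?(passing_qop _ _ _ _ _ _ _ mix) ?(passing_qbar _ _ _ _ _ _ _ mix)
      ?qopK ?qbarK.
case: w w' df dg d => -[] [] [] [] /= [[-> ->] [-> ->] [-> ->]]
    [[-> ->] [-> ->] [-> ->]]; split=> //;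
  first [exact: under_sing1|exact: under_sing2|exact: under_sing3|
      exact: under_sing4|exact/esym/under_sing1|exact/esym/under_sing2|
      exact/esym/under_sing3|exact/esym/under_sing4].
Qed.

End Passing.

(** * Sliding a strand across a crossing *)

Section Steps.
Variables (R : realType) (S : skeleton) (X : Type) (Q : disingquandle X).
Implicit Types (G : gauss R S) (c m : edge S -> R -> X) (e f g h : edge S).
Implicit Types (s t u T : R) (x : X) (o : bool).

Definition step3 x0 T1 x1 T2 x2 t : X :=
  if t <= T1 then x0 else if t <= T2 then x1 else x2.

Lemma step3_start x0 T1 x1 T2 x2 t : t <= T1 -> step3 x0 T1 x1 T2 x2 t = x0.
Proof. by rewrite /step3 => ->. Qed.

Lemma step3_mid x0 T1 x1 T2 x2 t : T1 < t <= T2 -> step3 x0 T1 x1 T2 x2 t = x1.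
Proof. by rewrite /step3 => /andP[h ->]; rewrite leNgt h. Qed.

Lemma step3_end x0 T1 x1 T2 x2 t : T1 < T2 -> T2 < t -> step3 x0 T1 x1 T2 x2 t = x2.
Proof. by rewrite /step3 => h1 h2; rewrite !leNgt h2 (lt_trans h1). Qed.

(** The offset [o] lets one step function run along several consecutive edges. *)
Lemma carries_step3 G c e s t (o : R) h1 h2 T1 T2 x0 x1 x2 : T1 < T2 ->
  (forall u, s <= u <= t -> c e u = step3 x0 T1 x1 T2 x2 (o + u)) ->
  (forall h, chi G e h -> s <= place G e h < t ->
     (h = h1 /\ o + place G e h = T1) \/ (h = h2 /\ o + place G e h = T2)) ->
  (o + s <= T1 < o + t ->
     [/\ chi G e h1, o + place G e h1 = T1 &
         x1 = out G Q e h1 x0 (c h1 (place G h1 e))]) ->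
  (o + s <= T2 < o + t ->
     [/\ chi G e h2, o + place G e h2 = T2 &
         x2 = out G Q e h2 x1 (c h2 (place G h2 e))]) ->
  carries G Q c e s t.
Proof.
move=> T12 cE only at1 at2; split.
  move=> u v su uv vt cl.
  rewrite !cE ?su ?vt ?(ltW (le_lt_trans su uv)) ?(ltW (lt_le_trans uv vt)) //.
  have n1 : ~~ (o + u <= T1 < o + v).
    apply/negP => /andP[h1' h2']; case: at1 => [|c1 p1 _].
      by rewrite (le_trans _ h1') ?lerD2l // (lt_le_trans h2') ?lerD2l.
    have := cl _ c1; rewrite -(lerD2l o) -(ltrD2l o _ v) p1.
    by rewrite h1' h2'.
  have n2 : ~~ (o + u <= T2 < o + v).
    apply/negP => /andP[h1' h2']; case: at2 => [|c1 p1 _].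
      by rewrite (le_trans _ h1') ?lerD2l // (lt_le_trans h2') ?lerD2l.
    have := cl _ c1; rewrite -(lerD2l o) -(ltrD2l o _ v) p1.
    by rewrite h1' h2'.
  have ouv : o + u <= o + v by rewrite lerD2l ltW.
  have E T : ~~ (o + u <= T < o + v) -> (o + v <= T) = (o + u <= T).
    rewrite negb_and -ltNge -leNgt => /orP[h|h].
      by rewrite !leNgt h (lt_le_trans h).
    by rewrite h (le_trans ouv).
  by rewrite /step3 !E.
move=> f v ef sf fv vt cl.
have ft := lt_le_trans fv vt.
have n T h : chi G e h -> o + place G e h = T -> ~~ (o + place G e f < T < o + v).
  by move=> /cl + <-; rewrite !ltrD2l.
rewrite !cE ?sf ?vt ?(ltW ft) ?(ltW (le_lt_trans sf fv)) //.
case: (only f ef _) => [|[ff pf]|[ff pf]]; first by rewrite sf.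
  have [|_ _ ->] := at1; first by rewrite -pf lerD2l ltrD2l sf.
  rewrite [in RHS]step3_start ?pf // ff step3_mid // -{1}pf ltrD2l fv /= leNgt.
  apply/negP => T2v; case: at2 => [|c2 p2 _].
    rewrite (lt_le_trans T2v) ?lerD2l // andbT (le_trans _ (ltW T12)) //.
    by rewrite -pf lerD2l.
  by have := n _ _ c2 p2; rewrite pf T12 T2v.
have [|_ _ ->] := at2; first by rewrite -pf lerD2l ltrD2l sf.
rewrite ff [in RHS]step3_mid; last by rewrite -ff pf T12 lexx.
by rewrite step3_end // -pf ltrD2l.
Qed.

Definition ordered (o : bool) T T' := if o then T < T' else T' < T.

(** The order of the two steps is the boolean [o], since it differs between the two
sides of a move. *)
Definition step2 (o : bool) x0 T T' x1 x2 t : X :=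
  if o then step3 x0 T x1 T' x2 t else step3 x0 T' x1 T x2 t.

Lemma step2_first o x0 T T' x1 x2 : ordered o T T' ->
  step2 o x0 T T' x1 x2 T = if o then x0 else x1.
Proof. by rewrite /ordered; case: o => h; [apply: step3_start|apply: step3_mid; rewrite h lexx]. Qed.

Lemma step2_second o x0 T T' x1 x2 : ordered o T T' ->
  step2 o x0 T T' x1 x2 T' = if o then x1 else x0.
Proof. by rewrite /ordered; case: o => h; [apply: step3_mid; rewrite h lexx|apply: step3_start]. Qed.

Lemma step2_start o x0 T T' x1 x2 t : t <= T -> t <= T' ->
  step2 o x0 T T' x1 x2 t = x0.
Proof. by case: o => h h'; exact: step3_start. Qed.

Lemma step2_end o x0 T T' x1 x2 t : ordered o T T' -> T < t -> T' < t ->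
  step2 o x0 T T' x1 x2 t = x2.
Proof. by rewrite /ordered; case: o => h h1 h2; exact: step3_end. Qed.

Lemma carries_step2 G c e s t u h1 h2 T1 T2 o x0 x1 x2 : ordered o T1 T2 ->
  (forall w, c e w = step2 o x0 T1 T2 x1 x2 (u + w)) ->
  (forall h, chi G e h -> s <= place G e h < t ->
     (h = h1 /\ u + place G e h = T1) \/ (h = h2 /\ u + place G e h = T2)) ->
  (u + s <= T1 < u + t -> [/\ chi G e h1, u + place G e h1 = T1 &
     (if o then x1 else x2) =
     out G Q e h1 (if o then x0 else x1) (c h1 (place G h1 e))]) ->
  (u + s <= T2 < u + t -> [/\ chi G e h2, u + place G e h2 = T2 &
     (if o then x2 else x1) =
     out G Q e h2 (if o then x1 else x0) (c h2 (place G h2 e))]) ->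
  carries G Q c e s t.
Proof.
rewrite /step2; case: o => lt cE only at1 at2.
  by apply: (carries_step3 lt (fun w _ => cE w) only).
apply: (carries_step3 lt (fun w _ => cE w)) at2 at1 => h ch hs.
by case: (only h ch hs); [right|left].
Qed.

Lemma agree_clear G c m e s t : carries G Q c e s t -> carries G Q m e s t ->
  s <= t -> c e s = m e s -> (forall h, chi G e h -> ~~ (s <= place G e h < t)) ->
  c e t = m e t.
Proof.
move=> hc hm st E cl; apply: (carries_unique hc hm E); rewrite ?st ?lexx //.
by move=> f x ef h; case/negP: (cl f ef).
Qed.

Lemma out_over G e f x y y' : chi G e f -> level G e f = Over ->
  out G Q e f x y = out G Q e f x y'.
Proof. by rewrite /out => _ ->. Qed.

End Steps.

Section Window.
Variables (R : realType) (S : skeleton).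

(** Windows as association lists; the other edges get the empty window [0, 0]. *)
Definition window (l : seq (edge S * (R * R))) (x : edge S) : R * R :=
  foldr (fun q r => if x == q.1 then q.2 else r) (0, 0) l.

Lemma window_out l x : x \notin unzip1 l -> window l x = (0, 0).
Proof.
elim: l => //= q l IH; rewrite inE negb_or => /andP[/negbTE -> /IH].
exact.
Qed.

Lemma window_bounds l x :
  foldr (fun q A => [/\ q.2.1 <= 1, 0 <= q.2.2 & q.2.1 <= q.2.2] /\ A) True l ->
  [/\ (window l x).1 <= 1, 0 <= (window l x).2 & (window l x).1 <= (window l x).2].
Proof.
by elim: l => [|q l IH] /= => [_|[hq /IH hl]]; [rewrite lexx ler01|case: ifP].
Qed.

(** The vertex between the two edges of a strand is the only one that windows
leave free. *)
Lemma strand_junction e1 e2 l x : next S e1 = e2 -> e1 != e2 ->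
  foldr (fun q A => (0 <= q.2.1 /\ q.2.2 <= 1) /\ A) True l ->
  let w := window ((e1, (0, 2)) :: (e2, (-1, 1)) :: l) in
  (1 < (w x).2) = ((w (next S x)).1 < 0).
Proof.
move=> n1 d12 hl /=.
have W y : 0 <= (window l y).1 /\ (window l y).2 <= 1.
  elim: l hl => [|q l IH] /= => [_|[hq /IH hl]]; first by rewrite lexx ler01.
  by case: ifP.
have [->|x1] := eqVneq x e1.
  by rewrite n1 eq_sym (negbTE d12) eqxx /=; apply/idP/idP => _; lra.
have -> : (next S x == e2) = false.
  by apply/eqP; rewrite -n1 => /nextI/eqP; rewrite (negbTE x1).
have [h1 h2] := (proj1 (W (next S x)), proj2 (W x)).
case: (x == e2); case: (next S x == e1) => /=; apply/idP/idP; lra.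
Qed.

End Window.

Section Slide.
Variables (R : realType) (S : skeleton) (X : Type) (Q : disingquandle X).
Variables (e1 e2 f g : edge S) (af bf ag bg : R).
Variables (v v' : layer) (df dg d : bool).

Definition slide_enter x := (window [:: (e1, (0, 2)); (e2, (-1, 1)); (f, (af, bf)); (g, (ag, bg))] x).1.
Definition slide_leave x := (window [:: (e1, (0, 2)); (e2, (-1, 1)); (f, (af, bf)); (g, (ag, bg))] x).2.

(** The edges of the strand; [k%:R] is then the offset of the edge [part k]. *)
Definition part (k : bool) := if k then e2 else e1.

(** The strand [e1 e2] crosses [f] on [part kf] and [g] on [part kg]; [w] tells
whether it crosses [f] first. *)
Record slide_state (G : gauss R S) (kf kg w : bool) : Prop := SlideState {
  ss_f : chi G (part kf) f;
  ss_g : chi G (part kg) g;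
  ss_fg : chi G f g;
  ss_strand : forall k x, chi G (part k) x ->
    (x = f /\ k = kf) \/ (x = g /\ k = kg);
  ss_f_only : forall x, chi G f x -> af <= place G f x < bf ->
    x = part kf \/ x = g;
  ss_g_only : forall x, chi G g x -> ag <= place G g x < bg ->
    x = part kg \/ x = f;
  ss_f_in : af < place G f (part kf) < bf /\ af < place G f g < bf;
  ss_g_in : ag < place G g (part kg) < bg /\ ag < place G g f < bg;
  ss_level : [/\ level G (part kf) f = v, level G (part kg) g = v & level G f g = v'];
  ss_turn : [/\ turn G (part kf) f = df, turn G (part kg) g = dg & turn G f g = d];
  ss_w : ordered w (kf%:R + place G (part kf) f) (kg%:R + place G (part kg) g);
  ss_bf : ordered ((w == dg) == d) (place G f (part kf)) (place G f g);
  ss_bg : ordered ((w == df) == d) (place G g (part kg)) (place G g f)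
}.

Hypotheses (distinct : uniq [:: e1; e2; f; g]) (next1 : next S e1 = e2).
Hypotheses (window_f : 0 <= af /\ bf <= 1) (window_g : 0 <= ag /\ bg <= 1).

Lemma slide_neq :
  [/\ (e2 == e1) = false, (f == e1) = false /\ (f == e2) = false &
      [/\ (g == e1) = false, (g == e2) = false & (g == f) = false]].
Proof.
have ne (x y : edge S) : x != y -> (y == x) = false by rewrite eq_sym => /negbTE.
move: distinct; rewrite /= !inE !negb_or.
move=> /and4P[/and3P[h1 h2 h3] /andP[h4 h5] h6 _].
by split; [|split|split]; exact: ne.
Qed.

Local Notation sys kf kg w := (slide_sides Q v (lab e1) (lab f) (lab g) v' df dg d w).

Let lab_part k : lab (part k) = lab e1.
Proof. by case: k; rewrite //= -next1 lab_next. Qed.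

Let slide_windows x (r s : R) : slide_enter x <= r -> 0 <= r -> r < s ->
  s <= slide_leave x -> s <= 1 ->
  [\/ x = e1, x = e2, x = f /\ (af <= r /\ s <= bf) |
       x = g /\ (ag <= r /\ s <= bg)].
Proof.
rewrite /slide_enter /slide_leave /=.
have [-> *|_] := eqVneq x e1; first by constructor 1.
have [-> *|_] := eqVneq x e2; first by constructor 2.
have [-> *|_] := eqVneq x f; first by constructor 3.
have [-> *|_] := eqVneq x g; first by constructor 4.
move=> /= _ r0 rs s0 _.
by have := lt_le_trans rs (le_trans s0 r0); rewrite ltxx.
Qed.

Section Model.
Variables (G : gauss R S) (kf kg w : bool).
Hypothesis st : slide_state G kf kg w.
Variables (s0 s1 s2 x0 x1 x2 y0 y1 y2 : X).
Hypothesis eqs : sys kf kg w s0 s1 s2 x0 x1 x2 y0 y1 y2.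

Let Tf := kf%:R + place G (part kf) f.
Let Tg := kg%:R + place G (part kg) g.
Let bef := (w == dg) == d.
Let beg := (w == df) == d.

(** The coloring of the disc with the given colors.  On the strand it is a single
step function, as if [e1] and [e2] were one edge with parameters in [0, 2]. *)
Definition slide_model (x : edge S) (t : R) : X :=
  if x == e1 then step2 w s0 Tf Tg s1 s2 t else
  if x == e2 then step2 w s0 Tf Tg s1 s2 (1 + t) else
  if x == f then step2 bef x0 (place G f (part kf)) (place G f g) x1 x2 t
  else step2 beg y0 (place G g (part kg)) (place G g f) y1 y2 t.

Let model_part k t : slide_model (part k) t = step2 w s0 Tf Tg s1 s2 (k%:R + t).
Proof.
have [n1 _ _] := slide_neq.
by rewrite /slide_model; case: k => /=; rewrite ?n1 eqxx ?add0r.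
Qed.

Let model_f t : slide_model f t =
  step2 bef x0 (place G f (part kf)) (place G f g) x1 x2 (0 + t).
Proof.
by have [_ [n1 n2] _] := slide_neq; rewrite /slide_model n1 n2 eqxx add0r.
Qed.

Let model_g t : slide_model g t =
  step2 beg y0 (place G g (part kg)) (place G g f) y1 y2 (0 + t).
Proof.
by have [_ _ [n1 n2 n3]] := slide_neq; rewrite /slide_model n1 n2 n3 add0r.
Qed.

Let values :
  [/\ slide_model (part kf) (place G (part kf) f) = if w then s0 else s1,
      slide_model (part kg) (place G (part kg) g) = if w then s1 else s0,
      slide_model f (place G f (part kf)) = if bef then x0 else x1 &
      slide_model f (place G f g) = if bef then x1 else x0] /\
  (slide_model g (place G g (part kg)) = if beg then y0 else y1) /\
  (slide_model g (place G g f) = if beg then y1 else y0).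
Proof.
have ow := ss_w st; have obf := ss_bf st; have obg := ss_bg st.
rewrite !model_part !model_f !model_g !add0r.
by do 3?split; first [exact: step2_first|exact: step2_second].
Qed.

Let outs : 
  [/\ forall x y, out G Q (part kf) f x y = passing Q v df (lab f) x y,
      forall x y, out G Q (part kg) g x y = passing Q v dg (lab g) x y,
      forall x y, out G Q f g x y = passing Q v' d (lab g) x y &
      forall x y, out G Q g f x y = passing Q (opposite v') (~~ d) (lab f) x y] /\
  (forall x y, out G Q f (part kf) x y =
     passing Q (opposite v) (~~ df) (lab e1) x y) /\
  (forall x y, out G Q g (part kg) x y =
     passing Q (opposite v) (~~ dg) (lab e1) x y).
Proof.
have cf := ss_f st; have cg := ss_g st; have c := ss_fg st.
have [l1 l2 l3] := ss_level st; have [t1 t2 t3] := ss_turn st.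
split; [split=> x y|split=> x y]; rewrite out_passing ?lab_part //; try exact: chiC.
- by rewrite l1 t1.
- by rewrite l2 t2.
- by rewrite l3 t3.
- by rewrite (level_opp c) (turnC c) l3 t3.
- by rewrite (level_opp cf) (turnC cf) l1 t1.
- by rewrite (level_opp cg) (turnC cg) l2 t2.
Qed.

Lemma model_strand k : carries G Q slide_model (part k) 0 1.
Proof.
have [[o1 o2 _ _] _] := outs; have [/= [es1 es2] _ _] := eqs.
have [[_ _ pf _] [pg _]] := values.
have kE (j j' : bool) T : 0 < T < 1 -> j%:R + (0 : R) <= j'%:R + T < j%:R + 1 -> j = j'.
  by case: j j' => -[] //=; lra.
apply: (carries_step2 (h1 := f) (h2 := g) (ss_w st) (model_part k)).
- by move=> h /(ss_strand st) [[-> ->]|[-> ->]] _; [left|right].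
- move=> /(kE _ _ _ (place01 (ss_f st))) ->; split=> //; first exact: ss_f st.
  by rewrite o1 pf -es1.
- move=> /(kE _ _ _ (place01 (ss_g st))) ->; split=> //; first exact: ss_g st.
  by rewrite o2 pg -es2.
Qed.

Lemma model_carries_f : carries G Q slide_model f af bf.
Proof.
have [[_ _ o1 _] [o2 _]] := outs; have [/= _ [ef1 ef2] _] := eqs.
have [[p1 _ _ _] [_ p2]] := values.
apply: (carries_step2 (h1 := part kf) (h2 := g) (ss_bf st) model_f).
- by move=> h ch /(ss_f_only st ch)[->|->]; rewrite add0r; [left|right].
- by split; rewrite ?add0r ?o2 ?p1 //; exact: chiC (ss_f st).
- by split; rewrite ?add0r ?o1 ?p2 //; exact: ss_fg st.
Qed.

Lemma model_carries_g : carries G Q slide_model g ag bg.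
Proof.
have [[_ _ _ o1] [_ o2]] := outs; have [/= _ _ [eg1 eg2]] := eqs.
have [[_ p1 _ p2] _] := values.
apply: (carries_step2 (h1 := part kg) (h2 := f) (ss_bg st) model_g).
- by move=> h ch /(ss_g_only st ch)[->|->]; rewrite add0r; [left|right].
- by split; rewrite ?add0r ?o2 ?p1 //; exact: chiC (ss_g st).
- by split; rewrite ?add0r ?o1 ?p2 //; exact: chiC (ss_fg st).
Qed.

Lemma model_locally : locally_colored Q slide_enter slide_leave G slide_model.
Proof.
have [n1 [n2 n3] [n4 n5 n6]] := slide_neq.
split.
  move=> x r s er r0 sl s1'; have [sr|rs] := leP s r; first exact: carries_trivial.
  have [->|->|[-> [h1 h2]]|[-> [h1 h2]]] := slide_windows er r0 rs sl s1'.
  - exact: carriesS (model_strand false).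
  - exact: carriesS (model_strand true).
  - exact: carriesS model_carries_f.
  - exact: carriesS model_carries_g.
move=> x; rewrite /slide_leave /=.
have [-> _|_] := eqVneq x e1.
  by rewrite next1 /slide_model n1 !eqxx addr0.
have [_|_] := eqVneq x e2; first by rewrite ltxx.
have [_|_] := eqVneq x f; first by case: window_f => _ h; rewrite ltNge h.
have [_|_] := eqVneq x g; first by case: window_g => _ h; rewrite ltNge h.
by rewrite ltr10.
Qed.

Lemma model_ends :
  [/\ slide_model e1 0 = s0, slide_model f af = x0 & slide_model g ag = y0] /\
  [/\ slide_model e2 1 = s2, slide_model f bf = x2 & slide_model g bg = y2].
Proof.
have /andP[tf0 tf1] := place01 (ss_f st); have /andP[tg0 tg1] := place01 (ss_g st).
have Tf0 : 0 < Tf < 2 by rewrite /Tf; move: tf0 tf1; case: (kf) => /=; lra.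
have Tg0 : 0 < Tg < 2 by rewrite /Tg; move: tg0 tg1; case: (kg) => /=; lra.
have [/andP[f1 f2] /andP[f3 f4]] := ss_f_in st.
have [/andP[g1 g2] /andP[g3 g4]] := ss_g_in st.
have [/andP[p1 p2] /andP[p3 p4]] := (Tf0, Tg0).
have E2 : (1 : R) + 1 = 2 by lra.
rewrite -[e1]/(part false) -[e2]/(part true) !model_part !model_f !model_g.
rewrite !add0r E2; split; first by split; rewrite step2_start ?ltW.
split; rewrite step2_end //; [exact: ss_w st|exact: ss_bf st|exact: ss_bg st].
Qed.

End Model.

(** The strands that pass over are determined first, then those that they cut. *)
Lemma slide_deterministic G kf kg w : v <> Sing -> slide_state G kf kg w ->
  deterministic Q slide_enter slide_leave G.
Proof.
move=> vS st c m [hc vc] [hm vm] ent.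
have [n1 [n2 n3] [n4 n5 n6]] := slide_neq.
have [l1 l2 _] := ss_level st.
have c1 := ss_f st; have c2 := ss_g st; have c3 := ss_fg st.
have [if1 if2] := ss_f_in st; have [ig1 ig2] := ss_g_in st.
have [f0 f1] := window_f; have [g0 g1] := window_g.
have afb : af < bf by case/andP: if1 => /lt_trans h /h.
have agb : ag < bg by case/andP: ig1 => /lt_trans h /h.
have carr k : carries G Q c (part k) 0 1 /\ carries G Q m (part k) 0 1.
  by split; [apply: hc|apply: hm];
    case: k; rewrite /slide_enter /slide_leave /= ?n1 ?eqxx //=; lra.
have carf : carries G Q c f af bf /\ carries G Q m f af bf.
  by split; [apply: hc|apply: hm];
    rewrite /slide_enter /slide_leave /= ?n2 ?n3 ?eqxx //=; lra.
have carg : carries G Q c g ag bg /\ carries G Q m g ag bg.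
  by split; [apply: hc|apply: hm];
    rewrite /slide_enter /slide_leave /= ?n4 ?n5 ?n6 ?eqxx //=; lra.
have es : c e1 0 = m e1 0.
  have := ent e1; rewrite /slide_enter /slide_leave /= eqxx /= => -> //; lra.
have ef : c f af = m f af.
  by have := ent f; rewrite /slide_enter /slide_leave /= n2 n3 eqxx /= => ->.
have eg : c g ag = m g ag.
  by have := ent g; rewrite /slide_enter /slide_leave /= n4 n5 n6 eqxx /= => ->.
have [[cf mf] [cg mg]] := (carf, carg).
pose agree_strand := forall k t, 0 <= t <= 1 -> c (part k) t = m (part k) t.
pose agree_f := forall t, af <= t <= bf -> c f t = m f t.
pose agree_g := forall t, ag <= t <= bg -> c g t = m g t.
suff [hs hf hg] : [/\ agree_strand, agree_f & agree_g].
  move=> x t /andP[ent_t t_l] /andP[t0 t1] el.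
  have xt : [\/ x = e1, x = e2, x = f /\ (af <= t <= bf) | x = g /\ (ag <= t <= bg)].
    move: ent_t t_l el; rewrite /slide_enter /slide_leave /=.
    have [-> *|_] := eqVneq x e1; first by constructor 1.
    have [-> *|_] := eqVneq x e2; first by constructor 2.
    have [-> /= h1 h2 *|_] := eqVneq x f; first by constructor 3; rewrite h1 h2.
    have [-> /= h1 h2 *|_] := eqVneq x g; first by constructor 4; rewrite h1 h2.
    by rewrite ltxx.
  case: xt => [->|->|[-> h]|[-> h]].
  - by apply: (hs false); rewrite t0.
  - by apply: (hs true); rewrite t0.
  - exact: hf.
  - exact: hg.
have strand : (forall k h x, chi G (part k) h -> out G Q (part k) h x (c h (place G h (part k)))
    = out G Q (part k) h x (m h (place G h (part k)))) -> agree_strand.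
  move=> ho.
  have st0 : c e1 1 = m e1 1.
    have [a1 a2] := carr false; apply: (carries_unique a1 a2 es).
      by move=> h x ch _; exact: (ho false).
    by rewrite ler01 lexx.
  have st1 : c e2 0 = m e2 0.
    have l12 : 1 < slide_leave e1 by rewrite /slide_leave /= eqxx /=; lra.
    by rewrite -next1 vc // vm.
  move=> k t t01; have [a1 a2] := carr k; apply: (carries_unique a1 a2) t01.
    by case: (k).
  by move=> h x ch _; exact: ho.
have both : (forall x, out G Q f (part kf) x (c (part kf) (place G (part kf) f)) =
      out G Q f (part kf) x (m (part kf) (place G (part kf) f))) ->
    (forall x, out G Q g (part kg) x (c (part kg) (place G (part kg) g)) =
      out G Q g (part kg) x (m (part kg) (place G (part kg) g))) ->
    agree_f /\ agree_g.
  move=> of_ og.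
  have pf : c f (place G f g) = m f (place G f g).
    have a1 := carriesS (lexx _) (ltW (proj2 (andP if2))) cf.
    have a2 := carriesS (lexx _) (ltW (proj2 (andP if2))) mf.
    apply: (carries_unique a1 a2 ef).
      move=> h x ch /andP[h1 h2].
      have [|hE|hE] := ss_f_only st ch; last by rewrite hE ltxx in h2.
        by rewrite h1 (lt_trans h2) //; case/andP: if2.
      by rewrite hE.
    by case/andP: if2 => /ltW ->; rewrite lexx.
  have pg : c g (place G g f) = m g (place G g f).
    have a1 := carriesS (lexx _) (ltW (proj2 (andP ig2))) cg.
    have a2 := carriesS (lexx _) (ltW (proj2 (andP ig2))) mg.
    apply: (carries_unique a1 a2 eg).
      move=> h x ch /andP[h1 h2].
      have [|hE|hE] := ss_g_only st ch; last by rewrite hE ltxx in h2.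
        by rewrite h1 (lt_trans h2) //; case/andP: ig2.
      by rewrite hE.
    by case/andP: ig2 => /ltW ->; rewrite lexx.
  split.
    apply: (carries_unique cf mf ef) => h x ch hw.
    by case: (ss_f_only st ch hw) => ->; rewrite ?of_ ?pg.
  apply: (carries_unique cg mg eg) => h x ch hw.
  by case: (ss_g_only st ch hw) => ->; rewrite ?og ?pf.
have p01 (x y : edge S) : chi G x y -> 0 <= place G x y <= 1.
  by move=> /place01/andP[/ltW -> /ltW ->].
case: v vS l1 l2 => // _ l1 l2.
  have as_ : agree_strand.
    apply: strand => k h x ch; apply: out_over => //.
    by case: (ss_strand st ch) => -[-> ->].
  have [af_ ag_] : agree_f /\ agree_g.
    by apply: both => x; rewrite as_ // p01.
  by [].
have [af_ ag_] : agree_f /\ agree_g.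
  apply: both => x; apply: out_over; try exact: chiC.
    by rewrite (level_opp c1) l1.
  by rewrite (level_opp c2) l2.
split=> //; apply: strand => k h x ch.
case: (ss_strand st ch) => -[-> ->].
  by rewrite af_ //; case/andP: if1 => /ltW -> /ltW ->.
by rewrite ag_ //; case/andP: ig1 => /ltW -> /ltW ->.
Qed.

(** In [G] the colors that leave the disc are, by determinism, those of the model;
in [G'] they are the same by [slide_exits]. *)
Lemma slide_simulates G G' kf kg w kf' kg' w' : mixed_distributive Q ->
  v = Over \/ v = Under /\ v' = Sing ->
  slide_state G kf kg w -> slide_state G' kf' kg' w' ->
  simulates Q slide_enter slide_leave G G'.
Proof.
move=> mix hv st st' c hc.
have vS : v <> Sing by case: hv => [->|[-> _]].
have [n1 [n2 n3] [n4 n5 n6]] := slide_neq.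
have [f0 f1] := window_f; have [g0 g1] := window_g.
have afb : af < bf by case: (ss_f_in st) => /andP[/lt_trans h /h].
have agb : ag < bg by case: (ss_g_in st) => /andP[/lt_trans h /h].
have [s1 [s2 [x1 [x2 [y1 [y2 E]]]]]] :=
  @slide_solvable _ Q v (lab e1) (lab f) (lab g) v' df dg d w (c e1 0) (c f af) (c g ag) vS.
have [s1' [s2' [x1' [x2' [y1' [y2' E']]]]]] :=
  @slide_solvable _ Q v (lab e1) (lab f) (lab g) v' df dg d w' (c e1 0) (c f af) (c g ag) vS.
have [Es Ef Eg] := slide_exits mix hv E E'.
have lm := model_locally st E; have lm' := model_locally st' E'.
have [[a1 a2 a3] [b1 b2 b3]] :=
  model_ends st (c e1 0) s1 s2 (c f af) x1 x2 (c g ag) y1 y2.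
have [[a1' a2' a3'] [b1' b2' b3']] :=
  model_ends st' (c e1 0) s1' s2' (c f af) x1' x2' (c g ag) y1' y2'.
have det := slide_deterministic vS st hc lm.
have entry M : M e1 0 = c e1 0 -> M f af = c f af -> M g ag = c g ag ->
    same_entries slide_enter slide_leave c M.
  move=> m1 m2 m3 x; rewrite /slide_enter /slide_leave /=.
  have [->|_] := eqVneq x e1; first by [].
  have [_|_] := eqVneq x e2; first by rewrite ler0N1.
  have [->|_] := eqVneq x f; first by [].
  have [->|_] := eqVneq x g; first by [].
  by rewrite ltxx.
eexists; split; [exact: lm'|exact: entry|].
have {}det := det (entry _ a1 a2 a3).
move=> x el l1.
have := det x (slide_leave x); rewrite lexx andbT.
move: el l1; rewrite /slide_enter /slide_leave /=.
have [_ _|_] := eqVneq x e1; first by move=> /= h; exfalso; move: h; lra.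
have [-> _ _|_] := eqVneq x e2.
  by move=> /= ->; rewrite ?b1 ?b1' ?Es //; lra.
have [-> _ _|_] := eqVneq x f.
  by move=> /= ->; rewrite ?b2 ?b2' ?Ef //; lra.
have [-> _ _|_] := eqVneq x g.
  by move=> /= ->; rewrite ?b3 ?b3' ?Eg //; lra.
by rewrite ltxx.
Qed.

End Slide.

(** * Kinks and fingers *)

Section Idempotence.
Variables (X : Type) (Q : disingquandle X).

Lemma passing_idem v d l x : v <> Sing -> passing Q v d l x x = x.
Proof.
case: v => // _ /=; case: d; last exact: qop_idem.
by apply: (can_inj (qopK (dsq_quandle Q l) x)); rewrite qbarK qop_idem.
Qed.

(** At the crossing of a kink, a strand passes under itself: the colors on both sides
of this crossing are then equal, because acting by [y] is injective. *)
Lemma passing_fixed v d l x y : v <> Sing -> passing Q v d l x y = y -> x = y.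
Proof.
move=> vS E; have {E} : passing Q v d l x y = passing Q v d l y y.
  by rewrite E passing_idem.
case: v vS => //= _; case: d => /=; first exact: (can_inj (qbarK (dsq_quandle Q l) y)).
exact: (can_inj (qopK (dsq_quandle Q l) y)).
Qed.

Lemma passing_undo d l x y :
  passing Q Under (~~ d) l (passing Q Under d l x y) y = x.
Proof. by case: d => /=; rewrite ?qopK ?qbarK. Qed.

(** A classical crossing just before a singular one has the same effect as a
crossing of the same sign just after it.  The turn changes between them, as the
strands have exchanged their sides. *)
Lemma twist_exits v d le lf x0 y0 : v <> Sing ->
  let x1 := passing Q v d lf x0 y0 in
  let y1 := passing Q (opposite v) (~~ d) le y0 x0 in
  let x1' := passing Q Sing d lf x0 y0 in
  let y1' := passing Q Sing (~~ d) le y0 x0 in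
  passing Q (opposite v) (~~ d) lf x1' y1' = passing Q Sing (~~ d) lf x1 y1 /\
  passing Q v d le y1' x1' = passing Q Sing d le y1 x1.
Proof.
have R2_qbar l x y : R2 Q (qbar (dsq_quandle Q l) x y) y = R1 Q y x.
  by rewrite (R2_R1 _ l) qbarK.
have twist_qbar l m x y : qbar (dsq_quandle Q m) (R2 Q y x) (R1 Q y x) =
    R1 Q (qbar (dsq_quandle Q l) x y) y.
  rewrite -(R2_qbar l); set t := qbar _ x y.
  have -> : R2 Q y x = qop (dsq_quandle Q m) (R1 Q t y) (R2 Q t y).
    by rewrite (twist_sing Q l m) /t qbarK.
  by rewrite qopK.
case: v d => // -[] _ /=; split=> //;
  first [exact: twist_sing|exact: R2_R1|exact: twist_qbar|exact/esym/R2_qbar].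
Qed.

End Idempotence.

Section Kink.
Variables (R : realType) (S : skeleton) (X : Type) (Q : disingquandle X).
Variables (e1 e2 e3 : edge S).
Hypotheses (distinct : uniq [:: e1; e2; e3]).
Hypotheses (next1 : next S e1 = e2) (next2 : next S e2 = e3).

Definition kink_enter x : R :=
  (window [:: (e1, (0, 2)); (e2, (-1, 2)); (e3, (-1, 1))] x).1.
Definition kink_leave x : R :=
  (window [:: (e1, (0, 2)); (e2, (-1, 2)); (e3, (-1, 1))] x).2.

(** This covers both sides of the move, as [e1] and [e3] may or may not cross. *)
Record kink_state (G : gauss R S) : Prop := KinkState {
  ks_1 : forall x, chi G e1 x -> x = e3;
  ks_2 : forall x, ~~ chi G e2 x;
  ks_3 : forall x, chi G e3 x -> x = e1;
  ks_level : level G e1 e3 <> Sing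
}.

Let neq : [/\ (e2 == e1) = false, (e3 == e1) = false & (e3 == e2) = false].
Proof.
have ne (x y : edge S) : x != y -> (y == x) = false by rewrite eq_sym => /negbTE.
by move: distinct; rewrite /= !inE !negb_or => /and3P[/andP[h1 h2] h3 _]; split; exact: ne.
Qed.

Let out_const G x y (a : X) : kink_state G -> x \in [:: e1; e2; e3] ->
  chi G x y -> out G Q x y a a = a.
Proof.
move=> ks; rewrite !inE => /or3P[] /eqP -> xy; have [k1 k2 k3 kl] := ks.
- by have E := k1 _ xy; subst y; rewrite out_passing // passing_idem.
- by rewrite (negbTE (k2 y)) in xy.
- have E := k3 _ xy; subst y; rewrite out_passing // passing_idem // (level_opp (chiC xy)).
  by case: (level G e1 e3) kl.
Qed.

Let carries_const G x (a : X) s t : kink_state G -> x \in [:: e1; e2; e3] ->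
  carries G Q (fun _ _ => a) x s t.
Proof. by move=> ks x3; split=> // f u xf _ _ _ _; rewrite (out_const _ ks). Qed.

Let windows G c : locally_colored Q kink_enter kink_leave G c ->
  [/\ carries G Q c e1 0 1, carries G Q c e2 0 1, carries G Q c e3 0 1,
      c e2 0 = c e1 1 & c e3 0 = c e2 1].
Proof.
have [n1 n2 n3] := neq; move=> [hc hv]; split.
- by apply: hc; rewrite /kink_enter /kink_leave /= ?eqxx //=; lra.
- by apply: hc; rewrite /kink_enter /kink_leave /= ?n1 ?eqxx //=; lra.
- by apply: hc; rewrite /kink_enter /kink_leave /= ?n2 ?n3 ?eqxx //=; lra.
- by rewrite -next1 hv // /kink_leave /= eqxx /=; lra.
- by rewrite -next2 hv // /kink_leave /= n1 eqxx /=; lra.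
Qed.

(** The color [b] that comes back to the crossing is that of the whole kink after
it, so that it satisfies [b = passing a b], hence [b = a]. *)
Lemma kink_constant G c : kink_state G ->
  locally_colored Q kink_enter kink_leave G c ->
  forall x t, x \in [:: e1; e2; e3] -> 0 <= t <= 1 -> c x t = c e1 0.
Proof.
move=> ks hc; have [k1 k2 k3 kl] := ks; have [w1 w2 w3 v1 v2] := windows hc.
have l01 : 0 <= (1 : R) <= 1 by rewrite ler01 lexx.
set a := c e1 0.
have key : chi G e1 e3 -> c e3 (place G e3 e1) = a /\ c e1 (place G e1 e3) = a.
  move=> c13; have c31 := chiC c13.
  have /andP[p0 p1] := place01 c13; have /andP[q0 q1] := place01 c31.
  have u1 := carriesS (lexx 0) (ltW p1) w1; have u3 := carriesS (lexx 0) (ltW q1) w3.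
  have A1 : c e1 (place G e1 e3) = a.
    apply: (carries_uncut u1); first by rewrite ltW // lexx.
    by move=> f /k1 -> /andP[_]; rewrite ltxx.
  have A2 : c e1 1 = out G Q e1 e3 a (c e3 (place G e3 e1)).
    rewrite -A1; apply: (carries_cross w1) => //; first exact: ltW.
    by move=> f /k1 ->; rewrite ltxx.
  have A3 : c e2 1 = c e2 0.
    by apply: (carries_uncut w2) => // f e2f; case/negP: (k2 f).
  have A4 : c e3 (place G e3 e1) = c e3 0.
    apply: (carries_uncut u3); first by rewrite ltW // lexx.
    by move=> f /k3 -> /andP[_]; rewrite ltxx.
  have : passing Q (level G e1 e3) (turn G e1 e3) (lab e3) a (c e3 (place G e3 e1)) =
      c e3 (place G e3 e1).
    by rewrite -out_passing // -A2 -v1 -A3 -v2 A4.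
  by move=> /(passing_fixed kl) <-.
have C1 t : 0 <= t <= 1 -> c e1 t = a.
  apply: (carries_unique w1 (@carries_const G e1 a 0 1 ks _)); rewrite ?inE ?eqxx //.
  move=> f x c1f _; have E := k1 _ c1f; subst f.
  by have [-> _] := key c1f.
have C2 t : 0 <= t <= 1 -> c e2 t = a.
  apply: (carries_unique w2 (@carries_const G e2 a 0 1 ks _)).
  - by rewrite !inE eqxx orbT.
  - by rewrite v1 C1.
  - by move=> f x e2f; case/negP: (k2 f).
have C3 t : 0 <= t <= 1 -> c e3 t = a.
  apply: (carries_unique w3 (@carries_const G e3 a 0 1 ks _)).
  - by rewrite !inE eqxx !orbT.
  - by rewrite v2 C2.
  - move=> f x c3f _; have E := k3 _ c3f; subst f.
    by have [_ ->] := key (chiC c3f).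
by move=> x t; rewrite !inE => /or3P[] /eqP -> /=; auto.
Qed.

Let in_window x (s t : R) : kink_enter x <= s -> 0 <= s -> s < t -> t <= kink_leave x ->
  x \in [:: e1; e2; e3].
Proof.
rewrite /kink_enter /kink_leave /= !inE.
have [//|_] := eqVneq x e1; have [//|_] := eqVneq x e2; have [//|_] := eqVneq x e3.
by move=> _ s0 st t0; have := lt_le_trans st (le_trans t0 s0); rewrite ltxx.
Qed.

Lemma kink_deterministic G : kink_state G ->
  deterministic Q kink_enter kink_leave G.
Proof.
move=> ks c m hc hm ent x t _ t01 el.
have x3 : x \in [:: e1; e2; e3].
  move: el; rewrite /kink_enter /kink_leave /= !inE.
  by have [//|_] := eqVneq x e1; have [//|_] := eqVneq x e2; have [//|_] := eqVneq x e3;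
    rewrite ltxx.
rewrite (kink_constant ks hc) // (kink_constant ks hm) //.
by have := ent e1; rewrite /kink_enter /kink_leave /= eqxx /= => -> //; lra.
Qed.

Lemma kink_simulates G G' : kink_state G -> kink_state G' ->
  simulates Q kink_enter kink_leave G G'.
Proof.
move=> ks ks' c hc; have K := kink_constant ks hc; have [n1 n2 n3] := neq.
have E x t : 0 <= t <= 1 -> kink_enter x < kink_leave x -> c e1 0 = c x t.
  move=> t01 el; apply/esym/K => //.
  move: el; rewrite /kink_enter /kink_leave /= !inE.
  by have [//|_] := eqVneq x e1; have [//|_] := eqVneq x e2; have [//|_] := eqVneq x e3;
    rewrite ltxx.
exists (fun _ _ => c e1 0); split.
- split=> // x s t es s0 tl t1; have [ts|st] := leP t s; first exact: carries_trivial.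
  by apply: carries_const => //; exact: in_window es s0 st tl.
- move=> x el e0; apply: E => //; rewrite e0 /=.
  rewrite /kink_enter /=; case: eqP => _ /=; first lra.
  case: eqP => _ /=; first lra.
  by case: eqP => _ /=; lra.
- move=> x el l1; apply: E => //; rewrite l1 andbT.
  rewrite /kink_leave /=; case: eqP => _ /=; first lra.
  case: eqP => _ /=; first lra.
  by case: eqP => _ /=; lra.
Qed.

End Kink.

Section Finger.
Variables (R : realType) (S : skeleton) (X : Type) (Q : disingquandle X).
Variables (e1 e2 f : edge S) (af bf : R) (v : layer) (df : bool).
Hypotheses (distinct : uniq [:: e1; e2; f]).
Hypotheses (next1 : next S e1 = e2).
Hypotheses (window_f : [/\ 0 <= af, af < bf & bf <= 1]) (vS : v <> Sing).

Definition finger_enter x : R :=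
  (window [:: (e1, (0, 2)); (e2, (-1, 1)); (f, (af, bf))] x).1.
Definition finger_leave x : R :=
  (window [:: (e1, (0, 2)); (e2, (-1, 1)); (f, (af, bf))] x).2.

(** The two sides of the move that pushes a strand across the edge [f]. *)
Record apart_state (G : gauss R S) : Prop := ApartState {
  as_1 : forall x, ~~ chi G e1 x;
  as_2 : forall x, ~~ chi G e2 x;
  as_f : forall x, chi G f x -> ~~ (af <= place G f x < bf)
}.

Record finger_state (G : gauss R S) : Prop := FingerState {
  fs_1 : chi G e1 f;
  fs_2 : chi G e2 f;
  fs_1_only : forall x, chi G e1 x -> x = f;
  fs_2_only : forall x, chi G e2 x -> x = f;
  fs_f_only : forall x, chi G f x -> af <= place G f x < bf -> x = e1 \/ x = e2;
  fs_in : af < place G f e1 < bf /\ af < place G f e2 < bf;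
  fs_level : level G e1 f = v /\ level G e2 f = v;
  fs_turn : turn G e1 f = df /\ turn G e2 f = ~~ df
}.

Let neq : [/\ (e2 == e1) = false, (f == e1) = false & (f == e2) = false].
Proof.
have ne (x y : edge S) : x != y -> (y == x) = false by rewrite eq_sym => /negbTE.
by move: distinct; rewrite /= !inE !negb_or => /and3P[/andP[h1 h2] h3 _]; split; exact: ne.
Qed.

Let windows G c : locally_colored Q finger_enter finger_leave G c ->
  [/\ carries G Q c e1 0 1, carries G Q c e2 0 1, carries G Q c f af bf &
      c e2 0 = c e1 1].
Proof.
have [n1 n2 n3] := neq; have [a0 ab b1] := window_f; move=> [hc hv]; split.
- by apply: hc; rewrite /finger_enter /finger_leave /= ?eqxx //=; lra.
- by apply: hc; rewrite /finger_enter /finger_leave /= ?n1 ?eqxx //=; lra.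
- by apply: hc; rewrite /finger_enter /finger_leave /= ?n2 ?n3 ?eqxx //=; lra.
- by rewrite -next1 hv // /finger_leave /= eqxx /=; lra.
Qed.

Let finger_locally G m : carries G Q m e1 0 1 -> carries G Q m e2 0 1 ->
  carries G Q m f af bf -> m e2 0 = m e1 1 ->
  locally_colored Q finger_enter finger_leave G m.
Proof.
have [a0 ab b1] := window_f; move=> h1 h2 hf hv; split.
  move=> x r s er r0 sl s1; have [sr|rs] := leP s r; first exact: carries_trivial.
  move: er sl; rewrite /finger_enter /finger_leave /=.
  have [-> _ _|_] := eqVneq x e1; first exact: carriesS h1.
  have [-> _ _|_] := eqVneq x e2; first exact: carriesS h2.
  have [-> /= ? ?|_] := eqVneq x f; first exact: carriesS hf.
  by move=> _ s0; have := lt_le_trans rs (le_trans s0 r0); rewrite ltxx.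
move=> x; rewrite /finger_leave /=.
have [-> _|_] := eqVneq x e1; first by rewrite next1.
have [_|_] := eqVneq x e2; first by rewrite ltxx.
by have [_|_] := eqVneq x f; rewrite ltNge ?b1 // ler01.
Qed.

Let finger_entries (c m : edge S -> R -> X) : m e1 0 = c e1 0 -> m f af = c f af ->
  same_entries finger_enter finger_leave c m.
Proof.
move=> h1 h2 x; rewrite /finger_enter /finger_leave /=.
have [->//|_] := eqVneq x e1.
have [_|_] := eqVneq x e2; first by rewrite ler0N1.
by have [->//|_] := eqVneq x f; rewrite ltxx.
Qed.

Let finger_exits (c m : edge S -> R -> X) : m e2 1 = c e2 1 -> m f bf = c f bf ->
  same_exits finger_enter finger_leave c m.
Proof.
move=> h1 h2 x; rewrite /finger_enter /finger_leave /=.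
have [_ _ h|_] := eqVneq x e1; first by exfalso; move: h => /=; lra.
have [->//|_] := eqVneq x e2.
by have [->//|_] := eqVneq x f; rewrite ltxx.
Qed.

Let finger_cases (P : edge S -> R -> Prop) :
  (forall t, 0 <= t <= 1 -> P e1 t) -> (forall t, 0 <= t <= 1 -> P e2 t) ->
  (forall t, af <= t <= bf -> P f t) ->
  forall x t, finger_enter x <= t <= finger_leave x -> 0 <= t <= 1 ->
    finger_enter x < finger_leave x -> P x t.
Proof.
move=> h1 h2 hf x t; rewrite /finger_enter /finger_leave /=.
have [-> *|_] := eqVneq x e1; first exact: h1.
have [-> *|_] := eqVneq x e2; first exact: h2.
by have [-> *|_] := eqVneq x f; [exact: hf|rewrite ltxx].
Qed.

Let l01 : 0 <= (1 : R) <= 1. Proof. by rewrite ler01 lexx. Qed.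

Let entry1 (c m : edge S -> R -> X) : same_entries finger_enter finger_leave c m -> c e1 0 = m e1 0.
Proof.
by move/(_ e1); rewrite /finger_enter /finger_leave /= eqxx /= => -> //; lra.
Qed.

Let entryf (c m : edge S -> R -> X) : same_entries finger_enter finger_leave c m -> c f af = m f af.
Proof.
have [n1 n2 n3] := neq; have [a0 ab b1] := window_f.
by move/(_ f); rewrite /finger_enter /finger_leave /= n2 n3 eqxx /= => ->.
Qed.

Lemma apart_deterministic G : apart_state G ->
  deterministic Q finger_enter finger_leave G.
Proof.
move=> [k1 k2 kf] c m hc hm ent.
have [c1 c2 cf cv] := windows hc; have [m1 m2 mf mv] := windows hm.
have A1 t : 0 <= t <= 1 -> c e1 t = m e1 t.
  apply: (carries_unique c1 m1 (entry1 ent)) => h x ch; by case/negP: (k1 h).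
apply: finger_cases => //.
  apply: (carries_unique c2 m2); first by rewrite cv mv A1.
  by move=> h x ch; case/negP: (k2 h).
apply: (carries_unique cf mf (entryf ent)) => h x ch hw.
by case/negP: (kf h ch).
Qed.

Lemma finger_deterministic G : finger_state G ->
  deterministic Q finger_enter finger_leave G.
Proof.
move=> [k1 k2 o1 o2 of_ [i1 i2] [l1 l2] [t1 t2]] c m hc hm ent.
have [c1 c2 cf cv] := windows hc; have [m1 m2 mf mv] := windows hm.
have p01 (x y : edge S) : chi G x y -> 0 <= place G x y <= 1.
  by move=> /place01/andP[/ltW -> /ltW ->].
have strand : (forall x, out G Q e1 f x (c f (place G f e1)) =
      out G Q e1 f x (m f (place G f e1))) ->
    (forall x, out G Q e2 f x (c f (place G f e2)) =
      out G Q e2 f x (m f (place G f e2))) ->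
    (forall t, 0 <= t <= 1 -> c e1 t = m e1 t) /\
    (forall t, 0 <= t <= 1 -> c e2 t = m e2 t).
  move=> h1 h2.
  have A1 t : 0 <= t <= 1 -> c e1 t = m e1 t.
    by apply: (carries_unique c1 m1 (entry1 ent)) => h x /o1 ->.
  split=> //; apply: (carries_unique c2 m2); first by rewrite cv mv A1.
  by move=> h x /o2 ->.
have through : (forall x, out G Q f e1 x (c e1 (place G e1 f)) =
      out G Q f e1 x (m e1 (place G e1 f))) ->
    (forall x, out G Q f e2 x (c e2 (place G e2 f)) =
      out G Q f e2 x (m e2 (place G e2 f))) ->
    forall t, af <= t <= bf -> c f t = m f t.
  move=> h1 h2; apply: (carries_unique cf mf (entryf ent)) => h x ch hw.
  by case: (of_ h ch hw) => ->.
case: v vS l1 l2 => // _ l1 l2.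
  have [A1 A2] := strand (fun x => out_over Q x _ _ k1 l1) (fun x => out_over Q x _ _ k2 l2).
  by apply: finger_cases => //; apply: through => x; [rewrite A1|rewrite A2] => //; exact: p01.
have F : forall t, af <= t <= bf -> c f t = m f t.
  apply: through => x; apply: out_over; try exact: chiC.
    by rewrite (level_opp k1) l1.
  by rewrite (level_opp k2) l2.
have [A1 A2] : (forall t, 0 <= t <= 1 -> c e1 t = m e1 t) /\
    (forall t, 0 <= t <= 1 -> c e2 t = m e2 t).
  apply: strand => x; rewrite F //.
    by case/andP: i1 => /ltW -> /ltW ->.
  by case/andP: i2 => /ltW -> /ltW ->.
exact: finger_cases.
Qed.

(** The two passages have opposite turns, and undo each other. *)
Lemma finger_model G (a b : X) : finger_state G -> exists m,
  [/\ locally_colored Q finger_enter finger_leave G m,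
      m e1 0 = a /\ m f af = b & m e2 1 = a /\ m f bf = b].
Proof.
move=> [k1 k2 o1 o2 of_ [i1 i2] [l1 l2] [t1 t2]].
have [n1 n2 n3] := neq; have [a0 ab b1] := window_f.
have /andP[p0 p1] := place01 k1; have /andP[q0 q1] := place01 k2.
have k1' := chiC k1; have k2' := chiC k2.
have o12 : out G Q e1 f =2 passing Q v df (lab f).
  by move=> x y; rewrite out_passing // l1 t1.
have o22 : out G Q e2 f =2 passing Q v (~~ df) (lab f).
  by move=> x y; rewrite out_passing // l2 t2.
have of1 : out G Q f e1 =2 passing Q (opposite v) (~~ df) (lab e1).
  by move=> x y; rewrite out_passing // (level_opp k1) (turnC k1) l1 t1.
have of2 : out G Q f e2 =2 passing Q (opposite v) df (lab e1).
  move=> x y; rewrite out_passing // (level_opp k2) (turnC k2) l2 t2 negbK.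
  by rewrite -next1 lab_next.
pose P1 := place G f e1; pose P2 := place G f e2.
have P12 : P1 != P2.
  apply/eqP => E; have := place_inj k1' k2' E => E'; by rewrite E' eqxx in n1.
pose o := P1 < P2.
have oP : ordered o P1 P2.
  by rewrite /ordered /o; case: ltP => // h; rewrite lt_neqAle eq_sym P12.
pose a1 := passing Q v df (lab f) a b.
pose b1' := passing Q (opposite v) (if o then ~~ df else df) (lab e1) b a.
pose T1 := place G e1 f; pose T2 := 1 + place G e2 f.
have [T12 T20] : T1 < T2 /\ 0 < T2 by rewrite /T1 /T2; split; lra.
pose strand := step2 true a T1 T2 a1 a.
pose through := step2 o b P1 P2 b1' b.
pose m x t := if x == e1 then strand t else if x == e2 then strand (1 + t) else through t.
have m1 t : m e1 t = strand (0 + t) by rewrite /m eqxx add0r.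
have m2 t : m e2 t = strand (1 + t) by rewrite /m n1 eqxx.
have mf t : m f t = through (0 + t) by rewrite /m n2 n3 add0r.
have [V1 V2] : strand T1 = a /\ strand T2 = a1.
  by rewrite /strand step2_first // step2_second.
(* The edges that pass over keep their color. *)
have thE t : v = Under -> through t = b.
  by move=> E; rewrite /through /b1' E /step2 /step3; case: (o); do 2?case: ifP.
have stE t : v = Over -> strand t = a.
  by move=> E; rewrite /strand /a1 E /step2 /step3; do 2?case: ifP.
have out1 : a1 = out G Q e1 f a (m f (place G f e1)).
  by rewrite o12 mf /a1; case: v vS thE => // _ thE; rewrite thE.
have out2 : a = out G Q e2 f a1 (m f (place G f e2)).
  by rewrite o22 mf /a1; case: v vS thE => // _ thE; rewrite thE // passing_undo.
have und w x : passing Q (opposite v) (~~ w) (lab e1)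
    (passing Q (opposite v) w (lab e1) x a) a = x.
  by case: v vS => // _; rewrite /opposite passing_undo.
have E1 x : out G Q f e1 x (m e1 (place G e1 f)) =
    passing Q (opposite v) (~~ df) (lab e1) x a by rewrite of1 m1 add0r V1.
have E2 x : out G Q f e2 x (m e2 (place G e2 f)) =
    passing Q (opposite v) df (lab e1) x a.
  by rewrite of2 m2; case: v vS stE => // _ stE; rewrite stE.
exists m; split; last 2 first.
- rewrite m1 mf !add0r /strand /through !step2_start ?ltW //.
  + by case/andP: i1.
  + by case/andP: i2.
- rewrite m2 mf /strand /through add0r !step2_end //.
  + by case/andP: i1.
  + by case/andP: i2.
  + by rewrite /T1; lra.
  + by rewrite /T2; lra.
apply: finger_locally.
- apply: (carries_step2 (h1 := f) (h2 := f) (o := true) T12 m1) => [h ch _|_|].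
  + by left; have E := o1 _ ch; subst h; rewrite add0r.
  + by rewrite add0r.
  + by rewrite /T2; lra.
- apply: (carries_step2 (h1 := f) (h2 := f) (o := true) T12 m2) => [h ch _||_].
  + by right; have E := o2 _ ch; subst h.
  + by rewrite /T1; lra.
  + by [].
- apply: (carries_step2 (h1 := e1) (h2 := e2) oP mf) => [h ch hw|_|_].
  + by rewrite add0r; case: (of_ _ ch hw) => ->; [left|right].
  + rewrite add0r E1; split=> //; rewrite /b1'; case: (o); by rewrite ?und.
  + rewrite add0r E2; split=> //; rewrite /b1'; case: (o) => //.
    by rewrite -{1}(und (~~ df) b) negbK.
- by rewrite m1 m2 add0r addr0.
Qed.

Let n2' : (e1 == f) = false. Proof. by rewrite eq_sym; case: neq. Qed.
Let n3' : (e2 == f) = false. Proof. by rewrite eq_sym; case: neq. Qed.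

Lemma apart_model G (a b : X) : apart_state G ->
  let m := fun x (_ : R) => if x == f then b else a in
  locally_colored Q finger_enter finger_leave G m.
Proof.
move=> [k1 k2 kf] m; have [n1 n2 n3] := neq.
apply: finger_locally.
- by split=> // h t ch; case/negP: (k1 h).
- by split=> // h t ch; case/negP: (k2 h).
- split=> // h t ch ah ht tb; case/negP: (kf h ch).
  by rewrite ah (lt_le_trans ht).
- by rewrite /m n2' n3'.
Qed.

Let at_exits (c m : edge S -> R -> X) :
  (forall x t, finger_enter x <= t <= finger_leave x -> 0 <= t <= 1 ->
    finger_enter x < finger_leave x -> c x t = m x t) ->
  c e2 1 = m e2 1 /\ c f bf = m f bf.
Proof.
have [n1 n2 n3] := neq; have [a0 ab b1] := window_f.
move=> D; split; apply: D; rewrite /finger_enter /finger_leave /= ?n1 ?n2 ?n3 ?eqxx /=; lra.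
Qed.

Lemma finger_out G G' : apart_state G -> finger_state G' ->
  simulates Q finger_enter finger_leave G G'.
Proof.
move=> ks ks' c hc; have lm := apart_model (c e1 0) (c f af) ks.
have [m [hm [h1 h2] [h3 h4]]] := finger_model (c e1 0) (c f af) ks'.
have [n1 n2 n3] := neq; have [a0 ab b1] := window_f.
have D := apart_deterministic ks hc lm.
have {}D := D (finger_entries _ _); rewrite n2' eqxx in D.
have {}D := D erefl erefl.
exists m; split=> //; [exact: finger_entries|apply: finger_exits].
- by have [-> _] := at_exits D; rewrite n3'.
- by have [_ ->] := at_exits D; rewrite eqxx.
Qed.

Lemma finger_in G G' : finger_state G -> apart_state G' ->
  simulates Q finger_enter finger_leave G G'.
Proof.
move=> ks ks' c hc; have lm := apart_model (c e1 0) (c f af) ks'.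
have [m [hm [h1 h2] [h3 h4]]] := finger_model (c e1 0) (c f af) ks.
have [n1 n2 n3] := neq; have [a0 ab b1] := window_f.
have D := finger_deterministic ks hc hm (finger_entries h1 h2).
eexists; split; first exact: lm.
- by apply: finger_entries; rewrite ?eqxx // n2'.
- apply: finger_exits.
  + by have [-> _] := at_exits D; rewrite n3' h3.
  + by have [_ ->] := at_exits D; rewrite eqxx h4.
Qed.

End Finger.

(** * Classical and singular crossings exchanged in a bigon *)

Section Twist.
Variables (R : realType) (S : skeleton) (X : Type) (Q : disingquandle X).
Variables (e1 e2 f1 f2 : edge S) (ae be af bf : R) (d : bool).
Hypotheses (distinct : uniq [:: e1; e2; f1; f2]).
Hypotheses (next_e : next S e1 = e2) (next_f : next S f1 = f2).
Hypotheses (we : [/\ 0 <= ae, ae < 1, 0 < be & be <= 1]).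
Hypotheses (wf : [/\ 0 <= af, af < 1, 0 < bf & bf <= 1]).

Definition twist_enter x : R :=
  (window [:: (e1, (ae, 2)); (e2, (-1, be)); (f1, (af, 2)); (f2, (-1, bf))] x).1.
Definition twist_leave x : R :=
  (window [:: (e1, (ae, 2)); (e2, (-1, be)); (f1, (af, 2)); (f2, (-1, bf))] x).2.

(** [v1] and [v2] are the levels of the two corners of the bigon. *)
Record twist_state (G : gauss R S) (v1 v2 : layer) : Prop := TwistState {
  ts_1 : chi G e1 f1;
  ts_2 : chi G e2 f2;
  ts_e1 : forall x, chi G e1 x -> ae <= place G e1 x -> x = f1;
  ts_e2 : forall x, chi G e2 x -> place G e2 x < be -> x = f2;
  ts_f1 : forall x, chi G f1 x -> af <= place G f1 x -> x = e1;
  ts_f2 : forall x, chi G f2 x -> place G f2 x < bf -> x = e2;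
  ts_in1 : ae < place G e1 f1 /\ af < place G f1 e1;
  ts_in2 : place G e2 f2 < be /\ place G f2 e2 < bf;
  ts_level : level G e1 f1 = v1 /\ level G e2 f2 = v2;
  ts_turn : turn G e1 f1 = d /\ turn G e2 f2 = ~~ d
}.

Let neq : [/\ (e2 == e1) = false, (f1 == e1) = false /\ (f1 == e2) = false &
      [/\ (f2 == e1) = false, (f2 == e2) = false & (f2 == f1) = false]].
Proof.
have ne (x y : edge S) : x != y -> (y == x) = false by rewrite eq_sym => /negbTE.
move: distinct; rewrite /= !inE !negb_or.
move=> /and4P[/and3P[h1 h2 h3] /andP[h4 h5] h6 _].
by split; [|split|split]; exact: ne.
Qed.

Let windows G c : locally_colored Q twist_enter twist_leave G c ->
  [/\ carries G Q c e1 ae 1, carries G Q c e2 0 be,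
      carries G Q c f1 af 1 & carries G Q c f2 0 bf] /\
  (c e2 0 = c e1 1 /\ c f2 0 = c f1 1).
Proof.
have [n1 [n2 n3] [n4 n5 n6]] := neq; have [p1 p2 p3 p4] := we; have [q1 q2 q3 q4] := wf.
move=> [hc hv]; split; split.
- by apply: hc; rewrite /twist_enter /twist_leave /= ?eqxx //=; lra.
- by apply: hc; rewrite /twist_enter /twist_leave /= ?n1 ?eqxx //=; lra.
- by apply: hc; rewrite /twist_enter /twist_leave /= ?n2 ?n3 ?eqxx //=; lra.
- by apply: hc; rewrite /twist_enter /twist_leave /= ?n4 ?n5 ?n6 ?eqxx //=; lra.
- by rewrite -next_e hv // /twist_leave /= eqxx /=; lra.
- by rewrite -next_f hv // /twist_leave /= n2 n3 eqxx /=; lra.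
Qed.

Let twist_locally G m : carries G Q m e1 ae 1 -> carries G Q m e2 0 be ->
  carries G Q m f1 af 1 -> carries G Q m f2 0 bf ->
  m e2 0 = m e1 1 -> m f2 0 = m f1 1 ->
  locally_colored Q twist_enter twist_leave G m.
Proof.
have [p1 p2 p3 p4] := we; have [q1 q2 q3 q4] := wf.
move=> h1 h2 hf1 hf2 v1 v2; split.
  move=> x r s er r0 sl s1; have [sr|rs] := leP s r; first exact: carries_trivial.
  move: er sl; rewrite /twist_enter /twist_leave /=.
  have [-> /= ? _|_] := eqVneq x e1; first exact: carriesS h1.
  have [-> /= _ ?|_] := eqVneq x e2; first exact: carriesS h2.
  have [-> /= ? _|_] := eqVneq x f1; first exact: carriesS hf1.
  have [-> /= _ ?|_] := eqVneq x f2; first exact: carriesS hf2.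
  by move=> _ s0; have := lt_le_trans rs (le_trans s0 r0); rewrite ltxx.
move=> x; rewrite /twist_leave /=.
have [-> _|_] := eqVneq x e1; first by rewrite next_e.
have [_|_] := eqVneq x e2; first by rewrite ltNge p4.
have [-> _|_] := eqVneq x f1; first by rewrite next_f.
by have [_|_] := eqVneq x f2; rewrite ltNge ?q4 // ler01.
Qed.

Let twist_entries (c m : edge S -> R -> X) : m e1 ae = c e1 ae -> m f1 af = c f1 af ->
  same_entries twist_enter twist_leave c m.
Proof.
move=> h1 h2 x; rewrite /twist_enter /twist_leave /=.
have [->//|_] := eqVneq x e1.
have [_|_] := eqVneq x e2; first by rewrite ler0N1.
have [->//|_] := eqVneq x f1.
by have [_|_] := eqVneq x f2; rewrite ?ler0N1 ?ltxx.
Qed.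

Let twist_exits_of (c m : edge S -> R -> X) : m e2 be = c e2 be -> m f2 bf = c f2 bf ->
  same_exits twist_enter twist_leave c m.
Proof.
move=> h1 h2 x; rewrite /twist_enter /twist_leave /=.
have [_ _ h|_] := eqVneq x e1; first by exfalso; move: h => /=; lra.
have [->//|_] := eqVneq x e2.
have [_ _ h|_] := eqVneq x f1; first by exfalso; move: h => /=; lra.
by have [->//|_] := eqVneq x f2; rewrite ltxx.
Qed.

Lemma twist_deterministic G v1 v2 : twist_state G v1 v2 ->
  deterministic Q twist_enter twist_leave G.
Proof.
move=> [k1 k2 oe1 oe2 of1 of2 [i1 i2] [j1 j2] _ _] c m hc hm ent.
have [n1 [n2 n3] [n4 n5 n6]] := neq; have [p1 p2 p3 p4] := we; have [q1 q2 q3 q4] := wf.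
have [[c1 c2 cf1 cf2] [cv1 cv2]] := windows hc.
have [[m1 m2 mf1 mf2] [mv1 mv2]] := windows hm.
have k1' := chiC k1; have k2' := chiC k2.
have /andP[a0 a1] := place01 k1; have /andP[b0 b1] := place01 k2.
have /andP[a0' a1'] := place01 k1'; have /andP[b0' b1'] := place01 k2'.
have E1 : c e1 ae = m e1 ae.
  by have := ent e1; rewrite /twist_enter /twist_leave /= eqxx /= => -> //; lra.
have E2 : c f1 af = m f1 af.
  by have := ent f1; rewrite /twist_enter /twist_leave /= n2 n3 eqxx /= => -> //; lra.
have A1 : c e1 (place G e1 f1) = m e1 (place G e1 f1).
  apply: (agree_clear (carriesS (lexx _) (ltW a1) c1) (carriesS (lexx _) (ltW a1) m1)) => //.
    exact: ltW.
  by move=> h ch; apply/negP => /andP[h1 h2]; rewrite (oe1 h) // ltxx in h2.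
have A2 : c f1 (place G f1 e1) = m f1 (place G f1 e1).
  apply: (agree_clear (carriesS (lexx _) (ltW a1') cf1) (carriesS (lexx _) (ltW a1') mf1)) => //.
    exact: ltW.
  by move=> h ch; apply/negP => /andP[h1 h2]; rewrite (of1 h) // ltxx in h2.
have B1 t : ae <= t <= 1 -> c e1 t = m e1 t.
  apply: (carries_unique c1 m1 E1) => h x ch /andP[h1 _].
  by rewrite (oe1 h ch h1) A2.
have B2 t : af <= t <= 1 -> c f1 t = m f1 t.
  apply: (carries_unique cf1 mf1 E2) => h x ch /andP[h1 _].
  by rewrite (of1 h ch h1) A1.
have F1 : c e2 0 = m e2 0 by rewrite cv1 mv1 B1 // lexx ltW.
have F2 : c f2 0 = m f2 0 by rewrite cv2 mv2 B2 // lexx ltW.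
have C1 : c e2 (place G e2 f2) = m e2 (place G e2 f2).
  apply: (agree_clear (carriesS (lexx _) (ltW j1) c2) (carriesS (lexx _) (ltW j1) m2)) => //.
    exact: ltW.
  move=> h ch; apply/negP => /andP[h1 h2].
  by have E := oe2 h ch (lt_trans h2 j1); rewrite E ltxx in h2.
have C2 : c f2 (place G f2 e2) = m f2 (place G f2 e2).
  apply: (agree_clear (carriesS (lexx _) (ltW j2) cf2) (carriesS (lexx _) (ltW j2) mf2)) => //.
    exact: ltW.
  move=> h ch; apply/negP => /andP[h1 h2].
  by have E := of2 h ch (lt_trans h2 j2); rewrite E ltxx in h2.
have D1 t : 0 <= t <= be -> c e2 t = m e2 t.
  apply: (carries_unique c2 m2 F1) => h x ch /andP[_ h1].
  by rewrite (oe2 h ch h1) C2.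
have D2 t : 0 <= t <= bf -> c f2 t = m f2 t.
  apply: (carries_unique cf2 mf2 F2) => h x ch /andP[_ h1].
  by rewrite (of2 h ch h1) C1.
move=> x t /andP[]; rewrite /twist_enter /twist_leave /=.
have [-> /= h1 _ /andP[_ h2] _|_] := eqVneq x e1; first by apply: B1; rewrite h1.
have [-> /= _ h1 /andP[h2 _] _|_] := eqVneq x e2; first by apply: D1; rewrite h2.
have [-> /= h1 _ /andP[_ h2] _|_] := eqVneq x f1; first by apply: B2; rewrite h1.
have [-> /= _ h1 /andP[h2 _] _|_] := eqVneq x f2; first by apply: D2; rewrite h2.
by rewrite ltxx.
Qed.

Lemma twist_model G v1 v2 (x0 y0 : X) : twist_state G v1 v2 ->
  let x1 := passing Q v1 d (lab f1) x0 y0 in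
  let y1 := passing Q (opposite v1) (~~ d) (lab e1) y0 x0 in
  exists m, [/\ locally_colored Q twist_enter twist_leave G m,
    m e1 ae = x0 /\ m f1 af = y0,
    m e2 be = passing Q v2 (~~ d) (lab f1) x1 y1 &
    m f2 bf = passing Q (opposite v2) d (lab e1) y1 x1].
Proof.
move=> [k1 k2 oe1 oe2 of1 of2 [i1 i2] [j1 j2] [l1 l2] [t1 t2]] x1 y1.
have [n1 [n2 n3] [n4 n5 n6]] := neq; have [p1 p2 p3 p4] := we; have [q1 q2 q3 q4] := wf.
have k1' := chiC k1; have k2' := chiC k2.
have /andP[a0 a1] := place01 k1; have /andP[b0 b1] := place01 k2.
have /andP[a0' a1'] := place01 k1'; have /andP[b0' b1'] := place01 k2'.
have le2 : lab e2 = lab e1 by rewrite -next_e lab_next.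
have lf2 : lab f2 = lab f1 by rewrite -next_f lab_next.
set x2 := passing Q v2 _ _ x1 y1; set y2 := passing Q _ _ _ y1 x1.
have O1 x y : out G Q e1 f1 x y = passing Q v1 d (lab f1) x y.
  by rewrite out_passing // l1 t1.
have O2 x y : out G Q e2 f2 x y = passing Q v2 (~~ d) (lab f1) x y.
  by rewrite out_passing // l2 t2 lf2.
have O3 x y : out G Q f1 e1 x y = passing Q (opposite v1) (~~ d) (lab e1) x y.
  by rewrite out_passing // (level_opp k1) (turnC k1) l1 t1.
have O4 x y : out G Q f2 e2 x y = passing Q (opposite v2) d (lab e1) x y.
  by rewrite out_passing // (level_opp k2) (turnC k2) l2 t2 le2 negbK.
pose T1 := place G e1 f1; pose T2 := 1 + place G e2 f2.
pose U1 := place G f1 e1; pose U2 := 1 + place G f2 e2.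
have T12 : T1 < T2 by rewrite /T1 /T2; lra.
have U12 : U1 < U2 by rewrite /U1 /U2; lra.
pose m x t := if x == e1 then step3 x0 T1 x1 T2 x2 t
  else if x == e2 then step3 x0 T1 x1 T2 x2 (1 + t)
  else if x == f1 then step3 y0 U1 y1 U2 y2 t else step3 y0 U1 y1 U2 y2 (1 + t).
have mE1 t : m e1 t = step3 x0 T1 x1 T2 x2 t by rewrite /m eqxx.
have mE2 t : m e2 t = step3 x0 T1 x1 T2 x2 (1 + t) by rewrite /m n1 eqxx.
have mF1 t : m f1 t = step3 y0 U1 y1 U2 y2 t by rewrite /m n2 n3 eqxx.
have mF2 t : m f2 t = step3 y0 U1 y1 U2 y2 (1 + t) by rewrite /m n4 n5 n6.
have P1 : m e1 (place G e1 f1) = x0 by rewrite mE1 step3_start.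
have P2 : m e2 (place G e2 f2) = x1 by rewrite mE2 step3_mid // T12 lexx.
have P3 : m f1 (place G f1 e1) = y0 by rewrite mF1 step3_start.
have P4 : m f2 (place G f2 e2) = y1 by rewrite mF2 step3_mid // U12 lexx.
exists m; split; last 3 first.
- by rewrite mE1 mF1 !step3_start ?ltW.
- by rewrite mE2 step3_end // ltrD2l.
- by rewrite mF2 step3_end // ltrD2l.
apply: twist_locally.
- apply: (carries_step3 (o := 0) (h1 := f1) (h2 := f2) T12) => [u _|h ch /andP[hw _]|_|].
  + by rewrite add0r mE1.
  + by left; rewrite (oe1 h) // add0r.
  + by split; rewrite ?add0r // O1 P3.
  + by rewrite /T2; lra.
- apply: (carries_step3 (o := 1) (h1 := f1) (h2 := f2) T12) => [u _|h ch /andP[_ hw]||_].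
  + by rewrite mE2.
  + by right; rewrite (oe2 h).
  + by rewrite /T1; lra.
  + by split=> //; rewrite O2 P4.
- apply: (carries_step3 (o := 0) (h1 := e1) (h2 := e2) U12) => [u _|h ch /andP[hw _]|_|].
  + by rewrite add0r mF1.
  + by left; rewrite (of1 h) // add0r.
  + by split; rewrite ?add0r // O3 P1.
  + by rewrite /U2; lra.
- apply: (carries_step3 (o := 1) (h1 := e1) (h2 := e2) U12) => [u _|h ch /andP[_ hw]||_].
  + by rewrite mF2.
  + by right; rewrite (of2 h).
  + by rewrite /U1; lra.
  + by split=> //; rewrite O4 P2.
- by rewrite mE1 mE2 addr0.
- by rewrite mF1 mF2 addr0.
Qed.

Let at_exits (c m : edge S -> R -> X) :
  (forall x t, twist_enter x <= t <= twist_leave x -> 0 <= t <= 1 ->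
    twist_enter x < twist_leave x -> c x t = m x t) ->
  c e2 be = m e2 be /\ c f2 bf = m f2 bf.
Proof.
have [n1 [n2 n3] [n4 n5 n6]] := neq; have [p1 p2 p3 p4] := we; have [q1 q2 q3 q4] := wf.
by move=> D; split; apply: D; rewrite /twist_enter /twist_leave /= ?n1 ?n4 ?n5 ?n6 ?eqxx /=; lra.
Qed.

Lemma twist_simulates G G' v : v <> Sing ->
  twist_state G v Sing -> twist_state G' Sing (opposite v) ->
  simulates Q twist_enter twist_leave G G' /\
  simulates Q twist_enter twist_leave G' G.
Proof.
move=> vS ts ts'.
have vv : opposite (opposite v) = v by case: (v).
split=> c hc.
  have [m [hm [a1 a2] b1 b2]] := twist_model (c e1 ae) (c f1 af) ts.
  have [m' [hm' [a1' a2'] b1' b2']] := twist_model (c e1 ae) (c f1 af) ts'.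
  have [E1 E2] := at_exits (twist_deterministic ts hc hm (twist_entries a1 a2)).
  have [X1 X2] := twist_exits Q d (lab e1) (lab f1) (c e1 ae) (c f1 af) vS.
  exists m'; split=> //; first exact: twist_entries.
  by apply: twist_exits_of; rewrite ?b1' ?b2' ?E1 ?E2 ?b1 ?b2 ?vv.
have [m [hm [a1 a2] b1 b2]] := twist_model (c e1 ae) (c f1 af) ts'.
have [m' [hm' [a1' a2'] b1' b2']] := twist_model (c e1 ae) (c f1 af) ts.
have [E1 E2] := at_exits (twist_deterministic ts' hc hm (twist_entries a1 a2)).
have [X1 X2] := twist_exits Q d (lab e1) (lab f1) (c e1 ae) (c f1 af) vS.
exists m'; split=> //; first exact: twist_entries.
by apply: twist_exits_of; rewrite ?b1' ?b2' ?E1 ?E2 ?b1 ?b2 ?vv.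
Qed.

End Twist.

(** * What is seen in a disc *)

Section Gaps.
Variable R : realType.
Implicit Types (U V : seq R) (m a b u v : R).

Lemma gap_below V m : 0 < m ->
  exists2 a, 0 <= a < m & forall v, v \in V -> v < m -> v < a.
Proof.
move=> m0; elim: V => [|v V [a /andP[a0 am] IH]]; first by exists (m / 2) => //; lra.
have [vm|mv] := ltP v m; last first.
  exists a; first by rewrite a0.
  move=> w; rewrite inE => /orP[/eqP ->|wV]; last exact: IH.
  by rewrite ltNge mv.
exists (Num.max a ((v + m) / 2)); first by rewrite le_max a0 gt_max am /=; lra.
move=> w; rewrite inE lt_max => /orP[/eqP -> _|wV wm]; last by rewrite IH.
by apply/orP; right; lra.
Qed.

Lemma gap_above V m : m < 1 ->
  exists2 b, m < b <= 1 & forall v, v \in V -> m < v -> b < v.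
Proof.
move=> m1; have [|a /andP[a0 am] h] := @gap_below [seq 1 - v | v <- V] (1 - m).
  lra.
exists (1 - a); first by lra.
move=> v vV mv; have := h (1 - v) (map_f _ vV); lra.
Qed.

Lemma seq_min U u0 : u0 \in U -> exists2 m, m \in U & forall u, u \in U -> m <= u.
Proof.
elim: U u0 => // v U IH u0 _; case: U IH => [_|w U IH].
  by exists v; rewrite ?inE // => u; rewrite inE => /eqP ->.
have [|m mU h] := IH w; first by rewrite inE eqxx.
have [vm|mv] := leP v m.
  exists v; first by rewrite inE eqxx.
  by move=> u; rewrite inE => /orP[/eqP ->//|/h]; apply: le_trans.
exists m; first by rewrite inE mU orbT.
by move=> u; rewrite inE => /orP[/eqP ->|/h //]; exact: ltW.
Qed.

Lemma seq_max U u0 : u0 \in U -> exists2 m, m \in U & forall u, u \in U -> u <= m.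
Proof.
move=> uU; have [m /mapP[w wU ->] h] := seq_min (map_f -%R uU).
by exists w => // u uU'; have := h _ (map_f -%R uU'); rewrite lerN2.
Qed.

(** As the lists are finite, there is some room on both sides of the hull of [U]. *)
Lemma separating_window U V u0 : u0 \in U ->
  (forall u, u \in U -> 0 < u < 1) ->
  (forall u u' v, u \in U -> u' \in U -> v \in V -> ~~ (u <= v <= u')) ->
  exists a b, [/\ 0 <= a, a < b, b <= 1,
    forall u, u \in U -> a < u < b & forall v, v \in V -> v < a \/ b < v].
Proof.
move=> uU U01 sep.
have [m mU hm] := seq_min uU; have [M MU hM] := seq_max uU.
have /andP[m0 m1] := U01 m mU; have /andP[M0 M1] := U01 M MU.
have [a /andP[a0 am] ha] := gap_below V m0; have [b /andP[bM b1] hb] := gap_above V M1.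
have mM := hm M MU.
exists a, b; split=> //.
- by apply: lt_trans am (le_lt_trans mM bM).
- by move=> u uU'; rewrite (lt_le_trans am) ?hm // (le_lt_trans _ bM) ?hM.
- move=> v vV; have := sep m M v mU MU vV; rewrite negb_and -!ltNge.
  by move=> /orP[/(ha v vV)|/(hb v vV)]; [left|right].
Qed.

End Gaps.

Section Disc.
Variables (R : realType) (S : skeleton) (i : layering S) (B : set 'rV[R]_2).
Variables (str thr : seq (edge S)).
Implicit Types (r : position R S) (x y : edge S) (t u s : R).

(** What is seen in the disc: strands inside it, edges that traverse it, and
nothing else but the two ends of the strand. *)
Record picture r : Prop := Picture {
  pic_strand : forall x, x \in str -> segment r x `<=` B;
  pic_through : forall x, x \in thr -> ~ B (r x) /\ ~ B (r (next S x));
  pic_other : forall x z, x \notin str -> x \notin thr -> segment r x z -> B z ->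
    exists w, z = r w
}.

Hypothesis convexB : convex B.

Lemma through_notin r x : picture r -> x \in thr -> x \notin str.
Proof.
move=> pic xt; apply/negP => xs; have [nB _] := pic_through pic xt.
exact/nB/(pic_strand pic xs)/segment_start.
Qed.

(** The part of an edge in a convex disc is an interval. *)
Lemma through_convex r x s t u : B (point r x s) -> B (point r x u) ->
  s <= t <= u -> B (point r x t).
Proof.
move=> Bs Bu /andP[st tu]; have [su|su] := eqVneq s u.
  have -> // : t = s by apply/eqP; rewrite eq_le st su tu.
have us : 0 < u - s by rewrite subr_gt0 lt_neqAle su (le_trans st).
have -> : point r x t = point r x s + ((t - s) / (u - s)) *: (point r x u - point r x s).
  rewrite /point; apply: row2P; rewrite !mxE; field; exact: lt0r_neq0.
apply: convexB => //; rewrite divr_ge0 ?subr_ge0 ?(ltW us) //=.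
  by rewrite ler_pdivrMr // mul1r lerD2r.
exact: le_trans tu.
Qed.

Section OnePicture.
Variable r : position R S.
Hypotheses (reg : regular r i) (pic : picture r).

Lemma crossing_in_disc x y : crosses r x y -> B (point r x (par r x y)) ->
  y \in str ++ thr.
Proof.
move=> cr Bz; rewrite mem_cat; apply/negP => /negP; rewrite negb_or => /andP[ys yt].
have [zx zy] := segment_crossing reg cr.
have [w zw] := pic_other pic ys yt zy Bz.
by apply: (crossing_not_vertex reg cr (v := w)); rewrite -zw.
Qed.

Lemma strand_crossing x y : x \in str -> crosses r x y -> y \in str ++ thr.
Proof.
move=> xs cr; apply: (crossing_in_disc cr); apply: (pic_strand pic xs).
by case: (segment_crossing reg cr).
Qed.

Lemma strand_crossingB x y : crosses r x y -> y \in str -> B (point r x (par r x y)).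
Proof.
move=> cr ys; apply: (pic_strand pic ys); by case: (segment_crossing reg cr).
Qed.

End OnePicture.

Section TwoPictures.
Variables (p q : position R S) (hp : regular p i) (hq : regular q i).
Hypotheses (picp : picture p) (picq : picture q).
Hypothesis same : forall x, x \notin str -> p x = q x /\ p (next S x) = q (next S x).
Hypothesis thr_in : forall x y, x \in thr -> y \in thr -> crosses p x y ->
  B (point p x (par p x y)).

Lemma same_dir x : x \notin str -> dir p x = dir q x.
Proof. by move=> /same[h1 h2]; rewrite /dir h1 h2. Qed.

Lemma same_point x t : x \notin str -> point p x t = point q x t.
Proof. by move=> h; rewrite /point same_dir //; have [-> _] := same h. Qed.

Lemma same_par x y : x \notin str -> y \notin str -> par p x y = par q x y.
Proof.
move=> hx hy; rewrite /par !same_dir //.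
by have [-> _] := same hx; have [-> _] := same hy.
Qed.

Lemma same_crosses x y : x \notin str -> y \notin str ->
  crosses p x y <-> crosses q x y.
Proof.
move=> hx hy; rewrite /crosses.
have -> // : segment p x = segment q x.
  by apply/seteqP; split=> z [t t01 ->]; exists t; rewrite ?same_point.
have -> // : segment p y = segment q y.
by apply/seteqP; split=> z [t t01 ->]; exists t; rewrite ?same_point.
Qed.

Definition inside x y := (x \in str ++ thr) && (y \in str ++ thr).

Definition window_for x (a b : R) : Prop :=
  [/\ forall y, y \in str ++ thr -> crosses p x y -> a < par p x y < b,
      forall y, y \in str ++ thr -> crosses q x y -> a < par q x y < b &
      forall y, y \notin str ++ thr -> crosses p x y ->
        par p x y < a \/ b < par p x y].

(** Along an edge that traverses the disc, the crossings in the disc are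
consecutive, both before and after the move. *)
Lemma through_window x : x \in thr ->
  (exists y, y \in str ++ thr /\ (crosses p x y \/ crosses q x y)) ->
  exists a b, [/\ 0 <= a, a < b, b <= 1 & window_for x a b].
Proof.
move=> xt [y0 [y0I cr0]]; have xs := through_notin picp xt.
pose U := [seq par p x y | y <- enum (edge S) & (y \in str ++ thr) && `[< crosses p x y >]]
       ++ [seq par q x y | y <- enum (edge S) & (y \in str ++ thr) && `[< crosses q x y >]].
pose V := [seq par p x y | y <- enum (edge S) & (y \notin str ++ thr) && `[< crosses p x y >]].
have Up y : y \in str ++ thr -> crosses p x y -> par p x y \in U.
  move=> yI cr; rewrite mem_cat map_f // mem_filter yI mem_enum andbT.
  exact/asboolP.
have Uq y : y \in str ++ thr -> crosses q x y -> par q x y \in U.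
  move=> yI cr; rewrite mem_cat [X in _ || X]map_f ?orbT // mem_filter yI mem_enum andbT.
  exact/asboolP.
have UB u : u \in U -> B (point p x u) /\ 0 < u < 1.
  rewrite mem_cat => /orP[] /mapP[y]; rewrite mem_filter => /andP[/andP[yI /asboolP cr] _] ->.
    split; last exact: par_in01 hp _ _ cr.
    have [ys|yt] := orP (etrans (esym (mem_cat _ _ _)) yI).
      exact: (strand_crossingB hp picp cr ys).
    exact: thr_in.
  split; last exact: par_in01 hq _ _ cr.
  have [ys|yt] := orP (etrans (esym (mem_cat _ _ _)) yI).
    by rewrite same_point //; exact: (strand_crossingB hq picq cr ys).
  have ynt := through_notin picp yt.
  by rewrite -same_par //; apply: thr_in => //; apply/same_crosses.
have [u0 u0U] : exists u0, u0 \in U.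
  by case: cr0 => cr; [exists (par p x y0)|exists (par q x y0)]; [exact: Up|exact: Uq].
have [|u u' v uU u'U /mapP[y]|a [b [a0 ab b1 hU hV]]] := @separating_window _ U V u0 u0U.
- by move=> u /UB[].
- rewrite mem_filter => /andP[/andP[yI /asboolP cr] _] ->.
  apply/negP => uv; case/negP: yI; apply: (crossing_in_disc hp picp cr).
  by apply: through_convex uv; [case: (UB u uU)|case: (UB u' u'U)].
exists a, b; split=> //; split=> y yI cr.
- exact/hU/Up.
- exact/hU/Uq.
- by apply/hV/mapP; exists y => //; rewrite mem_filter yI mem_enum andbT; apply/asboolP.
Qed.

Lemma disc_same_outside (enter leave : edge S -> R) :
  (forall x, x \in str -> enter x <= 0 /\ 1 <= leave x) ->
  (forall x, x \in thr -> window_for x (enter x) (leave x)) ->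
  (forall x, x \notin str ++ thr -> enter x = 0 /\ leave x = 0) ->
  same_outside enter leave inside (gauss_of hp) (gauss_of hq).
Proof.
move=> hs ht ho.
have nI x y : ~~ inside x y -> crosses p x y \/ crosses q x y ->
    x \notin str /\ y \notin str.
  move=> n cr; split; apply/negP => h; case/negP: n; apply/andP; split.
  - by rewrite mem_cat h.
  - by case: cr => cr; [exact: (strand_crossing hp picp h cr)|exact: (strand_crossing hq picq h cr)].
  - by case: cr => /crossesC cr;
      [exact: (strand_crossing hp picp h cr)|exact: (strand_crossing hq picq h cr)].
  - by rewrite mem_cat h.
have par01 r (hr : regular r i) x y : crosses r x y -> 0 < par r x y < 1.
  exact: par_in01 hr _ _.
have inn r (hr : regular r i) x y : (forall z, x \in thr -> z \in str ++ thr ->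
      crosses r x z -> enter x < par r x z < leave x) -> crosses r x y -> inside x y ->
      enter x <= par r x y < leave x.
  move=> hw cr /andP[xI yI]; have /andP[h0 h1] := par01 _ hr _ _ cr.
  move: xI; rewrite mem_cat => /orP[/hs[k1 k2]|xt].
    by rewrite (le_trans k1 (ltW h0)) (lt_le_trans h1).
  by have /andP[/ltW -> ->] := hw y xt yI cr.
split=> x y /=.
- move=> n; apply/asboolP/asboolP => cr.
    have [h1 h2] := nI x y n (or_introl cr); exact/same_crosses.
  have [h1 h2] := nI x y n (or_intror cr); exact/same_crosses.
- by move=> /asboolP cr n; have [h1 h2] := nI x y n (or_introl cr); exact: same_par.
- by [].
- by move=> /asboolP cr n; have [h1 h2] := nI x y n (or_introl cr); rewrite !same_dir.
- move=> /asboolP cr n; have [h1 h2] := nI x y n (or_introl cr).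
  have [xt|xt] := boolP (x \in thr).
    have [_ _] := ht x xt; apply=> //; apply: contra n => yI.
    by rewrite /inside yI mem_cat xt orbT.
  have [|e0 l0] := ho x; first by rewrite mem_cat negb_or h1 xt.
  by right; rewrite l0; case/andP: (par01 _ hp _ _ cr).
- by move=> /asboolP cr; apply: inn => // z xt; case: (ht x xt) => h _ _; exact: h.
- by move=> /asboolP cr; apply: inn => // z xt; case: (ht x xt) => _ h _; exact: h.
- by rewrite /inside andbC.
Qed.

End TwoPictures.
End Disc.

Lemma fpath_pred (T : eqType) (h : T -> T) x s y : fpath h x s -> y \in s ->
  exists2 z, z \in x :: s & h z = y.
Proof.
elim: s x => //= z s IH x /andP[/eqP xz zs]; rewrite inE => /orP[/eqP ->|ys].
  by exists x; rewrite ?inE ?eqxx.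
by have [w ws wy] := IH z zs ys; exists w; rewrite // inE ws orbT.
Qed.

Lemma strand_moved_pictures (R : realType) (S : skeleton) (p q : position R S) B e s thr :
  strand_moved p q B e s thr -> e \notin s -> next S (last e s) \notin s ->
  [/\ convex B, picture B (e :: s) thr p, picture B (e :: s) thr q &
   forall x, x \notin e :: s -> p x = q x /\ p (next S x) = q (next S x)].
Proof.
move=> [[cB fp] hs hsame hthr hoth] es ls.
have same x : x \notin e :: s -> p x = q x /\ p (next S x) = q (next S x).
  move=> xs; split; apply: hsame.
    by apply: contra xs => xs; rewrite inE xs orbT.
  apply/negP => nxs; have [z zs E] := fpath_pred fp nxs.
  by case/negP: xs; rewrite -(nextI E).
have thrs x : x \in thr -> x \notin e :: s.
  move=> xt; apply/negP => xs; have [nB _] := hthr x xt.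
  by apply/nB; have [h _] := hs x xs; exact/h/segment_start.
split=> //; split.
- by move=> x /hs[].
- by move=> x /hthr.
- by move=> x z h1 h2 h3 h4; case: (hoth x z h1 h2 h3 h4) => ->; eexists.
- by move=> x /hs[].
- by move=> x xt; have [<- <-] := same x (thrs x xt); exact: hthr.
- move=> x z h1 h2 h3 h4; have [|E|E] := hoth x z h1 h2 _ h4.
  + case: h3 => t t01 ->; exists t => //.
    by have [E1 E2] := same x h1; rewrite /point /dir E1 E2.
  + by exists e; rewrite E hsame.
  + by exists (next S (last e s)); rewrite E hsame.
Qed.

Lemma colorings_replacement (R : realType) (S : skeleton) (p q : position R S)
    (i j : layering S) (hp : regular p i) (hq : regular q j) (X : finType)
    (Q : disingquandle X) (N : rel (edge S)) (enter leave : edge S -> R) :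
  let G := gauss_of hp in let G' := gauss_of hq in
  same_outside enter leave N G G' ->
  (forall e, [/\ enter e <= 1, 0 <= leave e & enter e <= leave e]) ->
  (forall e, (1 < leave e) = (enter (next S e) < 0)) ->
  deterministic Q enter leave G -> deterministic Q enter leave G' ->
  simulates Q enter leave G G' -> simulates Q enter leave G' G ->
  #|colorings (Diagram hq) Q| = #|colorings (Diagram hp) Q|.
Proof.
move=> G G' so wo ju det det' sim sim'; apply/eqP; rewrite eqn_leq; apply/andP; split.
  exact: tangle_replacement (same_outsideC so) wo ju det' sim'.
exact: tangle_replacement so wo ju det sim.
Qed.

(** * The moves *)

Section KinkMove.
Variables (R : realType) (S : skeleton) (p q : position R S) (i : layering S).
Variables (hp : regular p i) (hq : regular q i) (X : finType) (Q : disingquandle X).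

Lemma colorings_RI B e1 e2 e3 :
  strand_moved p q B e1 [:: e2; e3] [::] -> i e1 e3 <> Sing ->
  #|colorings (Diagram hq) Q| = #|colorings (Diagram hp) Q|.
Proof.
move=> sm nS; have [[_ fp] _ _ _ _] := sm.
have [n1 n2] : next S e1 = e2 /\ next S e2 = e3.
  by case/andP: fp => /eqP h1 /andP[/eqP h2 _].
have d12 : e1 != e2 by rewrite -n1 eq_sym next_neq.
have d23 : e2 != e3 by rewrite -n2 eq_sym next_neq.
have d13 : e1 != e3 by rewrite -n2 -n1 eq_sym next_next.
have dist : uniq [:: e1; e2; e3] by rewrite /= !inE negb_or d12 d13 d23.
have n3 x : next S x = e2 -> x = e1 by rewrite -n1 => /nextI.
have n4 x : next S x = e3 -> x = e2 by rewrite -n2 => /nextI.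
have [||cB picp picq same] := strand_moved_pictures sm.
- by rewrite !inE negb_or d12 d13.
- rewrite /= !inE negb_or; apply/andP; split; apply/eqP.
    by move/n3/eqP; rewrite eq_sym (negbTE d13).
  by move/n4/eqP; rewrite eq_sym (negbTE d23).
have ks r (hr : regular r i) : picture B [:: e1; e2; e3] [::] r ->
    kink_state e1 e2 e3 (gauss_of hr).
  move=> pic; have mem x y : x \in [:: e1; e2; e3] -> crosses r x y ->
      [|| y == e1, y == e2 | y == e3].
    by move=> xs cr; have := strand_crossing hr pic xs cr; rewrite cats0 !inE.
  split=> //=.
  - move=> x /asboolP cr; have [/eqP c1 /eqP c2 /eqP c3 _] := cr.
    have := mem _ _ _ cr; rewrite !inE eqxx => /(_ isT) /or3P[] /eqP h //.
      by case: c1.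
    by case: c2; rewrite n1.
  - move=> x; apply/asboolP => cr; have [/eqP c1 /eqP c2 /eqP c3 _] := cr.
    have := mem _ _ _ cr; rewrite !inE eqxx orbT => /(_ isT) /or3P[] /eqP h.
    + by apply: c3; rewrite h n1.
    + by case: c1.
    + by apply: c2; rewrite h n2.
  - move=> x /asboolP cr; have [/eqP c1 /eqP c2 /eqP c3 _] := cr.
    have := mem _ _ _ cr; rewrite !inE eqxx !orbT => /(_ isT) /or3P[] /eqP h //.
      by case: c3; rewrite h n2.
    by case: c1.
have [d21 d31 d32] : [/\ e2 != e1, e3 != e1 & e3 != e2] by rewrite !(eq_sym e3) eq_sym.
apply: (@colorings_replacement _ _ _ _ _ _ hp hq _ Q (inside [:: e1; e2; e3] [::])
  (kink_enter R e1 e2 e3) (kink_leave R e1 e2 e3)).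
- apply: (disc_same_outside hp hq picp picq same).
  + move=> x; rewrite !inE /kink_enter /kink_leave /=.
    have [_ _|_] := eqVneq x e1; first by split=> /=; lra.
    have [_ _|_] := eqVneq x e2; first by split=> /=; lra.
    by have [_ _|] := eqVneq x e3; first by split=> /=; lra.
  + by [].
  + by move=> x xI; rewrite /kink_enter /kink_leave window_out.
- by move=> x; apply: window_bounds => /=; do ![split] => //; lra.
- move=> x; rewrite /kink_enter /kink_leave /=.
  have [->|x1] := eqVneq x e1.
    by rewrite n1 (negbTE d21) eqxx /=; apply/idP/idP => _; lra.
  have [->|x2] := eqVneq x e2.
    by rewrite n2 (negbTE d31) (negbTE d32) eqxx /=; apply/idP/idP => _; lra.
  have -> : (next S x == e2) = false by apply/eqP => /n3/eqP; rewrite (negbTE x1).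
  have -> : (next S x == e3) = false by apply/eqP => /n4/eqP; rewrite (negbTE x2).
  by case: (next S x == e1) => /=; case: eqP => _ /=; rewrite !ltxx // ltNge ler01.
- exact: (kink_deterministic dist n1 n2 (ks _ hp picp)).
- exact: (kink_deterministic dist n1 n2 (ks _ hq picq)).
- exact: (kink_simulates dist n1 n2 (ks _ hp picp) (ks _ hq picq)).
- exact: (kink_simulates dist n1 n2 (ks _ hq picq) (ks _ hp picp)).
Qed.

End KinkMove.

Section Sides.
Variables (R : realType) (S : skeleton) (r : position R S) (i : layering S).
Hypothesis reg : regular r i.
Implicit Types (x f g : edge S) (t s : R).

Lemma side_on f t : side r f (point r f t) = 0.
Proof. by rewrite /side /point /det2 !mxE; ring. Qed.

Lemma side_crossing x f t : crosses r x f ->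
  side r f (point r x t) = (t - par r x f) * det2 (dir r f) (dir r x).
Proof.
move=> cr; have := side_on f (par r f x); rewrite -(crosses_point reg cr).
rewrite !side_point => h; have -> : side r f (r x) =
  - (par r x f * det2 (dir r f) (dir r x)) by lra.
by ring.
Qed.

(** The end of [x] is between the two crossings, on one side of [f]; the strand
leaves this side as it entered it. *)
Lemma opposite_turns x f : crosses r x f -> crosses r (next S x) f ->
  (0 < det2 (dir r (next S x)) (dir r f)) = ~~ (0 < det2 (dir r x) (dir r f)).
Proof.
move=> c1 c2; have := side_crossing 1 c1; have := side_crossing 0 c2.
rewrite point0 point1 => -> E.
have d1 := crosses_det reg c1; have d2 := crosses_det reg c2.
have /andP[a0 a1] := par_in01 reg c1; have /andP[b0 b1] := par_in01 reg c2.
rewrite (det2C (dir r f)) oppr_eq0 in d1; rewrite (det2C (dir r f)) oppr_eq0 in d2.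
rewrite !(det2C (dir r f)) !oppr_gt0.
move: E d1 d2; set u := det2 _ (dir r x); set v := det2 _ (dir r (next S x)).
move: (par r x f) (par r (next S x) f) a0 a1 b0 b1 => a b a0 a1 b0 b1 E.
rewrite !neq_lt => /orP[un|up] /orP[vn|vp].
- by exfalso; nra.
- by rewrite un ltNge ltW.
- by rewrite vn ltNge ltW.
- by exfalso; nra.
Qed.

End Sides.

Section FingerMove.
Variables (R : realType) (S : skeleton) (p q : position R S) (i : layering S).
Variables (hp : regular p i) (hq : regular q i) (X : finType) (Q : disingquandle X).

Lemma colorings_RII B e1 e2 f :
  strand_moved p q B e1 [:: e2] [:: f] ->
  ~ crosses p e1 f -> ~ crosses p e2 f -> crosses q e1 f -> crosses q e2 f ->
  i e1 f = i e2 f -> i e1 f <> Sing ->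
  #|colorings (Diagram hq) Q| = #|colorings (Diagram hp) Q|.
Proof.
move=> sm np1 np2 cq1 cq2 i12 nS; have [[_ fp] _ _ _ _] := sm.
have n1 : next S e1 = e2 by case/andP: fp => /eqP.
have d12 : e1 != e2 by rewrite -n1 eq_sym next_neq.
have n3 x : next S x = e2 -> x = e1 by rewrite -n1 => /nextI.
have [||cB picp picq same] := strand_moved_pictures sm.
- by rewrite inE d12.
- by rewrite /= inE next_neq.
have fstr : f \notin [:: e1; e2] by apply: (through_notin picp); rewrite inE.
have [df1 df2] : f != e1 /\ f != e2 by move: fstr; rewrite !inE negb_or => /andP.
have dist : uniq [:: e1; e2; f].
  by rewrite /= !inE negb_or d12 !(eq_sym _ f) df1 df2.
have thr_in x y : x \in [:: f] -> y \in [:: f] -> crosses p x y ->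
    B (point p x (par p x y)).
  by rewrite !inE => /eqP -> /eqP -> [/eqP].
have [|a [b [a0 ab b1 win]]] := through_window cB hp hq picp picq same thr_in (mem_head f [::]).
  by exists e1; split; [rewrite !inE eqxx|right; exact: crossesC].
have wf : [/\ 0 <= a, a < b & b <= 1] by [].
have [w1 w2 w3] := win.
have memstr r (hr : regular r i) x y : picture B [:: e1; e2] [:: f] r ->
    x \in [:: e1; e2] -> crosses r x y -> y = f.
  move=> pic xs cr; have := strand_crossing hr pic xs cr; move: xs.
  have [/eqP c1 /eqP c2 /eqP c3 _] := cr.
  rewrite /= !inE => /orP[] /eqP E /or3P[] /eqP F //; exfalso.
  - by apply: c1; rewrite E F.
  - by apply: c2; rewrite E F.
  - by apply: c3; rewrite E F.
  - by apply: c1; rewrite E F.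
have as_ : apart_state e1 e2 f a b (gauss_of hp).
  split=> /=.
  - move=> x; apply/asboolP => cr.
    by have E := memstr _ hp _ _ picp (mem_head _ _) cr; subst x.
  - move=> x; apply/asboolP => cr.
    have E : x = f by apply: (memstr _ hp _ _ picp _ cr); rewrite !inE eqxx orbT.
    by subst x.
  - move=> x /asboolP cr; apply/negP => /andP[ax xb].
    have [xI|xI] := boolP (x \in [:: e1; e2; f]); last first.
      by have [] := w3 x xI cr; rewrite ltNge ?ax // (ltW xb).
    move: xI; rewrite !inE => /or3P[] /eqP E; subst x.
    + exact/np1/crossesC.
    + exact/np2/crossesC.
    + by case: cr => /eqP.
have fs : finger_state e1 e2 f a b (i e1 f) (0 < det2 (dir q e1) (dir q f)) (gauss_of hq).
  split=> /=; try exact/asboolP.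
  - by move=> x /asboolP cr; exact: (memstr _ hq _ _ picq (mem_head _ _) cr).
  - by move=> x /asboolP cr; apply: (memstr _ hq _ _ picq _ cr); rewrite !inE eqxx orbT.
  - move=> x /asboolP cr /andP[ax xb].
    have [xI|xI] := boolP (x \in [:: e1; e2; f]).
      by move: xI; rewrite !inE => /or3P[] /eqP E; [left|right|case: cr => /eqP; rewrite E].
    have xstr : x \notin [:: e1; e2].
      by apply: contra xI; rewrite !inE => /orP[] ->; rewrite ?orbT.
    have := w3 x xI (proj2 (same_crosses same fstr xstr) cr).
    by rewrite (same_par same fstr xstr) => -[]; rewrite ltNge ?ax // (ltW xb).
  - by split; apply: w2; rewrite ?inE ?eqxx ?orbT //; exact: crossesC.
  - by rewrite i12.
  - by split=> //; rewrite -{1}n1; apply: (opposite_turns hq cq1); rewrite n1.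
apply: (@colorings_replacement _ _ _ _ _ _ hp hq _ Q (inside [:: e1; e2] [:: f])
  (finger_enter e1 e2 f a b) (finger_leave e1 e2 f a b)).
- apply: (disc_same_outside hp hq picp picq same).
  + move=> x; rewrite !inE /finger_enter /finger_leave /=.
    have [_ _|_] := eqVneq x e1; first by split=> /=; lra.
    by have [_ _|_] := eqVneq x e2; first by split=> /=; lra.
  + move=> x; rewrite inE => /eqP ->.
    by rewrite /finger_enter /finger_leave /= (negbTE df1) (negbTE df2) eqxx.
  + by move=> x xI; rewrite /finger_enter /finger_leave window_out.
- by move=> x; apply: window_bounds => /=; do ![split] => //; lra.
- by move=> x; apply: strand_junction.
- exact: (apart_deterministic dist n1 wf as_).
- exact: (finger_deterministic dist n1 wf nS fs).
- exact: (finger_out dist n1 wf nS as_ fs).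
- exact: (finger_in dist n1 wf nS fs as_).
Qed.

End FingerMove.

Section SlideGeometry.
Variables (R : realType) (S : skeleton) (r : position R S) (i : layering S).
Variables (B : set 'rV[R]_2) (e1 e2 : edge S) (thr : seq (edge S)).
Hypotheses (reg : regular r i) (convexB : convex B).
Hypothesis pic : picture B [:: e1; e2] thr r.
Hypothesis next1 : next S e1 = e2.
Implicit Types (f g x : edge S) (s t : R).

Definition traverses f : Prop :=
  f \in thr /\ dir r f != 0 /\ exists2 t, 0 <= t <= 1 & B (point r f t).

(** An edge that traverses a convex disc contains the part of its line in it, since
otherwise one of its ends would be in the disc. *)
Lemma on_line_in_disc f z : traverses f -> B z -> side r f z = 0 -> segment r f z.
Proof.
move=> [ft [dn [t0 /andP[t00 t01] Bt0]]] Bz h.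
have [n0 n1] := pic_through pic ft.
have [t zt] := side0 dn h; exists t => //; rewrite zt in Bz.
apply/andP; split; rewrite leNgt; apply/negP => lt.
  apply: n0; rewrite -(point0 r f); apply: (through_convex convexB Bz Bt0).
  by rewrite (ltW lt).
apply: n1; rewrite -(point1 r f); apply: (through_convex convexB Bt0 Bz).
by rewrite (ltW lt) t01.
Qed.

Lemma strand_in x t : x \in [:: e1; e2] -> 0 <= t <= 1 -> B (point r x t).
Proof. by move=> xs t01; apply: (pic_strand pic xs); exists t. Qed.

Lemma strand_nonzero x f t : x \in [:: e1; e2] -> traverses f ->
  ~ crosses r x f -> 0 <= t <= 1 -> side r f (point r x t) != 0.
Proof.
move=> xs tf nc t01; apply/eqP => h; apply: nc.
have [ft _] := tf; have [n0 n1] := pic_through pic ft.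
have fs := through_notin pic ft.
split.
- by apply: contraNneq fs => <-.
- apply/eqP => E; apply: n0; rewrite -E.
  exact/(pic_strand pic xs)/segment_end.
- apply/eqP => E; apply: n1; rewrite E.
  exact/(pic_strand pic xs)/segment_start.
- exists (point r x t); split; first by exists t.
  by apply: on_line_in_disc h => //; exact: strand_in.
Qed.

Lemma strand_same_side x f s t : x \in [:: e1; e2] -> traverses f ->
  ~ crosses r x f -> 0 <= s <= 1 -> 0 <= t <= 1 ->
  0 < side r f (point r x s) -> 0 < side r f (point r x t).
Proof.
move=> xs tf nc s01 t01 sp; rewrite ltNge; apply/negP => tn.
have nz u : 0 <= u <= 1 -> side r f (point r x u) != 0.
  exact: strand_nonzero.
have tn0 := nz t t01; move: sp tn tn0; rewrite !side_point.
set a := side r f (r x); set b := det2 _ _ => sp tn tn0.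
pose l := (a + s * b) / ((a + s * b) - (a + t * b)).
have D : 0 < (a + s * b) - (a + t * b) by lra.
have lD : l * ((a + s * b) - (a + t * b)) = a + s * b by rewrite /l divfK // gt_eqF.
have l0 : 0 <= l by rewrite divr_ge0 // ltW.
have l1 : l <= 1 by rewrite ler_pdivrMr // mul1r; lra.
have /eqP[] : side r f (point r x (s + l * (t - s))) != 0.
  by apply: nz; case/andP: s01; case/andP: t01 => *; apply/andP; split; nra.
by rewrite side_point -/a -/b; move: lD; clear -l; move: l => l lD; lra.
Qed.

Lemma strand_side_eq x f s t : x \in [:: e1; e2] -> traverses f ->
  ~ crosses r x f -> 0 <= s <= 1 -> 0 <= t <= 1 ->
  (0 < side r f (point r x s)) = (0 < side r f (point r x t)).
Proof. by move=> *; apply/idP/idP; exact: strand_same_side. Qed.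

Lemma sign_crossing x f t : crosses r x f -> t != par r x f ->
  (0 < side r f (point r x t)) = ((t < par r x f) == (0 < det2 (dir r x) (dir r f))).
Proof.
move=> cr tn; rewrite (side_crossing reg) // (det2C (dir r x)).
have := crosses_det reg cr; move: (det2 (dir r x) (dir r f)) => D dn.
have [lt|gt|E] := ltgtP t (par r x f); last by rewrite E eqxx in tn.
  by rewrite nmulr_rgt0 ?subr_lt0 // oppr_lt0; case: ltP.
rewrite pmulr_rgt0 ?subr_gt0 // oppr_gt0 /=.
by move: dn; case: ltgtP.
Qed.

Local Notation part := (part e1 e2).

Let part_in k : part k \in [:: e1; e2].
Proof. by case: k; rewrite !inE eqxx ?orbT. Qed.

(** The strand goes across [f] from the side of its initial vertex, so that its turn
does not depend on the picture. *)
Lemma strand_turn k f : traverses f -> crosses r (part k) f ->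
  ~ crosses r (part (~~ k)) f ->
  (0 < det2 (dir r (part k)) (dir r f)) = (0 < side r f (r e1)).
Proof.
move=> tf cr ncr; have /andP[p0 p1] := par_in01 reg cr.
have n0 : 0 != par r (part k) f by rewrite lt_eqF.
have := sign_crossing cr n0; rewrite p0 [true == _]eq_sym eqb_id => <-.
case: k cr ncr {p0 p1 n0} => cr ncr; last by rewrite point0.
rewrite point0 /= -next1 -point1 -(point0 r e1).
by apply: strand_side_eq => //; rewrite ?inE ?eqxx ?lexx ?ler01.
Qed.

(** The crossing with [f] is before the crossing with [g] if it is still on the side
of [g] on which the strand starts. *)
Lemma strand_order kf kg f g : traverses f -> traverses g -> f != g ->
  crosses r (part kf) f -> ~ crosses r (part (~~ kf)) f ->
  crosses r (part kg) g -> ~ crosses r (part (~~ kg)) g ->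
  let Tf := kf%:R + par r (part kf) f in let Tg := kg%:R + par r (part kg) g in
  Tf != Tg /\
  (0 < side r g (point r (part kf) (par r (part kf) f))) =
  ((Tf < Tg) == (0 < side r g (r e1))).
Proof.
move=> tf tg fg cf ncf cg ncg Tf Tg.
have /andP[p0 p1] := par_in01 reg cf; have /andP[q0 q1] := par_in01 reg cg.
have turn := strand_turn tg cg ncg.
have p01 : 0 <= par r (part kf) f <= 1 by rewrite !ltW.
have [E|E] := eqVneq kf kg.
  subst kg; have pn : par r (part kf) f != par r (part kf) g.
    by apply: contra fg => /eqP /(par_inj reg cf cg) ->.
  split; first by rewrite /Tf /Tg (inj_eq (addrI _)).
  by rewrite sign_crossing // turn /Tf /Tg ltrD2l.
have Ek : kg = ~~ kf by case: (kf) (kg) E => -[].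
have ncf' : ~ crosses r (part kf) g by move: ncg; rewrite Ek negbK.
subst kg; move: cf cg p0 p1 p01 q0 q1 turn ncf'; rewrite /Tf /Tg.
case: (kf) => /= cf cg p0 p1 p01 q0 q1 turn ncf'.
  have -> : (1 + par r e2 f < 0 + par r e1 g) = false by apply/negbTE; lra.
  split; first by apply/eqP; lra.
  rewrite (strand_side_eq (part_in true) tg ncf' p01 (t := 0)) ?lexx ?ler01 //.
  have u1 : 1 != par r e1 g by rewrite gt_eqF.
  rewrite point0 /= -next1 -point1 sign_crossing //.
  by rewrite [1 < _]ltNge (ltW q1) turn.
have -> : (0 + par r e1 f < 1 + par r e2 g) by lra.
split; first by apply/eqP; lra.
by rewrite (strand_side_eq (part_in false) tg ncf' p01 (t := 0)) ?lexx ?ler01 // point0.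
Qed.

(** The order in which the strand meets [f] and [g] decides on which side of their
crossing it passes. *)
Lemma through_order kf kg f g : traverses f -> traverses g -> crosses r f g ->
  crosses r (part kf) f -> ~ crosses r (part (~~ kf)) f ->
  crosses r (part kg) g -> ~ crosses r (part (~~ kg)) g ->
  let w := kf%:R + par r (part kf) f < kg%:R + par r (part kg) g in
  let bf := par r f (part kf) < par r f g in
  par r f (part kf) != par r f g /\
  bf = ((w == (0 < side r g (r e1))) == (0 < det2 (dir r f) (dir r g))).
Proof.
move=> tf tg cfg cf ncf cg ncg w bf.
have fg : f != g by case: cfg.
have pn : par r f (part kf) != par r f g.
  apply/eqP => E; have [gt _] := tg; have := through_notin pic gt.
  by rewrite -(par_inj reg (crossesC cf) cfg E) part_in.
split=> //.
have [_ E] := strand_order tf tg fg cf ncf cg ncg; rewrite -/w in E.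
move: E; rewrite (crosses_point reg cf) sign_crossing // -/bf => <-.
by case: (bf) (0 < det2 _ _) => -[].
Qed.

End SlideGeometry.

Section SlideMove.
Variables (R : realType) (S : skeleton) (p q : position R S) (i : layering S).
Variables (hp : regular p i) (hq : regular q i) (X : finType) (Q : disingquandle X).

Lemma slide_state_of (r : position R S) (hr : regular r i) B e1 e2 f g v af bf ag bg :
  convex B -> picture B [:: e1; e2] [:: f; g] r -> next S e1 = e2 ->
  crosses r f g -> B (point r f (par r f g)) ->
  (forall x, x \in [:: f; g] -> (crosses r e1 x <-> ~ crosses r e2 x)) ->
  [/\ i e1 f = v, i e2 f = v, i e1 g = v & i e2 g = v] ->
  (forall y, y \in [:: e1; e2; f; g] -> crosses r f y -> af < par r f y < bf) ->
  (forall y, y \in [:: e1; e2; f; g] -> crosses r g y -> ag < par r g y < bg) ->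
  (forall y, y \notin [:: e1; e2; f; g] -> crosses r f y ->
     par r f y < af \/ bf < par r f y) ->
  (forall y, y \notin [:: e1; e2; f; g] -> crosses r g y ->
     par r g y < ag \/ bg < par r g y) ->
  exists kf kg w, slide_state e1 e2 f g af bf ag bg v (i f g)
    (0 < side r f (r e1)) (0 < side r g (r e1)) (0 < det2 (dir r f) (dir r g))
    (gauss_of hr) kf kg w.
Proof.
move=> cB pic n1 cfg zB xor [l1 l2 l3 l4] wf wg of_ og.
have cgf := crossesC cfg.
have tf : traverses r B [:: f; g] f.
  split; first by rewrite inE eqxx.
  by split; [exact: (dir_neq0 hr cfg)|exists (par r f g) => //; exact: par_in01W hr _ _ cfg].
have tg : traverses r B [:: f; g] g.
  split; first by rewrite !inE eqxx orbT.
  split; first exact: (dir_neq0 hr cgf).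
  exists (par r g f); first exact: par_in01W hr _ _ cgf.
  by rewrite -(crosses_point hr cfg).
have fstr := through_notin pic (proj1 tf); have gstr := through_notin pic (proj1 tg).
have [f1 f2] : f != e1 /\ f != e2 by move: fstr; rewrite !inE negb_or => /andP.
have [g1 g2] : g != e1 /\ g != e2 by move: gstr; rewrite !inE negb_or => /andP.
have choose x : x \in [:: f; g] -> exists k, crosses r (part e1 e2 k) x /\
    ~ crosses r (part e1 e2 (~~ k)) x.
  move=> /xor [h1 h2]; have [c2|nc2] := pselect (crosses r e2 x).
    by exists true; split=> // /h1.
  by exists false; split=> //; exact: h2.
have [kf [cf ncf]] := choose f (proj1 tf); have [kg [cg ncg]] := choose g (proj1 tg).
exists kf, kg, (kf%:R + par r (part e1 e2 kf) f < kg%:R + par r (part e1 e2 kg) g).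
have [pnf Ef] := through_order hr cB pic n1 tf tg cfg cf ncf cg ncg.
have [png Eg] := through_order hr cB pic n1 tg tf cgf cg ncg cf ncf.
have fg : f != g by case: cfg.
have [nT _] := strand_order hr cB pic n1 tf tg fg cf ncf cg ncg.
move: Ef Eg; set Tf := kf%:R + _; set Tg := kg%:R + _; set w := Tf < Tg => Ef Eg.
have wE : (Tg < Tf) = ~~ w by rewrite -leNgt le_eqVlt eq_sym (negbTE nT).
have dE : (0 < det2 (dir r g) (dir r f)) = ~~ (0 < det2 (dir r f) (dir r g)).
  exact: (@turnC _ _ (gauss_of hr) f g (asboolT cfg)).
have mem k : part e1 e2 k \in [:: e1; e2; f; g].
  by case: k; rewrite !inE eqxx ?orbT.
have [mf mg] : f \in [:: e1; e2; f; g] /\ g \in [:: e1; e2; f; g].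
  by rewrite !inE !eqxx !orbT.
have mstr k : part e1 e2 k \in [:: e1; e2] by case: k; rewrite !inE eqxx ?orbT.
have crf := crossesC cf; have crg := crossesC cg.
split=> /=; try exact/asboolP.
- move=> k x /asboolP cr.
  have := strand_crossing hr pic (mstr k) cr; rewrite !inE => /or4P[] /eqP E; subst x.
  + exfalso; case: k cr => -[/eqP c1 _ /eqP c3 _]; first by apply: c3; rewrite n1.
    by apply: c1.
  + exfalso; case: k cr => -[/eqP c1 /eqP c2 _ _]; first by apply: c1.
    by apply: c2; rewrite n1.
  + left; split=> //; case: (kf) (k) ncf cr => -[] //= h1 h2; by case: h1.
  + right; split=> //; case: (kg) (k) ncg cr => -[] //= h1 h2; by case: h1.
- move=> x /asboolP cr /andP[ax xb].
  have [xI|xI] := boolP (x \in [:: e1; e2; f; g]); last first.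
    by case: (of_ x xI cr); rewrite ltNge ?ax // (ltW xb).
  move: xI; rewrite !inE => /or4P[] /eqP E; subst x.
  + by left; case: (kf) ncf => //= h; case: h; exact: crossesC.
  + by left; case: (kf) ncf => //= h; case: h; exact: crossesC.
  + by case: cr => /eqP.
  + by right.
- move=> x /asboolP cr /andP[ax xb].
  have [xI|xI] := boolP (x \in [:: e1; e2; f; g]); last first.
    by case: (og x xI cr); rewrite ltNge ?ax // (ltW xb).
  move: xI; rewrite !inE => /or4P[] /eqP E; subst x.
  + by left; case: (kg) ncg => //= h; case: h; exact: crossesC.
  + by left; case: (kg) ncg => //= h; case: h; exact: crossesC.
  + by right.
  + by case: cr => /eqP.
- by split; apply: wf.
- by split; apply: wg.
- by case: (kf) (kg) => -[].
- by rewrite (strand_turn hr cB pic n1 tf cf ncf) (strand_turn hr cB pic n1 tg cg ncg).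
- rewrite /ordered -/Tf -/Tg -/w; case: ifP => // /negbT; rewrite -wE; exact.
- rewrite /ordered -Ef; case: ifP => // /negbT; rewrite -leNgt le_eqVlt eq_sym (negbTE pnf).
  exact.
- have -> : ((w == (0 < side r f (r e1))) == (0 < det2 (dir r f) (dir r g))) =
     (par r g (part e1 e2 kg) < par r g f).
    by rewrite Eg wE dE; case: (w) (0 < side _ _ _) (0 < det2 _ _) => -[] [].
  rewrite /ordered; case: ifP => // /negbT; rewrite -leNgt le_eqVlt eq_sym (negbTE png).
  exact.
Qed.

Lemma colorings_slide B e1 e2 f g v : mixed_distributive Q ->
  slides p q i B e1 e2 f g v -> v = Over \/ v = Under /\ i f g = Sing ->
  #|colorings (Diagram hq) Q| = #|colorings (Diagram hp) Q|.
Proof.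
move=> mix [sm [[z [zf zg zB]] cfg] xor lev] hv; have [[_ fp] _ _ _ _] := sm.
have vS : v <> Sing by case: hv => [->|[->]].
have n1 : next S e1 = e2 by case/andP: fp => /eqP.
have d12 : e1 != e2 by rewrite -n1 eq_sym next_neq.
have n3 x : next S x = e2 -> x = e1 by rewrite -n1 => /nextI.
have [||cB picp picq same] := strand_moved_pictures sm.
- by rewrite inE d12.
- by rewrite /= inE next_neq.
have fstr : f \notin [:: e1; e2] by apply: (through_notin picp); rewrite !inE eqxx.
have gstr : g \notin [:: e1; e2] by apply: (through_notin picp); rewrite !inE eqxx orbT.
have [f1 f2] : f != e1 /\ f != e2 by move: fstr; rewrite !inE negb_or => /andP.
have [g1 g2] : g != e1 /\ g != e2 by move: gstr; rewrite !inE negb_or => /andP.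
have fg : f != g by case: cfg.
have dist : uniq [:: e1; e2; f; g].
  by rewrite /= !inE !negb_or d12 !(eq_sym _ f) !(eq_sym _ g) f1 f2 g1 g2 eq_sym fg.
have cgf := crossesC cfg.
have zB' : B (point p f (par p f g)).
  case: zf zg => t t01 zt [u u01 zu]; rewrite -(par_hits hp cfg (u := u) (t := t)) -?zt //.
have thr_in x y : x \in [:: f; g] -> y \in [:: f; g] -> crosses p x y ->
    B (point p x (par p x y)).
  rewrite !inE => /orP[] /eqP -> /orP[] /eqP -> cr //; try by case: cr => /eqP.
  by rewrite -(crosses_point hp cfg).
have win x : x \in [:: f; g] ->
    exists a b, [/\ 0 <= a, a < b, b <= 1 & window_for [:: e1; e2] [:: f; g] p q x a b].
  move=> xt; apply: (through_window cB hp hq picp picq same thr_in xt).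
  move: xt; rewrite !inE => /orP[] /eqP ->; [exists g|exists f];
    by rewrite !inE eqxx !orbT; split=> //; left.
have [af [bf [af0 afb bf1 wf]]] := win f (mem_head _ _).
have [ag [bg [ag0 agb bg1 wg]]] := win g (mem_last f [:: g]).
have [wf1 wf2 wf3] := wf; have [wg1 wg2 wg3] := wg.
have far x (a b : R) y : x \in [:: f; g] ->
    (forall y, y \notin [:: e1; e2; f; g] -> crosses p x y -> par p x y < a \/ b < par p x y) ->
    y \notin [:: e1; e2; f; g] -> crosses q x y -> par q x y < a \/ b < par q x y.
  move=> xt h yI cr; have xs := through_notin picp xt.
  have ys : y \notin [:: e1; e2].
    by apply: contra yI; rewrite !inE => /orP[] ->; rewrite ?orbT.
  by rewrite -(same_par same) //; apply: h => //; apply/(same_crosses same).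
have [kf [kg [w st]]] := slide_state_of hp cB picp n1 cfg zB'
  (fun x xt => proj1 (xor x xt)) lev wf1 wg1 wf3 wg3.
have cfg' : crosses q f g by apply/(same_crosses same).
have zB'' : B (point q f (par q f g)).
  by rewrite -(same_par same) // -(same_point same).
have [kf' [kg' [w' st']]] := slide_state_of hq cB picq n1 cfg' zB''
  (fun x xt => proj2 (xor x xt)) lev wf2 wg2
  (fun y => @far f af bf y (mem_head _ _) wf3)
  (fun y => @far g ag bg y (mem_last f [:: g]) wg3).
have pe1 : p e1 = q e1 by case: sm => _ _ h _ _; apply: h; rewrite inE d12.
have sideE x : x \notin [:: e1; e2] -> side q x (q e1) = side p x (p e1).
  by move=> xs; rewrite /side -pe1 (same_dir same xs); have [-> _] := same x xs.
rewrite (sideE f) // (sideE g) // -(same_dir same fstr) -(same_dir same gstr) in st'.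
have wf' : 0 <= af /\ bf <= 1 by []. have wg' : 0 <= ag /\ bg <= 1 by [].
apply: (@colorings_replacement _ _ _ _ _ _ hp hq _ Q (inside [:: e1; e2] [:: f; g])
  (slide_enter e1 e2 f g af bf ag bg) (slide_leave e1 e2 f g af bf ag bg)).
- apply: (disc_same_outside hp hq picp picq same).
  + move=> x; rewrite !inE /slide_enter /slide_leave /=.
    have [_ _|_] := eqVneq x e1; first by split=> /=; lra.
    by have [_ _|_] := eqVneq x e2; first by split=> /=; lra.
  + move=> x; rewrite !inE /slide_enter /slide_leave => /orP[] /eqP ->; rewrite /=.
      by rewrite (negbTE f1) (negbTE f2) eqxx.
    by rewrite (negbTE g1) (negbTE g2) eq_sym (negbTE fg) eqxx.
  + by move=> x xI; rewrite /slide_enter /slide_leave window_out.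
- by move=> x; apply: window_bounds => /=; do ![split] => //; lra.
- by move=> x; apply: strand_junction.
- exact: (slide_deterministic dist n1 wf' wg' vS st).
- exact: (slide_deterministic dist n1 wf' wg' vS st').
- exact: (slide_simulates dist n1 wf' wg' mix hv st st').
- exact: (slide_simulates dist n1 wf' wg' mix hv st' st).
Qed.

End SlideMove.

Section Bigon.
Variables (R : realType) (B : set 'rV[R]_2).
Hypothesis convexB : convex B.
Implicit Types (z a b w : 'rV[R]_2).

Lemma convex_triangle z a b (s t : R) : B z -> B (z + a) -> B (z + b) ->
  0 <= s -> 0 <= t -> s + t <= 1 -> B (z + s *: a + t *: b).
Proof.
move=> Bz Ba Bb s0 t0 st1.
have [s1|sn1] := eqVneq s 1.
  have -> : t = 0 by lra.
  by rewrite s1 scale1r scale0r addr0.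
have u0 : 0 < 1 - s by rewrite subr_gt0 lt_neqAle sn1; lra.
have Bc : B (z + (t / (1 - s)) *: b).
  have -> : z + (t / (1 - s)) *: b = z + (t / (1 - s)) *: ((z + b) - z).
    by rewrite [z + b]addrC addrK.
  by apply: convexB => //; rewrite divr_ge0 ?(ltW u0) //= ler_pdivrMr // mul1r; lra.
have -> : z + s *: a + t *: b = (z + (t / (1 - s)) *: b) +
    s *: ((z + a) - (z + (t / (1 - s)) *: b)).
  by apply: row2P; rewrite !mxE; field; rewrite gt_eqF.
by apply: convexB => //; lra.
Qed.

Lemma convex_between z w (s t : R) : B (z + s *: w) -> B z -> 0 <= t <= s ->
  B (z + t *: w).
Proof.
move=> Bs Bz /andP[t0 ts]; have [s0|sn0] := eqVneq s 0.
  have -> : t = 0 by lra.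
  by rewrite scale0r addr0.
have sp : 0 < s by rewrite lt_neqAle eq_sym sn0; lra.
have -> : z + t *: w = z + (t / s) *: ((z + s *: w) - z).
  by apply: row2P; rewrite !mxE; field.
by apply: convexB => //; rewrite divr_ge0 ?(ltW sp) //= ler_pdivrMr // mul1r.
Qed.

Lemma lerp_in (t rho m : R) : 0 < t -> t < 1 -> rho * (1 - t) <= t ->
  - rho <= m <= 1 -> 0 <= t + m * (1 - t) <= 1.
Proof. by move=> *; apply/andP; split; nra. Qed.

(** Two strands leave [z] along [a] and [b] and meet again at [w].  If [w] were on
the same side of the line through [z + a] and [z + b] as [z], then [w] would be
inside the triangle, or [z] inside the triangle formed with [w], or a strand would
cross the other one; as the strands have to leave the disc, they would cross a
third time. *)
Lemma bigon_corner z a b w (al be l rho : R) :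
  w = z + al *: a + be *: b -> al + be < 1 -> 1 < l -> 0 < rho ->
  B z -> B (z + a) -> B (z + b) -> B w ->
  ~ B (z + a + l *: (w - (z + a))) -> ~ B (z - rho *: a) ->
  (forall k m : R, 0 <= k <= l -> 0 <= m <= 1 ->
     z + a + k *: (w - (z + a)) <> z + m *: b) ->
  (forall k m : R, 0 <= k <= 1 -> - rho <= m <= 1 ->
     z + b + k *: (w - (z + b)) <> z + m *: a) -> False.
Proof.
move=> wE ab1 l1 rho0 Bz Ba Bb Bw nBl nBr nm1 nm2.
have E1 k : z + a + k *: (w - (z + a)) = z + (1 - k * (1 - al)) *: a + (k * be) *: b.
  by rewrite wE; apply: row2P; rewrite !mxE; ring.
have E2 k : z + b + k *: (w - (z + b)) = z + (k * al) *: a + (1 - k * (1 - be)) *: b.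
  by rewrite wE; apply: row2P; rewrite !mxE; ring.
clear wE; have [al0|al0] := ltP 0 al; last first.
  have [be0|be0] := leP 0 be.
    have n : 1 - al != 0 by lra.
    have k0 : 0 <= (1 - al)^-1 <= 1.
      by rewrite invr_ge0 invf_le1; lra.
    apply: (nm1 (1 - al)^-1 ((1 - al)^-1 * be)).
    - by case/andP: k0 => -> /le_trans -> //; exact: ltW.
    - case/andP: k0 => k0 k1; rewrite mulr_ge0 //= mulrC ler_pdivrMr; lra.
    - by rewrite E1 mulVf // subrr scale0r addr0.
  have n : 1 - be != 0 by lra.
  have /andP[k0 k1] : 0 <= (1 - be)^-1 <= 1 by rewrite invr_ge0 invf_le1; lra.
  pose m := (1 - be)^-1 * al.
  have m0 : m <= 0 by rewrite /m; nra.
  have Em : z + b + (1 - be)^-1 *: (w - (z + b)) = z + m *: a.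
    by rewrite E2 mulVf // subrr scale0r addr0.
  have Bm : B (z + m *: a).
    by rewrite -Em; apply: convexB => //; rewrite k0 k1.
  have [rm|mr] := leP (- rho) m.
    by apply: (nm2 (1 - be)^-1 m) => //; lra.
  (* The first strand starts between [z] and the point where the other strand meets
     its line. *)
  apply: nBr; have -> : z - rho *: a = z + rho *: - a by rewrite scalerN.
  apply: (@convex_between _ _ (- m)) => //; last by lra.
  by rewrite scalerN scaleNr opprK.
have [be0|be0] := leP be 0.
  have n : 1 - be != 0 by lra.
  have /andP[k0 k1] : 0 <= (1 - be)^-1 <= 1 by rewrite invr_ge0 invf_le1; lra.
  apply: (nm2 (1 - be)^-1 ((1 - be)^-1 * al)).
  - by rewrite k0 k1.
  - have : 0 <= (1 - be)^-1 * al by rewrite mulr_ge0 // ltW.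
    have : (1 - be)^-1 * al <= 1 by rewrite mulrC ler_pdivrMr; lra.
    lra.
  - by rewrite E2 mulVf // subrr scale0r addr0.
have n : 0 < 1 - al by lra.
have [kl|lk] := leP (1 - al)^-1 l.
  have k0 : 0 <= (1 - al)^-1 by rewrite invr_ge0 ltW.
  apply: (nm1 (1 - al)^-1 ((1 - al)^-1 * be)).
  - by rewrite k0 kl.
  - by rewrite mulr_ge0 ?(ltW be0) //= mulrC ler_pdivrMr; lra.
  - by rewrite E1 mulVf ?gt_eqF // subrr scale0r addr0.
(* [w] is in the triangle, and the strand ends in it. *)
apply: nBl; rewrite E1.
have h : l * (1 - al) < 1 by rewrite -ltr_pdivlMr // div1r.
by apply: convex_triangle => //; nra.
Qed.

End Bigon.

Section TwistMove.
Variables (R : realType) (S : skeleton) (p : position R S) (i j : layering S).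
Variables (hp : regular p i) (hq : regular p j) (X : finType) (Q : disingquandle X).
Variables (B : set 'rV[R]_2) (e1 e2 f1 f2 : edge S).
Hypotheses (next_e : next S e1 = e2) (next_f : next S f1 = f2) (convexB : convex B).
Hypotheses (c1 : crosses p e1 f1) (c2 : crosses p e2 f2).
Hypotheses (n12 : ~ crosses p e1 f2) (n21 : ~ crosses p e2 f1).
Hypothesis B1 : forall z, segment p e1 z -> segment p f1 z -> B z.
Hypothesis B2 : forall z, segment p e2 z -> segment p f2 z -> B z.
Hypotheses (Be : B (p e2)) (Bf : B (p f2)).
Hypothesis nB : [/\ ~ B (p e1), ~ B (p f1), ~ B (p (next S e2)) & ~ B (p (next S f2))].
Hypothesis others : forall x z, x \notin [:: e1; e2; f1; f2] -> segment p x z -> ~ B z.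

Let e21 : e2 != f1.
Proof. by apply/eqP => E; case: c1 => _ /eqP + _ _; rewrite next_e. Qed.

Let e12 : e1 != f2.
Proof. by apply/eqP => E; case: c1 => _ _ /eqP + _; rewrite next_f E. Qed.

Lemma no_meet_e2f1 z : B z -> segment p e2 z -> segment p f1 z -> False.
Proof.
move=> Bz se sf; have [nB1 nB2 nB3 nB4] := nB.
have [E|E] := eqVneq (next S e2) f1.
  by rewrite -E in sf; apply: nB3; rewrite -(adjacent_meet hp se sf).
apply: n21; split=> //; last by exists z.
by rewrite next_f; case: c2 => h _ _ _; rewrite eq_sym.
Qed.

Lemma no_meet_e1f2 z : B z -> segment p e1 z -> segment p f2 z -> False.
Proof.
move=> Bz se sf; have [nB1 nB2 nB3 nB4] := nB.
have [E|E] := eqVneq (next S f2) e1.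
  by rewrite -E in se; apply: nB4; rewrite -(adjacent_meet hp sf se).
apply: n12; split=> //; last by exists z.
by rewrite next_e; case: c2.
Qed.

Let z1 := point p e1 (par p e1 f1).
Let z2 := point p e2 (par p e2 f2).

Let Bz1 : B z1.
Proof. by have [h1 h2] := segment_crossing hp c1; apply: B1. Qed.

Let Bz2 : B z2.
Proof. by have [h1 h2] := segment_crossing hp c2; apply: B2. Qed.

(** At its second corner the bigon is closed, and the strands have exchanged their
sides. *)
Lemma bigon_turns :
  (0 < det2 (dir p e2) (dir p f2)) = ~~ (0 < det2 (dir p e1) (dir p f1)).
Proof.
have /andP[t0 t1] := par_in01 hp c1; have /andP[s0 s1] := par_in01 hp (crossesC c1).
have /andP[u0 u1] := par_in01 hp c2; have /andP[v0 v1] := par_in01 hp (crossesC c2).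
have d1 := crosses_det hp c1; have d2 := crosses_det hp c2.
have z1f : z1 = point p f1 (par p f1 e1) by rewrite /z1 (crosses_point hp c1).
have z2f : z2 = point p f2 (par p f2 e2) by rewrite /z2 (crosses_point hp c2).
move: t0 t1 s0 s1 u0 u1 v0 v1 z1f z2f Bz1 Bz2; rewrite /z1 /z2.
set t := par p e1 f1; set s := par p f1 e1; set u := par p e2 f2; set v := par p f2 e2.
set z := point p e1 t; set w := point p e2 u => t0 t1 s0 s1 u0 u1 v0 v1 zf wf Bz Bw.
pose a := (1 - t) *: dir p e1; pose b := (1 - s) *: dir p f1.
have za : z + a = p e2.
  by rewrite /z /a /point -next_e /dir; apply: row2P; rewrite !mxE; ring.
have zb : z + b = p f2.
  by rewrite zf /b /point -next_f /dir; apply: row2P; rewrite !mxE; ring.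
have wa : w - (z + a) = u *: dir p e2 by rewrite za /w /point addrC addKr.
have wb : w - (z + b) = v *: dir p f2 by rewrite zb wf /point addrC addKr.
have dab : det2 a b = (1 - t) * (1 - s) * det2 (dir p e1) (dir p f1).
  by rewrite /a /b det2Zl det2Zr mulrA.
have dw : det2 (w - (z + a)) (w - (z + b)) = u * v * det2 (dir p e2) (dir p f2).
  by rewrite wa wb det2Zl det2Zr mulrA.
have t1' : 0 < 1 - t by rewrite subr_gt0.
have s1' : 0 < 1 - s by rewrite subr_gt0.
have dn : det2 a b != 0 by rewrite dab !mulf_neq0 // gt_eqF.
pose al := det2 (w - z) b / det2 a b; pose be := det2 a (w - z) / det2 a b.
have wE : w = z + al *: a + be *: b.
  rewrite /al /be; move: dn; rewrite /det2; move: (a) (b) (w) (z) => a' b' w' z' dn.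
  by apply: row2P; rewrite !mxE; field.
have dE : det2 (w - (z + a)) (w - (z + b)) = (1 - al - be) * det2 a b.
  by rewrite {1 2}wE /det2 !mxE; ring.
have nE1 k m : 0 <= k <= u^-1 -> 0 <= m <= 1 ->
    z + a + k *: (w - (z + a)) <> z + m *: b.
  move=> /andP[k0 k1] /andP[m0 m1] E.
  have Bm : B (z + m *: b).
    by apply: (@convex_between _ _ convexB _ _ 1) => //; rewrite ?scale1r ?zb ?m0.
  apply: (no_meet_e2f1 Bm).
    exists (k * u); last by rewrite -E wa za /point scalerA.
    by rewrite mulr_ge0 ?(ltW u0) //= -ler_pdivlMr // div1r.
  exists (s + m * (1 - s)).
    by apply: (lerp_in (rho := 0)); rewrite ?mul0r ?oppr0 ?m0 ?m1 ?(ltW s0).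
  by rewrite zf /b /point; apply: row2P; rewrite !mxE; ring.
pose rho := t / (1 - t).
have rho0 : 0 < rho by rewrite divr_gt0.
have rhoE : rho * (1 - t) = t by rewrite divfK // gt_eqF.
have nE2 k m : 0 <= k <= 1 -> - rho <= m <= 1 ->
    z + b + k *: (w - (z + b)) <> z + m *: a.
  move=> k01 /andP[m0 m1] E.
  have Bm : B (z + m *: a) by rewrite -E; apply: convexB; rewrite ?zb.
  case/andP: k01 => k0 k1; apply: (no_meet_e1f2 Bm).
    exists (t + m * (1 - t)).
      by apply: (lerp_in (rho := rho)); rewrite ?rhoE ?m0.
    by rewrite /z /a /point; apply: row2P; rewrite !mxE; ring.
  exists (k * v); last by rewrite -E wb zb /point scalerA.
  by rewrite mulr_ge0 ?(ltW v0) //= mulr_ile1 // ltW.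
have [nB1 nB2 nB3 nB4] := nB.
have corner : ~ (al + be < 1).
  move=> ab1; apply: (bigon_corner convexB wE ab1 (l := u^-1) (rho := rho)) => //.
  - by rewrite invf_gt1.
  - by rewrite za.
  - by rewrite zb.
  - rewrite wa scalerA mulVf ?gt_eqF // scale1r za => h; apply: nB3.
    by rewrite -(point1 p e2) /point scale1r.
  - have -> // : z - rho *: a = p e1.
    by rewrite /z /a /point scalerA rhoE addrK.
have ab : 1 - al - be <= 0.
  rewrite leNgt; apply/negP => h; apply: corner.
  by rewrite -subr_gt0 opprD addrA.
move: dE; rewrite dw dab => dE.
have uv : 0 < u * v by rewrite mulr_gt0.
have ts : 0 < (1 - t) * (1 - s) by rewrite mulr_gt0.
move: dE d1 d2; clear -ab uv ts; set D1 := det2 _ (dir p f1); set D2 := det2 _ (dir p f2).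
move: (u * v) ((1 - t) * (1 - s)) (1 - al - be) uv ts ab => x y c x0 y0 c0 E.
rewrite !neq_lt => /orP[n1|p1] /orP[n2|p2].
- exfalso; have : 0 <= c * (y * D1) by rewrite mulr_le0 // ltW // pmulr_rlt0.
  by rewrite -E leNgt pmulr_rlt0 // n2.
- by rewrite p2 -leNgt ltW.
- by rewrite p1; apply/negbTE; rewrite -leNgt ltW.
- exfalso; have : c * (y * D1) <= 0 by rewrite mulr_le0_ge0 // ltW // pmulr_rgt0.
  by rewrite -E leNgt pmulr_rgt0 // p2.
Qed.

Let distinct : uniq [:: e1; e2; f1; f2].
Proof.
have d1 : e1 != e2 by rewrite -next_e eq_sym next_neq.
have d2 : f1 != f2 by rewrite -next_f eq_sym next_neq.
by case: (c1) => h1 _ _ _; case: (c2) => h2 _ _ _; rewrite /= !inE !negb_or d1 d2 h1 h2 e12 e21.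
Qed.

(** Past its first corner the edge stays in the disc, where only the other edges of
the bigon are seen. *)
Let clear1 x g x' : x = e1 /\ g = f1 /\ x' = e2 \/ x = f1 /\ g = e1 /\ x' = f2 ->
  exists2 a, 0 <= a < par p x g & forall y, crosses p x y -> y != g -> par p x y < a.
Proof.
move=> hx; have cr : crosses p x g by case: hx => -[-> [-> _]] //; exact: crossesC.
have nx : next S x = x' by case: hx => -[-> [_ ->]].
have Bz : B (point p x (par p x g)).
  have [h1 h2] := segment_crossing hp cr.
  by case: hx h1 h2 => -[-> [-> _]] h1 h2; [exact: B1|exact: B1].
have Bn : B (point p x 1) by rewrite point1 nx; case: hx => -[_ [_ ->]].
have /andP[p0 p1] := par_in01 hp cr.
have [a a01 ha] := gap_below [seq par p x y | y <- enum (edge S) & `[< crosses p x y >]] p0.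
exists a => // y cy yg; apply: ha.
  by apply/mapP; exists y; rewrite // mem_filter mem_enum andbT; apply/asboolP.
rewrite ltNge; apply/negP => le.
have /andP[q0 q1] := par_in01 hp cy.
have By : B (point p x (par p x y)).
  by apply: (through_convex convexB Bz Bn); rewrite le ltW.
have [s1 s2] := segment_crossing hp cy.
have yI : y \in [:: e1; e2; f1; f2].
  by apply/negP => /negP /others /(_ s2).
have [/eqP h1 /eqP h2 /eqP h3 _] := cy.
case: hx => -[Ex [Eg Ex']]; subst x g x'; move: yI yg; rewrite !inE => /or4P[] /eqP E; subst y;
  rewrite ?eqxx // => _.
exact/n21/crossesC.
Qed.

Let clear2 x g : x = e2 /\ g = f2 \/ x = f2 /\ g = e2 ->
  exists2 b, par p x g < b <= 1 & forall y, crosses p x y -> y != g -> b < par p x y.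
Proof.
move=> hx; have cr : crosses p x g by case: hx => -[-> ->] //; exact: crossesC.
have Bz : B (point p x (par p x g)).
  have [h1 h2] := segment_crossing hp cr.
  by case: hx h1 h2 => -[-> ->] h1 h2; [exact: B2|exact: B2].
have Bn : B (point p x 0) by rewrite point0; case: hx => -[-> _].
have /andP[p0 p1] := par_in01 hp cr.
have [b b01 hb] := gap_above [seq par p x y | y <- enum (edge S) & `[< crosses p x y >]] p1.
exists b => // y cy yg; apply: hb.
  by apply/mapP; exists y; rewrite // mem_filter mem_enum andbT; apply/asboolP.
rewrite ltNge; apply/negP => le.
have /andP[q0 q1] := par_in01 hp cy.
have By : B (point p x (par p x y)).
  by apply: (through_convex convexB Bn Bz); rewrite le ltW.
have [s1 s2] := segment_crossing hp cy.
have yI : y \in [:: e1; e2; f1; f2].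
  by apply/negP => /negP /others /(_ s2).
have [/eqP h1 /eqP h2 /eqP h3 _] := cy.
case: hx => -[Ex Eg]; subst x g; move: yI yg; rewrite !inE => /or4P[] /eqP E; subst y;
  rewrite ?eqxx // => _.
exact/n12/crossesC.
Qed.

Lemma colorings_RV : i e1 f1 <> Sing -> i e2 f2 = Sing -> j e1 f1 = Sing ->
  j e2 f2 <> Sing -> positive_crossing p i e1 f1 = positive_crossing p j e2 f2 ->
  (forall x y, (x, y) \notin [:: (e1, f1); (f1, e1); (e2, f2); (f2, e2)] ->
      j x y = i x y) ->
  #|colorings (Diagram hq) Q| = #|colorings (Diagram hp) Q|.
Proof.
move=> i1 i2 j1 j2 pos same.
have turns := bigon_turns.
have d21 : det2 (dir p f1) (dir p e1) != 0 by apply: (crosses_det hp); exact: crossesC.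
have vE : j e2 f2 = opposite (i e1 f1).
  have t1 := @turnC _ _ (gauss_of hp) e1 f1 (asboolT c1).
  have t2 := @turnC _ _ (gauss_of hp) e2 f2 (asboolT c2).
  move: pos; rewrite /positive_crossing /= in t1 t2 *; rewrite t1 t2 turns.
  by case: (i e1 f1) i1 (j e2 f2) j2 => // _ [] // _; case: (0 < _).
have [ae /andP[ae0 ae1] he1] := clear1 (or_introl (conj erefl (conj erefl erefl))).
have [af /andP[af0 af1] hf1] := clear1 (or_intror (conj erefl (conj erefl erefl))).
have [be /andP[be0 be1] he2] := clear2 (or_introl (conj erefl erefl)).
have [bf /andP[bf0 bf1] hf2] := clear2 (or_intror (conj erefl erefl)).
have /andP[t0 t1] := par_in01 hp c1; have /andP[s0 s1] := par_in01 hp (crossesC c1).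
have /andP[u0 u1] := par_in01 hp c2; have /andP[v0 v1] := par_in01 hp (crossesC c2).
have we : [/\ 0 <= ae, ae < 1, 0 < be & be <= 1] by split=> //; lra.
have wf : [/\ 0 <= af, af < 1, 0 < bf & bf <= 1] by split=> //; lra.
have ts k (hk : regular p k) : twist_state e1 e2 f1 f2 ae be af bf
    (0 < det2 (dir p e1) (dir p f1)) (gauss_of hk) (k e1 f1) (k e2 f2).
  split=> //=; try exact/asboolP.
  - move=> x /asboolP cr; have [//|xn] := eqVneq x f1.
    by rewrite leNgt (he1 x).
  - move=> x /asboolP cr; have [//|xn] := eqVneq x f2.
    by rewrite ltNge ltW // (he2 x).
  - move=> x /asboolP cr; have [//|xn] := eqVneq x e1.
    by rewrite leNgt (hf1 x).
  - move=> x /asboolP cr; have [//|xn] := eqVneq x e2.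
    by rewrite ltNge ltW // (hf2 x).
have tsp := ts i hp; have tsq := ts j hq; rewrite i2 in tsp; rewrite j1 vE in tsq.
have [sim sim'] := twist_simulates Q distinct next_e next_f we wf i1 tsp tsq.
pose N x y := (x, y) \in [:: (e1, f1); (f1, e1); (e2, f2); (f2, e2)].
have N1 x y : N x y -> [\/ x = e1 /\ y = f1, x = f1 /\ y = e1,
    x = e2 /\ y = f2 | x = f2 /\ y = e2].
  rewrite /N !inE => /or4P[] /eqP [-> ->];
    [constructor 1|constructor 2|constructor 3|constructor 4]; by [].
have ne (x y : edge S) : x != y -> (y == x) = false by rewrite eq_sym => /negbTE.
have [[m1 m2] [m3 m4] [m5 m6]] : [/\ (e2 == e1) = false /\ (f1 == e1) = false,
    (f1 == e2) = false /\ (f2 == e1) = false & (f2 == e2) = false /\ (f2 == f1) = false].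
  move: distinct; rewrite /= !inE !negb_or.
  move=> /and4P[/and3P[h1 h2 h3] /andP[h4 h5] h6 _].
  by split; split; exact: ne.
have n3 x : next S x = e2 -> x = e1 by rewrite -next_e => /nextI.
have n4 x : next S x = f2 -> x = f1 by rewrite -next_f => /nextI.
apply: (@colorings_replacement _ _ _ _ _ _ hp hq _ Q N
  (twist_enter e1 e2 f1 f2 ae be af bf) (twist_leave e1 e2 f1 f2 ae be af bf)) => //.
- have inN x y : N x y -> twist_enter e1 e2 f1 f2 ae be af bf x <= par p x y <
      twist_leave e1 e2 f1 f2 ae be af bf x.
    move=> /N1[] [-> ->]; rewrite /twist_enter /twist_leave /= ?m1 ?m2 ?m3 ?m4 ?m5 ?m6 ?eqxx /=; lra.
  split=> //=.
  - by move=> x y _ n; rewrite same.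
  - move=> x y /asboolP cr n; rewrite /twist_enter /twist_leave /=.
    have [Ex|_] := eqVneq x e1.
      subst x; left; apply: he1 => //; apply: contra n => /eqP ->.
      by rewrite /N !inE eqxx.
    have [Ex|_] := eqVneq x e2.
      subst x; right; apply: he2 => //; apply: contra n => /eqP ->.
      by rewrite /N !inE eqxx !orbT.
    have [Ex|_] := eqVneq x f1.
      subst x; left; apply: hf1 => //; apply: contra n => /eqP ->.
      by rewrite /N !inE eqxx !orbT.
    have [Ex|_] := eqVneq x f2.
      subst x; right; apply: hf2 => //; apply: contra n => /eqP ->.
      by rewrite /N !inE eqxx !orbT.
    by right; case/andP: (par_in01 hp cr).
  - by move=> x y _; exact: inN.
  - by move=> x y _; exact: inN.
  - by move=> x y; apply/idP/idP => /N1[] [-> ->]; rewrite /N !inE !eqxx ?orbT.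
- by move=> x; apply: window_bounds => /=; do ![split] => //; lra.
- move=> x; rewrite /twist_enter /twist_leave /=.
  have [->|x1] := eqVneq x e1.
    by rewrite next_e m1 eqxx /=; apply/idP/idP => _; lra.
  have [->|x3] := eqVneq x f1.
    by rewrite next_f m3 m4 m5 m6 eqxx /=; apply/idP/idP => _; lra.
  have -> : (next S x == e2) = false by apply/eqP => /n3/eqP; rewrite (negbTE x1).
  have -> : (next S x == f2) = false by apply/eqP => /n4/eqP; rewrite (negbTE x3).
  have En : (if next S x == e1 then (ae, 2 : R) else
    if next S x == f1 then (af, 2 : R) else (0 : R, 0 : R)).1 < 0 = false :> bool.
    case: ifP => _ /=; first by rewrite ltNge ae0.
    by case: ifP => _ /=; rewrite ?ltxx // ltNge af0.
  rewrite /= En; case: eqP => _ /=; first by rewrite ltNge be1.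
  by case: eqP => _ /=; rewrite ltNge ?bf1 ?ler01.
- exact: (twist_deterministic distinct next_e next_f we wf tsp).
- exact: (twist_deterministic distinct next_e next_f we wf tsq).
Qed.

End TwistMove.

Lemma colorings_reidemeister (R : realType) (S : skeleton) (p q : position R S)
    (i j : layering S) (hp : regular p i) (hq : regular q j) (X : finType)
    (Q : disingquandle X) : mixed_distributive Q -> reidemeister p i q j ->
  #|colorings (Diagram hq) Q| = #|colorings (Diagram hp) Q|.
Proof.
move=> mix rm; case: rm hp hq => {p q i j}.
- move=> p q i B e1 e2 e3 sm _ _ nS hp hq; exact: colorings_RI sm nS.
- move=> p q i B e1 e2 f sm h1 h2 h3 h4 h5 h6 hp hq.
  exact: colorings_RII sm h1 h2 h3 h4 h5 h6.
- move=> p q i B e1 e2 f g sl _ hp hq; apply: colorings_slide mix sl _; by left.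
- move=> p q i B e1 e2 f g sl _ hp hq; apply: colorings_slide mix sl _; by left.
- move=> p q i B e1 e2 f g sl h hp hq; apply: colorings_slide mix sl _; by right.
- move=> p i j B e1 e2 f1 f2 h1 h2 h3 [h4 h5 h6 h7] h8 h9 [h10 h11] h12 h13 h14 h15
    h16 h17 h18 h19 hp hq.
  exact: (colorings_RV hp hq Q h1 h2 h3 h4 h5 h6 h7 h8 h9 h10 h11 h12 h13).
Qed.

Lemma colorings_move (R : realType) (D D' : diagram R) (X : finType)
    (Q : disingquandle X) : mixed_distributive Q -> move D D' ->
  #|colorings D' Q| = #|colorings D Q|.
Proof.
move=> mix; case=> {D D'} => [D D'|D D'|S p q i hp hq|S p q i j hp hq].
- exact: colorings_relabeling.
- exact: colorings_subdivision.
- exact: colorings_deformation.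
- exact: colorings_reidemeister.
Qed.

Theorem theorem5p2 (R : realType) (X : finType) (Q : disingquandle X)
    (Qmix : mixed_distributive Q) (D D' : diagram R) :
  equivalent D D' ->
  #|colorings D' Q| = #|colorings D Q|.
Proof.
elim=> {D D'} [D D'|D|D D' _ IH|D D1 D' _ IH1 _ IH2].
- exact: colorings_move.
- by [].
- by rewrite IH.
- by rewrite IH2.
Qed.
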